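(* Let $n \geq 3$, $n > d \geq 2$. Let $U \subset \mathbb{R}^d \times \mathbb{C}^{n-d}$ be a connected open set and let $f \colon U \to \mathbb{C}^n$ be a real-analytic CR map that is a diffeomorphism onto its image $M = f(U)$. Let $S \subset M$ be the CR singular set of $M$ and suppose that $M$ is generic at some point. (i) If $(x,\xi)$ are the coordinates in $\mathbb{R}^d \times \mathbb{C}^{n-d}$, then the set $f^{-1}(S)$ is locally the zero set of a real-analytic function that is holomorphic in $\xi$. (ii) If $L$ is a leaf of $M$, then $S \cap L$ is either empty or a complex analytic variety of dimension $n-d$ or $n-d-1$. (iii) If $S \cap L$ is of dimension $n-d-1$ (where $L$ is a leaf of $M$), then $S$ must intersect all the leaves in some neighborhood of $L$.
   Context: For a real submanifold $M \subset \mathbb{C}^n$ of real codimension $d$ and $q \in M$, $T^{0,1}_qM$ denotes the space of antiholomorphic vectors in $\mathbb{C}\otimes T_q\mathbb{C}^n$ that are tangent to $M$. $M$ is generic at $p$ if $\dim_{\mathbb{C}} T^{0,1}_qM = n-d$ for all $q \in M$ near $p$. A CR singular point of $M$ is a point of discontinuity of $q \mapsto \dim_{\mathbb{C}} T^{0,1}_qM$; the CR singular set is the set of all such points. $\mathbb{R}^d\times\mathbb{C}^{n-d}\subset\mathbb{C}^d\times\mathbb{C}^{n-d}=\mathbb{C}^n$ is regarded as a generic submanifold; $f$ is CR if $\partial f/\partial\bar\xi_k=0$ for all $k$, i.e. $f$ is holomorphic in $\xi$. A leaf of $M$ is the image under $f$ of a leaf of the Levi foliation $\{x=\text{const}\}$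 of $U$; the leaves are complex submanifolds of complex dimension $n-d$ that foliate $M$ (also near points of $S$). *)

(* Defs.v *)
From HB Require Import structures.
From mathcomp Require Import all_boot all_order all_algebra.
From mathcomp Require Import complex.
From mathcomp Require Import all_classical all_reals all_analysis.
Set Implicit Arguments.
Unset Strict Implicit.
Unset Printing Implicit Defensive.
Import Order.TTheory GRing.Theory Num.Theory.
Import numFieldNormedType.Exports.
Local Open Scope classical_set_scope.
Local Open Scope complex_scope.
Local Open Scope ring_scope.

(* The usual topology of the complex numbers, and their structure of normed
   space over themselves; differentiability over R[i] is complex
   differentiability. *)
HB.instance Definition _ (R : rcfType) := NormedModule.copy R[i] R[i]^o.

Section RealCoordinates.
Variable R : realType.
Local Notation C := R[i].

(* C^k is identified with R^(k + k) by z = x + iy <-> (x, y), and R^d x C^m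
   with R^(d + (m + m)) by (x, u + iv) <-> (x, u, v). *)
Definition realify k (z : 'rV[C]_k) : 'rV[R]_(k + k) :=
  row_mx (map_mx (@complex.Re R) z) (map_mx (@complex.Im R) z).

Definition complexify k (w : 'rV[R]_(k + k)) : 'rV[C]_k :=
  \row_j (lsubmx w 0 j +i* rsubmx w 0 j).

Definition to_real d m (p : 'rV[R]_d * 'rV[C]_m) : 'rV[R]_(d + (m + m)) :=
  row_mx p.1 (realify p.2).

Definition of_real d m (w : 'rV[R]_(d + (m + m))) : 'rV[R]_d * 'rV[C]_m :=
  (lsubmx w, complexify (rsubmx w)).

Lemma realifyK k : cancel (@realify k) (@complexify k).
Proof.
by move=> z; apply/rowP => j; rewrite mxE row_mxKl row_mxKr !mxE; case: (z _ _).
Qed.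

Lemma complexifyK k : cancel (@complexify k) (@realify k).
Proof.
move=> w; rewrite /realify -[RHS]hsubmxK; congr row_mx;
  by apply/rowP => j; rewrite !mxE.
Qed.

Lemma to_realK d m : cancel (@to_real d m) (@of_real d m).
Proof. by case=> x z; rewrite /of_real /to_real row_mxKl row_mxKr realifyK. Qed.

Lemma of_realK d m : cancel (@of_real d m) (@to_real d m).
Proof. by move=> w; rewrite /to_real /of_real /= complexifyK hsubmxK. Qed.

End RealCoordinates.

Section RealAnalytic.
Variable R : realType.
Local Notation C := R[i].

Definition monomial N (x : 'rV[R]_N) (alpha : {ffun 'I_N -> nat}) : R :=
  \prod_i x 0 i ^+ alpha i.

(* the sum over the multi-indices in {0, ..., M - 1}^N *)
Definition box_sum N (u : {ffun 'I_N -> nat} -> C) (M : nat) : C :=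
  \sum_(beta : {ffun 'I_N -> 'I_M}) u [ffun i => nat_of_ord (beta i)].

Definition abs_converges_to N (u : {ffun 'I_N -> nat} -> C) (s : C) : Prop :=
  (exists B : R, forall M, box_sum (fun alpha => `|u alpha|) M <= B%:C) /\
  (box_sum u @ \oo --> s).

Definition analytic_at N (phi : 'rV[R]_N -> C) (a : 'rV[R]_N) : Prop :=
  exists c : {ffun 'I_N -> nat} -> C,
    \forall x \near a,
      abs_converges_to (fun alpha => c alpha * (monomial (x - a) alpha)%:C)
                       (phi x).

Definition real_analytic_on d m (U : set ('rV[R]_d * 'rV[C]_m))
    (h : 'rV[R]_d * 'rV[C]_m -> C) : Prop :=
  forall p, U p -> analytic_at (h \o @of_real R d m) (to_real p).

End RealAnalytic.

Section CRFunctions.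
Variable R : realType.
Local Notation C := R[i].

Definition Dreal N (phi : 'rV[R]_N -> C) (v a : 'rV[R]_N) : C :=
  'D_v (fun x => complex.Re (phi x)) a +i* 'D_v (fun x => complex.Im (phi x)) a.

(* d/d(conj xi_k) = (d/du_k + i d/dv_k) / 2, where xi_k = u_k + i v_k *)
Definition dbar d m (k : 'I_m) (h : 'rV[R]_d * 'rV[C]_m -> C)
    (p : 'rV[R]_d * 'rV[C]_m) : C :=
  let phi := h \o @of_real R d m in
  let a := to_real p in
  2^-1 * (Dreal phi (delta_mx 0 (rshift d (lshift m k))) a +
          'i * Dreal phi (delta_mx 0 (rshift d (rshift m k))) a).

Definition real_analytic_map d m n (U : set ('rV[R]_d * 'rV[C]_m))
    (f : 'rV[R]_d * 'rV[C]_m -> 'rV[C]_n) : Prop :=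
  forall j : 'I_n, real_analytic_on U (fun p => f p 0 j).

Definition CR_map d m n (U : set ('rV[R]_d * 'rV[C]_m))
    (f : 'rV[R]_d * 'rV[C]_m -> 'rV[C]_n) : Prop :=
  forall p, U p -> forall (j : 'I_n) (k : 'I_m),
    dbar k (fun q => f q 0 j) p = 0.

Definition holomorphic_in_xi d m (U : set ('rV[R]_d * 'rV[C]_m))
    (h : 'rV[R]_d * 'rV[C]_m -> C) : Prop :=
  forall p, U p -> differentiable (fun xi : 'rV[C]_m => h (p.1, xi)) p.2.

End CRFunctions.

Section Diffeomorphisms.
Variable R : realType.
Local Notation C := R[i].

Fixpoint Ck_on N K (k : nat) (A : set 'rV[R]_N) (g : 'rV[R]_N -> 'rV[R]_K) :
    Prop :=
  if k is k'.+1 then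
    (forall x, A x -> differentiable g x) /\
    (forall v : 'rV[R]_N, Ck_on k' A (fun x => 'D_v g x))
  else forall x, A x -> {for x, continuous g}.

Definition smooth_on N K (A : set 'rV[R]_N) (g : 'rV[R]_N -> 'rV[R]_K) : Prop :=
  forall k, Ck_on k A g.

(* A map between subsets of Euclidean spaces is smooth if it extends smoothly to
   a neighborhood of each point; this is required of the inverse F(A) -> A. *)
Definition diffeo_onto_image N K (A : set 'rV[R]_N)
    (F : 'rV[R]_N -> 'rV[R]_K) : Prop :=
  [/\ smooth_on A F, set_inj A F &
    forall a, A a -> exists (W : set 'rV[R]_K) (g : 'rV[R]_K -> 'rV[R]_N),
      [/\ open W, W (F a), smooth_on W g &
        forall x, A x -> W (F x) -> g (F x) = x]].

Definition mixed_diffeo_onto_image d m n (U : set ('rV[R]_d * 'rV[C]_m))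
    (f : 'rV[R]_d * 'rV[C]_m -> 'rV[C]_n) : Prop :=
  diffeo_onto_image (@of_real R d m @^-1` U)
                    (@realify R n \o f \o @of_real R d m).

End Diffeomorphisms.

Section CRStructure.
Variable R : realType.
Local Notation C := R[i].

(* velocities at q of curves in M through q *)
Definition tangent_space n (M : set 'rV[C]_n) (q : 'rV[C]_n) :
    set 'rV[R]_(n + n) :=
  [set v | exists gamma : R -> 'rV[R]_(n + n),
    [/\ gamma 0 = realify q,
        \forall t \near (0 : R), M (complexify (gamma t)) &
        is_derive (0 : R) 1 gamma v]].

(* C (x) T, for T a real linear subspace of R^N *)
Definition complexification N (T : set 'rV[R]_N) : set 'rV[C]_N :=
  [set w | exists u v, [/\ T u, T v &
    w = map_mx (real_complex R) u + 'i *: map_mx (real_complex R) v]].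

(* coordinates of sum_j c_j d/d(conj z_j), with respect to the d/dx_j and the
   d/dy_j, in C (x) T_q(C^n) = C^(n + n) *)
Definition antiholomorphic_vector n (c : 'rV[C]_n) : 'rV[C]_(n + n) :=
  row_mx (2^-1 *: c) ((2^-1 * 'i) *: c).

Definition T01 n (M : set 'rV[C]_n) (q : 'rV[C]_n) : set 'rV[C]_n :=
  [set c | complexification (tangent_space M q) (antiholomorphic_vector c)].

(* the largest number of linearly independent vectors in V *)
Definition cdim n (V : set 'rV[C]_n) : nat :=
  \max_(r < n.+1 | `[< exists B : 'M[C]_(r, n),
                         row_free B /\ forall i, V (row i B) >]) r.

Definition dim_T01 n (M : set 'rV[C]_n) (q : 'rV[C]_n) : nat := cdim (T01 M q).

Definition generic_at n (d : nat) (M : set 'rV[C]_n) (p : 'rV[C]_n) : Prop :=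
  M p /\ \forall q \near p, M q -> dim_T01 M q = (n - d)%N.

Definition CR_singular_set n (M : set 'rV[C]_n) : set 'rV[C]_n :=
  [set q | M q /\ ~ (dim_T01 M x @[x --> within M (nbhs q)] --> dim_T01 M q)].

End CRStructure.

Section Leaves.
Variable R : realType.
Local Notation C := R[i].

(* the leaf through p of the foliation {x = const} of U *)
Definition Levi_leaf d m (U : set ('rV[R]_d * 'rV[C]_m))
    (p : 'rV[R]_d * 'rV[C]_m) : set ('rV[R]_d * 'rV[C]_m) :=
  connected_component (U `&` [set q | q.1 = p.1]) p.

Definition is_leaf d m n (U : set ('rV[R]_d * 'rV[C]_m))
    (f : 'rV[R]_d * 'rV[C]_m -> 'rV[C]_n) (L : set 'rV[C]_n) : Prop :=
  exists2 p, U p & L = f @` Levi_leaf U p.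

End Leaves.

Section AnalyticVarieties.
Variable R : realType.
Local Notation C := R[i].

Definition holomorphic_on n l (V : set 'rV[C]_n) (g : 'rV[C]_n -> 'rV[C]_l) :
    Prop :=
  forall z, V z -> differentiable g z.

(* The functions live on open sets V of the ambient space: when L is a complex
   submanifold, its local equations can be included among those of X, and this
   says that X is a (relatively closed) complex analytic subvariety of L. *)
Definition analytic_subvariety n (L X : set 'rV[C]_n) : Prop :=
  X `<=` L /\
  forall p, L p -> exists (V : set 'rV[C]_n) (l : nat)
      (g : 'rV[C]_n -> 'rV[C]_l),
    [/\ open V, V p, holomorphic_on V g & X `&` V = V `&` [set z | g z = 0]].

(* near p, X is a complex submanifold of dimension r *)
Definition regular_point n (X : set 'rV[C]_n) (r : nat) (p : 'rV[C]_n) : Prop :=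
  [/\ (r <= n)%N, X p &
    exists (V : set 'rV[C]_n) (g : 'rV[C]_n -> 'rV[C]_(n - r)),
      [/\ open V, V p, holomorphic_on V g,
          X `&` V = V `&` [set z | g z = 0] & \rank ('J g p) = (n - r)%N]].

(* the dimension of a variety is the largest dimension at its regular points *)
Definition variety_dim n (X : set 'rV[C]_n) (r : nat) : Prop :=
  (exists p, regular_point X r p) /\
  (forall s p, regular_point X s p -> (s <= r)%N).

End AnalyticVarieties.

(* Main.v *)
Require Import Defs.
From HB Require Import structures.
From mathcomp Require Import all_boot all_order all_algebra.
From mathcomp Require Import complex ring lra zify.
From mathcomp Require Import all_classical all_reals all_analysis.
Set Implicit Arguments.
Unset Strict Implicit.
Unset Printing Implicit Defensive.
Import Order.TTheory GRing.Theory Num.Theory.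
Import numFieldNormedType.Exports.
Local Open Scope classical_set_scope.
Local Open Scope complex_scope.
Local Open Scope ring_scope.

(** Write [m] for [n - d]. The image [M] is parametrized by [f], so its tangent
    spaces are the images of the real differential of [f], and a linear
    computation gives [dim T01 = N - rank J] at a point of [M], where
    [N = d + 2 m] and [J] is the matrix of the derivatives of the complex
    components of [f] along the real coordinates. By the Cauchy-Riemann equations
    the derivatives along [Im xi] are multiples of those along [Re xi], so [J] can
    be replaced by the square matrix of the derivatives along [x] and [Re xi], and
    the dimension is [m] exactly where its determinant [h] (called [degeneracy])
    is nonzero. The function [h] is real-analytic and holomorphic in [xi]. As [M]
    is generic somewhere, [h] is not identically 0, hence vanishes on no open set;
    therefore the dimension jumps at each zero of [h], and [f^-1(S)] is the zero
    set of [h] ([CR_singularE]). This is (i).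

    On a leaf [L], parametrized by [xi], the set [S] is the zero set of the
    holomorphic function [g = h(x0, .)]. Around each of its points the leaf can be
    straightened: there are holomorphic coordinates of C^n in which the leaf is a
    coordinate plane ([leaf_straightening], from the holomorphic inverse function
    theorem), so subvarieties of the parameter domain become subvarieties of the
    leaf. If [g] has no zero the intersection is empty; if [g] is identically 0 it
    is the whole leaf, of dimension [m]. Otherwise it has a regular point of
    dimension [m - 1]: choose a zero of least order, and an iterated derivative
    [u] of order one less; then [u] vanishes on all the zeros of [g], has nonzero
    differential at the chosen zero, and Hurwitz's theorem on complex lines
    transverse to [u = 0] shows that nearby the zeros of [u] are zeros of [g]
    ([leaf_zero_structure]). Dimension [m] is impossible at a regular point, since
    [g] would vanish on an open part of the leaf and, by the identity theorem, on
    the leaf ([leaf_dim_bound]). This is (ii).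

    For (iii), the same use of Hurwitz's theorem with [x] as a parameter gives
    zeros of [h(x, .)] near the chosen zero for all [x] near [x0], so all leaves
    passing near one point of [L] meet [S]; this property propagates along the
    connected leaf, because a leaf that passes near a point of [L] also passes near
    the neighboring points ([singular_leaves_near]).

    The complex analysis used here is developed for the modulus and differential
    of normed spaces over [R[i]], starting from Goursat's theorem: functions are
    only assumed differentiable at each point. Instead of Cauchy's formula, the
    estimate [cauchy_center] of the value at the center of a square by the values
    on its border is enough; it gives Hurwitz's theorem ([zero_in_square]) and,
    applied to high powers, strict differentiability ([holo_strict]), on which the
    inverse function theorem rests. Real-analytic functions are handled through
    sums of unordered families, which allow series to be multiplied and
    differentiated term by term. *)

(** * Moduli and differentiability *)

Section Magnitude.
Variable R : realType.
Local Notation C := R[i].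
Implicit Types V W : normedModType C.

(** The norm of a space over the complex numbers has complex values; its real
    part allows estimates in the ordered field [R]. *)
Definition mag V (v : V) : R := complex.Re `|v|.

Lemma magE V (v : V) : `|v| = (mag v)%:C.
Proof. by rewrite /mag RRe_real ?normr_real. Qed.

Lemma mag_ge0 V (v : V) : 0 <= mag v.
Proof. by rewrite -ler0c -magE. Qed.

Lemma magD V (v w : V) : mag (v + w) <= mag v + mag w.
Proof. by rewrite -lecR rmorphD /= -!magE ler_normD. Qed.

Lemma magN V (v : V) : mag (- v) = mag v.
Proof. by rewrite /mag normrN. Qed.

Lemma mag_distC V (v w : V) : mag (v - w) = mag (w - v).
Proof. by rewrite -magN opprB. Qed.

Lemma magZ V (a : C) (v : V) : mag (a *: v) = mag a * mag v.
Proof. by apply: complexI; rewrite rmorphM /= -!magE normrZ. Qed.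

Lemma magM (a b : C) : mag (a * b) = mag a * mag b.
Proof. exact: (@magZ C a b). Qed.

Lemma mag0 V : mag (0 : V) = 0.
Proof. by rewrite /mag normr0. Qed.

Lemma mag1 : mag (1 : C) = 1.
Proof. by rewrite /mag normr1. Qed.

Lemma mag_eq0 V (v : V) : (mag v == 0) = (v == 0).
Proof. by rewrite -[in RHS]normr_eq0 magE (inj_eq (@complexI R)). Qed.

Lemma mag_gt0 V (v : V) : (0 < mag v) = (v != 0).
Proof. by rewrite lt_def mag_eq0 mag_ge0 andbT. Qed.

Lemma magV (a : C) : mag a^-1 = (mag a)^-1.
Proof.
apply: complexI; rewrite -magE normfV magE.
by rewrite -[RHS]/(real_complex R (mag a)^-1) fmorphV.
Qed.

Lemma magX (a : C) k : mag (a ^+ k) = mag a ^+ k.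
Proof. by elim: k => [|k IH]; rewrite ?expr0 ?mag1 // !exprS magM IH. Qed.

Lemma mag_real (x : R) : mag (x%:C : C) = `|x|.
Proof.
rewrite /mag normc_def /= expr0n addr0.
by rewrite sqrtr_sqr.
Qed.

Lemma magB V (u v w : V) : mag (u - w) <= mag (u - v) + mag (v - w).
Proof. by rewrite -[u - w](subrKA v) magD. Qed.

Lemma mag_sub V (u v : V) : mag u - mag v <= mag (u - v).
Proof. by rewrite lerBlDr (le_trans _ (magD _ _)) ?subrK. Qed.

Lemma mag_sum V I (r : seq I) (P : pred I) (F : I -> V) :
  mag (\sum_(i <- r | P i) F i) <= \sum_(i <- r | P i) mag (F i).
Proof.
elim/big_rec2: _ => [|i a v _ IH]; first by rewrite mag0.
exact: (le_trans (magD _ _) (lerD _ _)).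
Qed.

Lemma le_Re_mag (z : C) : `|complex.Re z| <= mag z.
Proof. by rewrite -lecR -magE normc_ge_Re. Qed.

Lemma mag_i : mag ('i : C) = 1.
Proof. by rewrite /mag normc_def /= expr0n expr1n add0r sqrtr1. Qed.

Lemma le_Im_mag (z : C) : `|complex.Im z| <= mag z.
Proof.
have := le_Re_mag (z * 'i%C); rewrite ReiNIm normrN magM.
by rewrite complexiE mag_i mulr1.
Qed.

Lemma mag_le_ReIm (z : C) : mag z <= `|complex.Re z| + `|complex.Im z|.
Proof.
rewrite {1}[z]complexE (le_trans (magD _ _))// magM mag_real mag_real.
by rewrite complexiE mag_i mul1r.
Qed.

Lemma gt0_mag (e : C) : 0 < e -> 0 < complex.Re e /\ e = (complex.Re e)%:C.
Proof.
move=> e0; have eR : (complex.Re e)%:C = e by rewrite RRe_real// gtr0_real.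
by rewrite -ltcR eR.
Qed.

Lemma nbhs_magP V (z : V) (A : set V) :
  nbhs z A <-> exists2 d : R, 0 < d & forall w, mag (w - z) < d -> A w.
Proof.
split.
  case/nbhs_ballP => e /= e0 eA; have [r0 eE] := gt0_mag e0.
  exists (complex.Re e) => // w wz; apply: eA.
  by rewrite -ball_normE /ball_/= distrC magE eE ltcR.
case=> d d0 dA; apply/nbhs_ballP; exists d%:C; first by rewrite /= ltcR.
move=> w; rewrite -ball_normE /ball_/= distrC magE ltcR; exact: dA.
Qed.

Lemma open_magP V (A : set V) :
  open A <-> forall z, A z -> exists2 d : R, 0 < d & forall w, mag (w - z) < d -> A w.
Proof.
rewrite openE; split=> [AO z Az|AO z Az]; first exact/nbhs_magP/AO.
exact/nbhs_magP/AO.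
Qed.

Lemma open_mag_ball V (z : V) (r : R) : open [set w | mag (w - z) < r].
Proof.
apply/open_magP => w /= wz; exists (r - mag (w - z)); first by rewrite subr_gt0.
move=> u uw; rewrite /=; have := magB u w z; lra.
Qed.

Lemma continuous_magP V W (f : V -> W) (z : V) :
  {for z, continuous f} <->
  forall e : R, 0 < e -> exists2 d : R, 0 < d &
    forall w, mag (w - z) < d -> mag (f w - f z) < e.
Proof.
split.
  move=> fz e e0; have : nbhs (f z) [set u | mag (u - f z) < e].
    by apply/nbhs_magP; exists e.
  by move/fz/nbhs_magP.
move=> H A /nbhs_magP [e e0 eA].
have [d d0 dH] := H _ e0; apply/nbhs_magP; exists d => // w wz.
exact/eA/dH.
Qed.

Lemma mag_entry k l (v : 'M[C]_(k, l)) i j : mag (v i j) <= mag v.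
Proof.
rewrite -lecR -!magE [leRHS]/Num.norm /= mx_normE.
by rewrite (bigmaxD1 (i, j)) //= num_max num_le_max lexx.
Qed.

Lemma mag_mx_le k l (v : 'M[C]_(k, l)) (r : R) : 0 <= r ->
  (forall i j, mag (v i j) <= r) -> mag v <= r.
Proof.
move=> r0 H; rewrite -lecR -magE /Num.norm /= mx_normE.
have r0' : 0 <= r%:C :> C by rewrite lecR.
rewrite -[r%:C]/(NngNum r0')%:num num_le.
apply/bigmax_leP; split => [|[i j] _]; first by rewrite -num_le.
by rewrite -num_le /= magE lecR.
Qed.

Lemma mag_mulmx k l p (v : 'M[C]_(k, l)) (A : 'M[C]_(l, p)) :
  mag (v *m A) <= mag v * (l%:R * mag A).
Proof.
apply: mag_mx_le => [|i j]; first by rewrite !mulr_ge0 ?mag_ge0.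
rewrite mxE (le_trans (mag_sum _ _ _))//.
apply: (@le_trans _ _ (\sum_(j0 < l) mag v * mag A)).
  by apply: ler_sum => s _; rewrite magM ler_pM ?mag_ge0 ?mag_entry.
by rewrite sumr_const card_ord -[leLHS]mulr_natl mulrCA.
Qed.

(** The candidate [L] for the differential is an argument, so that a
    differential can be exhibited before it is known to be linear or
    continuous. *)
Definition cdiff V W (f : V -> W) (z : V) (L : V -> W) : Prop :=
  forall e : R, 0 < e -> exists2 d : R, 0 < d &
    forall h, mag h < d -> mag (f (z + h) - f z - L h) <= e * mag h.

Lemma differentiable_cdiff V W (f : V -> W) z :
  differentiable f z -> cdiff f z ('d f z).
Proof.
move=> df e e0; have := diff_locallyxC df.
move=> H.
have : \forall h \near 0, `|f (z + h) - f z - 'd f z h| <= e%:C * `|h|.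
  have /eqaddoP/(_ e%:C) := funext H.
  rewrite ltcR => /(_ e0).
  apply: filterS => h /=.
  by rewrite opprD addrA.
move/nbhs_magP => [d d0 dH]; exists d => // h hd.
have := dH h; rewrite subr0 => /(_ hd).
by rewrite !magE -rmorphM /= lecR.
Qed.

(** The bound [K] provides the continuity of the differential. *)
Lemma cdiff_differentiable V W (f : V -> W) z (L : {linear V -> W}) (K : R) :
  (forall h, mag (L h) <= K * mag h) -> cdiff f z L ->
  differentiable f z /\ 'd f z = L :> (V -> W).
Proof.
move=> LK Lf.
have Lc : continuous L.
  move=> x; apply/continuous_magP => e e0.
  have K0 : 0 < `|K| + 1 by rewrite ltr_wpDl.
  exists (e / (`|K| + 1)); first by rewrite divr_gt0.
  move=> w wx; rewrite -linearB; apply: le_lt_trans (LK _) _.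
  rewrite ltr_pdivlMr // in wx; apply: le_lt_trans wx.
  rewrite mulrC ler_wpM2l ?mag_ge0//.
  by rewrite (le_trans (ler_norm _))// lerDl.
have H : f \o shift z = cst (f z) + L +o_ 0 id.
  apply/eqaddoP => _/posnumP[e].
  have [e0 eE] := gt0_mag [gt0 of e%:num].
  have [d d0 dH] := Lf _ e0.
  apply/nbhs_magP; exists d => // h; rewrite subr0 => hd.
  have := dH h hd; rewrite -lecR rmorphM /= -!magE -eE.
  by rewrite -[(_ - _) h]/(f (h + z) - (f z + L h)) opprD addrA [h + z]addrC.
have dE := diff_unique Lc H.
split=> //; apply/diff_locallyP; rewrite dE; split => //.
Qed.

End Magnitude.

(** * Goursat's theorem and Cauchy's estimate *)

Section SegmentIntegral.
Variable R : realType.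
Local Notation C := R[i].
Local Notation mu := (@lebesgue_measure R).

Definition ccont_on (a b : R) (phi : R -> C) : Prop :=
  forall x, a <= x <= b -> forall e : R, 0 < e ->
    exists2 d : R, 0 < d & forall y, `|y - x| < d -> mag (phi y - phi x) < e.

Definition cint (a b : R) (phi : R -> C) : C :=
  (\int[mu]_(x in `[a, b]) complex.Re (phi x))%R +i*
  (\int[mu]_(x in `[a, b]) complex.Im (phi x))%R.

Lemma ccont_onD a b phi psi : ccont_on a b phi -> ccont_on a b psi ->
  ccont_on a b (fun x => phi x + psi x).
Proof.
move=> cf cg x xab e e0; have e20 : 0 < e / 2 by rewrite divr_gt0.
have [d1 d10 H1] := cf x xab _ e20; have [d2 d20 H2] := cg x xab _ e20.
exists (Num.min d1 d2); first by rewrite lt_min d10.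
move=> y; rewrite lt_min => /andP[/H1 h1 /H2 h2].
rewrite opprD addrACA (le_lt_trans (magD _ _))//; lra.
Qed.

Lemma ccont_onN a b phi : ccont_on a b phi -> ccont_on a b (fun x => - phi x).
Proof.
move=> cf x xab e e0; have [d d0 H] := cf x xab _ e0.
by exists d => // y /H; rewrite -opprD magN.
Qed.

Lemma ccont_sub a b a' b' phi : a <= a' -> b' <= b -> ccont_on a b phi ->
  ccont_on a' b' phi.
Proof. move=> aa bb cf x xab; apply: cf; lra. Qed.

Lemma ccont_on_integrable a b phi : ccont_on a b phi ->
  mu.-integrable `[a, b] (EFin \o (fun x => complex.Re (phi x))) /\
  mu.-integrable `[a, b] (EFin \o (fun x => complex.Im (phi x))).
Proof.
move=> cf; split; apply: continuous_compact_integrable;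
  try exact: segment_compact; apply: continuous_in_subspaceT => x;
  rewrite inE /= in_itv /= => xab; apply/cvgrPdist_lt => e e0;
  have [d d0 H] := cf x xab _ e0; near=> y;
  rewrite distrC -raddfB /=; 
  [apply: le_lt_trans (le_Re_mag _) _|apply: le_lt_trans (le_Im_mag _) _];
  apply: H; rewrite distrC; near: y; exact: cvgr_dist_lt.
Unshelve. all: by end_near. Qed.

Lemma cint_eqD a b phi psi chi : ccont_on a b phi -> ccont_on a b psi ->
  (forall x, a <= x <= b -> chi x = phi x + psi x) ->
  cint a b chi = cint a b phi + cint a b psi.
Proof.
move=> /ccont_on_integrable [f1 f2] /ccont_on_integrable [g1 g2] E.
rewrite /cint; congr (_ +i* _).
  rewrite -RintegralD//; apply: eq_Rintegral => x.
  by rewrite inE /= in_itv /= => /E ->; rewrite raddfD.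
rewrite -RintegralD//; apply: eq_Rintegral => x.
by rewrite inE /= in_itv /= => /E ->; rewrite raddfD.
Qed.

Lemma cint_split a b c phi : a <= b -> b <= c -> ccont_on a c phi ->
  cint a c phi = cint a b phi + cint b c phi.
Proof.
move=> ab bc cf; have [f1 f2] := ccont_on_integrable cf.
have [g1 g2] := ccont_on_integrable (ccont_sub ab (lexx _) cf).
rewrite /cint; congr (_ +i* _).
  rewrite -(@Rintegral_itv_obnd_cbnd _ b); last first.
    by apply: integrableS g1 => //; apply: subset_itvr; rewrite bnd_simp.
  by rewrite -(@Rintegral_itvB _ _ (BLeft a) (BRight c) b) ?bnd_simp// addrC subrK.
rewrite -(@Rintegral_itv_obnd_cbnd _ b); last first.
  by apply: integrableS g2 => //; apply: subset_itvr; rewrite bnd_simp.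
by rewrite -(@Rintegral_itvB _ _ (BLeft a) (BRight c) b) ?bnd_simp// addrC subrK.
Qed.

(** For a function within [e] of a constant [k], comparison with the integrals
    of [k - e] and [k + e]. *)
Lemma Rint_close (a b k e : R) (f : R -> R) : a <= b ->
  mu.-integrable `[a, b] (EFin \o f) ->
  (forall x, a <= x <= b -> `|f x - k| <= e) ->
  `|(\int[mu]_(x in `[a, b]) f x)%R - k * (b - a)| <= e * (b - a).
Proof.
move=> ab fi H.
have cstE (r : R) : (\int[mu]_(x in `[a, b]) r)%R = r * (b - a).
  rewrite Rintegral_cst //= lebesgue_measure_itv /= lte_fin.
  by case: ltgtP ab => //= -> _; rewrite subrr.
have ci (r : R) : mu.-integrable `[a, b] (EFin \o (fun _ : R => r)).
  apply: continuous_compact_integrable; first exact: segment_compact.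
  by apply: continuous_subspaceT => x; apply: cst_continuous.
rewrite ler_distl -mulrBl -mulrDl -!cstE; apply/andP; split.
  apply: le_Rintegral => //.
  by move=> x /=; rewrite in_itv /= => /H; rewrite ler_distl => /andP[].
apply: le_Rintegral => //.
by move=> x /=; rewrite in_itv /= => /H; rewrite ler_distl => /andP[].
Qed.

(** The factor 2 comes from the separate estimates of the real and imaginary
    parts. *)
Lemma cint_close (a b e : R) (k : C) (phi : R -> C) : a <= b ->
  ccont_on a b phi -> (forall x, a <= x <= b -> mag (phi x - k) <= e) ->
  mag (cint a b phi - k * (b - a)%:C) <= 2 * e * (b - a).
Proof.
move=> ab /ccont_on_integrable[f1 f2] H.
apply: le_trans (mag_le_ReIm _) _.
rewrite -mulrA mulr_natl mulr2n; apply: lerD.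
  have -> : complex.Re (cint a b phi - k * (b - a)%:C) =
    (\int[mu]_(x in `[a, b]) complex.Re (phi x))%R - complex.Re k * (b - a).
    by case: (k) => kr ki /=; rewrite mulr0 subr0.
  apply: Rint_close => // x /H; apply: le_trans; rewrite -raddfB; exact: le_Re_mag.
have -> : complex.Im (cint a b phi - k * (b - a)%:C) =
  (\int[mu]_(x in `[a, b]) complex.Im (phi x))%R - complex.Im k * (b - a).
  by case: (k) => kr ki /=; rewrite mulr0 add0r.
apply: Rint_close => // x /H; apply: le_trans; rewrite -raddfB; exact: le_Im_mag.
Qed.

Lemma cint_bound (a b e : R) (phi : R -> C) : a <= b ->
  ccont_on a b phi -> (forall x, a <= x <= b -> mag (phi x) <= e) ->
  mag (cint a b phi) <= 2 * e * (b - a).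
Proof.
move=> ab cf H; have := @cint_close a b e 0 phi ab cf.
rewrite mul0r subr0; apply => x xab; rewrite subr0; exact: H.
Qed.

End SegmentIntegral.

Section Goursat.
Variable R : realType.
Local Notation C := R[i].

Definition in_rect (a b c d : R) : set C :=
  [set z | a <= complex.Re z <= b /\ c <= complex.Im z <= d].

Definition cdiff_at (q : C -> C) (z : C) : Prop :=
  exists l : C, cdiff q z (fun h => l * h).

(** The integral of [q] along the border of the rectangle [[a, b] x [c, d]],
    counterclockwise, with opposite sides grouped. *)
Definition bdint (q : C -> C) (a b c d : R) : C :=
  cint a b (fun x => q (x +i* c) - q (x +i* d)) +
  'i%C * cint c d (fun y => q (b +i* y) - q (a +i* y)).

Lemma cdiff_at_continuous q z : cdiff_at q z ->
  forall e : R, 0 < e -> exists2 d : R, 0 < d &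
    forall w, mag (w - z) < d -> mag (q w - q z) < e.
Proof.
case=> l H e e0; have [d d0 dH] := H 1 ltr01.
pose k := mag l + 2; have k0 : 0 < k by rewrite ltr_wpDl ?mag_ge0.
exists (Num.min d (e / k)); first by rewrite lt_min d0 divr_gt0.
move=> w; rewrite lt_min => /andP[wd we].
have := dH _ wd; rewrite mul1r [z + _]addrC subrK => h1.
have := magD (q w - q z - l * (w - z)) (l * (w - z)); rewrite subrK magM => h2.
apply: (le_lt_trans h2); move: we; rewrite ltr_pdivlMr // => we.
have := mag_ge0 (w - z); rewrite /k in we; have := mag_ge0 l; nra.
Qed.

Lemma ccont_hor q (a b y : R) : (forall x, a <= x <= b -> cdiff_at q (x +i* y)) ->
  ccont_on a b (fun x => q (x +i* y)).
Proof.
move=> H x /H /cdiff_at_continuous K e /K [d d0 dH].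
exists d => // u ux; apply: dH.
have -> : (u +i* y) - (x +i* y) = (u - x)%:C by apply/eqP; rewrite eq_complex /= subrr !eqxx.
by rewrite mag_real.
Qed.

Lemma ccont_ver q (c d x : R) : (forall y, c <= y <= d -> cdiff_at q (x +i* y)) ->
  ccont_on c d (fun y => q (x +i* y)).
Proof.
move=> H y /H /cdiff_at_continuous K e /K [r r0 rH].
exists r => // u uy; apply: rH.
have -> : (x +i* u) - (x +i* y) = 'i%C * (u - y)%:C.
  by apply/eqP; rewrite eq_complex /= !mul0r !mul1r subrr subr0 add0r !eqxx.
by rewrite magM mag_real complexiE mag_i mul1r.
Qed.

Definition on_border (a b c d : R) (z : C) : Prop :=
  [\/ complex.Re z = a, complex.Re z = b, complex.Im z = c | complex.Im z = d].

(** Here and in [bdint_hsplit], the two integrals along the cut cancel. *)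
Lemma bdint_vsplit q a b c d e : a <= e <= b -> c <= d ->
  (forall z, in_rect a b c d z -> complex.Re z = e \/ on_border a b c d z ->
     cdiff_at q z) ->
  bdint q a b c d = bdint q a e c d + bdint q e b c d.
Proof.
move=> /andP[ae eb] cd qd; have ab := le_trans ae eb.
have ver x : a <= x <= b -> [\/ x = a, x = e | x = b] ->
    ccont_on c d (fun y => q (x +i* y)).
  move=> xab xE; apply: ccont_ver => y yd; apply: qd; first by split.
  case: xE => xE /=; [right|left|right] => //; first by constructor 1.
  by constructor 2.
have hor y : c <= y <= d -> y = c \/ y = d ->
    ccont_on a b (fun x => q (x +i* y)).
  move=> ycd yE; apply: ccont_hor => x xab; apply: qd; first by split.
  by right; case: yE; [constructor 3|constructor 4].
have cc : ccont_on a b (fun x => q (x +i* c) - q (x +i* d)).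
  apply: ccont_onD; [|apply: ccont_onN]; apply: hor; rewrite ?lexx ?cd //.
    by left.
  by right.
rewrite /bdint (@cint_split _ a e b) //.
rewrite (@cint_eqD _ c d (fun y => q (e +i* y) - q (a +i* y))
  (fun y => q (b +i* y) - q (e +i* y))).
- by rewrite mulrDr addrACA.
- by apply: ccont_onD; [|apply: ccont_onN]; apply: ver; rewrite ?lexx ?ae ?eb ?ab //;
    [constructor 2|constructor 1].
- by apply: ccont_onD; [|apply: ccont_onN]; apply: ver; rewrite ?lexx ?ae ?eb ?ab //;
    [constructor 3|constructor 2].
- by move=> x _; rewrite [RHS]addrC subrKA.
Qed.

Lemma bdint_hsplit q a b c d e : a <= b -> c <= e <= d ->
  (forall z, in_rect a b c d z -> complex.Im z = e \/ on_border a b c d z ->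
     cdiff_at q z) ->
  bdint q a b c d = bdint q a b c e + bdint q a b e d.
Proof.
move=> ab /andP[ce ed] qd; have cd := le_trans ce ed.
have ver x : a <= x <= b -> x = a \/ x = b ->
    ccont_on c d (fun y => q (x +i* y)).
  move=> xab xE; apply: ccont_ver => y yd; apply: qd; first by split.
  by right; case: xE; [constructor 1|constructor 2].
have hor y : c <= y <= d -> [\/ y = c, y = e | y = d] ->
    ccont_on a b (fun x => q (x +i* y)).
  move=> ycd yE; apply: ccont_hor => x xab; apply: qd; first by split.
  case: yE => xE /=; [right|left|right] => //; first by constructor 3.
  by constructor 4.
have cc : ccont_on c d (fun y => q (b +i* y) - q (a +i* y)).
  apply: ccont_onD; [|apply: ccont_onN]; apply: ver; rewrite ?lexx ?ab //.
    by right.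
  by left.
rewrite /bdint (@cint_split _ c e d) //.
rewrite (@cint_eqD _ a b (fun x => q (x +i* c) - q (x +i* e))
  (fun x => q (x +i* e) - q (x +i* d))).
- by rewrite mulrDr addrACA.
- by apply: ccont_onD; [|apply: ccont_onN]; apply: hor; rewrite ?lexx ?ce ?ed ?cd //;
    [constructor 1|constructor 2].
- by apply: ccont_onD; [|apply: ccont_onN]; apply: hor; rewrite ?lexx ?ce ?ed ?cd //;
    [constructor 2|constructor 3].
- by move=> x _; rewrite subrKA.
Qed.

Section Border.
Variables (a b c d : R).
Hypotheses (ab : a <= b) (cd : c <= d).

Let aI : a <= a <= b. Proof. by rewrite lexx. Qed.
Let bI : a <= b <= b. Proof. by rewrite lexx andbT. Qed.
Let cI : c <= c <= d. Proof. by rewrite lexx. Qed.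
Let dI : c <= d <= d. Proof. by rewrite lexx andbT. Qed.

Let chor q : (forall z, in_rect a b c d z -> on_border a b c d z -> cdiff_at q z) ->
  ccont_on a b (fun x => q (x +i* c) - q (x +i* d)).
Proof.
move=> qd; apply: ccont_onD; [|apply: ccont_onN]; apply: ccont_hor => x xab;
  apply: qd; do ?[by split]; by [constructor 3|constructor 4].
Qed.

Let cver q : (forall z, in_rect a b c d z -> on_border a b c d z -> cdiff_at q z) ->
  ccont_on c d (fun y => q (b +i* y) - q (a +i* y)).
Proof.
move=> qd; apply: ccont_onD; [|apply: ccont_onN]; apply: ccont_ver => y ycd;
  apply: qd; do ?[by split]; by [constructor 2|constructor 1].
Qed.

Lemma bdint_bound q M :
  (forall z, in_rect a b c d z -> on_border a b c d z -> cdiff_at q z) ->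
  (forall z, in_rect a b c d z -> on_border a b c d z -> mag (q z) <= M) ->
  mag (bdint q a b c d) <= 4 * M * ((b - a) + (d - c)).
Proof.
move=> qd H; rewrite /bdint (le_trans (magD _ _))// magM complexiE mag_i mul1r.
rewrite mulrDr; apply: lerD.
  rewrite (_ : 4 * M = 2 * (2 * M)); last by ring.
  apply: cint_bound => //; first exact: chor.
  move=> x xab; rewrite (le_trans (magD _ _))// magN.
  by rewrite mulr_natl mulr2n lerD// H //; by [constructor 3|constructor 4].
rewrite (_ : 4 * M = 2 * (2 * M)); last by ring.
apply: cint_bound => //; first exact: cver.
move=> x xab; rewrite (le_trans (magD _ _))// magN.
by rewrite mulr_natl mulr2n lerD// H //; by [constructor 2|constructor 1].
Qed.

Lemma bdint_eqD q1 q2 q :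
  (forall z, in_rect a b c d z -> on_border a b c d z -> cdiff_at q1 z) ->
  (forall z, in_rect a b c d z -> on_border a b c d z -> cdiff_at q2 z) ->
  (forall z, in_rect a b c d z -> on_border a b c d z -> q z = q1 z + q2 z) ->
  bdint q a b c d = bdint q1 a b c d + bdint q2 a b c d.
Proof.
move=> d1 d2 E; rewrite /bdint.
rewrite (cint_eqD (chor d1) (chor d2) (chi := fun x => q (x +i* c) - q (x +i* d))).
  rewrite (cint_eqD (cver d1) (cver d2) (chi := fun y => q (b +i* y) - q (a +i* y))).
    by rewrite mulrDr addrACA.
  move=> y ycd; rewrite !E; do ?[by split]; do ?[by constructor 1]; do ?[by constructor 2].
  by rewrite opprD addrACA.
move=> x xab; rewrite !E; do ?[by split]; do ?[by constructor 3]; do ?[by constructor 4].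
by rewrite opprD addrACA.
Qed.

End Border.

Section Rectangle.
Variables (q : C -> C) (a b c d : R).
Hypotheses (ab : a <= b) (cd : c <= d).
Hypothesis qd : forall z, in_rect a b c d z -> cdiff_at q z.

Let hor y : c <= y <= d -> ccont_on a b (fun x => q (x +i* y)).
Proof. by move=> yd; apply: ccont_hor => x xab; apply: qd. Qed.

Let ver x : a <= x <= b -> ccont_on c d (fun y => q (x +i* y)).
Proof. by move=> xd; apply: ccont_ver => y ycd; apply: qd. Qed.

Let chor y y' : c <= y <= d -> c <= y' <= d ->
  ccont_on a b (fun x => q (x +i* y) - q (x +i* y')).
Proof. by move=> ? ?; apply: ccont_onD; [|apply: ccont_onN]; apply: hor. Qed.

Let cver y y' : a <= y <= b -> a <= y' <= b ->
  ccont_on c d (fun x => q (y +i* x) - q (y' +i* x)).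
Proof. by move=> ? ?; apply: ccont_onD; [|apply: ccont_onN]; apply: ver. Qed.

Let aI : a <= a <= b. Proof. by rewrite lexx. Qed.
Let bI : a <= b <= b. Proof. by rewrite lexx andbT. Qed.
Let cI : c <= c <= d. Proof. by rewrite lexx. Qed.
Let dI : c <= d <= d. Proof. by rewrite lexx andbT. Qed.

(** The border integral of an affine function is 0, so only the distance of
    [q] to one contributes. *)
Lemma bdint_small z l e : 0 <= e ->
  (forall w, in_rect a b c d w -> mag (q w - q z - l * (w - z)) <= e) ->
  mag (bdint q a b c d) <= 4 * e * ((b - a) + (d - c)).
Proof.
move=> e0 H.
have h1 : mag (cint a b (fun x => q (x +i* c) - q (x +i* d)) - (l * ('i%C * (c - d)%:C)) * (b - a)%:C)
   <= 2 * (2 * e) * (b - a).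
  apply: cint_close => //; first by apply: chor; rewrite ?cI ?dI ?ae ?eb.
  move=> x xab.
  have -> : q (x +i* c) - q (x +i* d) - (l * ('i%C * (c - d)%:C)) =
    (q (x +i* c) - q z - l * ((x +i* c) - z)) - (q (x +i* d) - q z - l * ((x +i* d) - z)).
    have -> : 'i%C * (c - d)%:C = (x +i* c) - (x +i* d) :> C.
      by apply/eqP; rewrite eq_complex /=; apply/andP; split; apply/eqP; ring.
    ring.
  rewrite (le_trans (magD _ _))// magN mulr_natl mulr2n.
  by apply: lerD; apply: H; split=> //=; rewrite ?aI ?bI ?cI ?dI.
have h2 : mag (cint c d (fun y => q (b +i* y) - q (a +i* y)) - (l * (b - a)%:C) * (d - c)%:C)
   <= 2 * (2 * e) * (d - c).
  apply: cint_close => //; first by apply: cver; rewrite ?aI ?bI ?ae ?eb.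
  move=> y ycd.
  have -> : q (b +i* y) - q (a +i* y) - (l * (b - a)%:C) =
    (q (b +i* y) - q z - l * ((b +i* y) - z)) - (q (a +i* y) - q z - l * ((a +i* y) - z)).
    have -> : (b - a)%:C = (b +i* y) - (a +i* y) :> C.
      by apply/eqP; rewrite eq_complex /= subrr !eqxx.
    ring.
  rewrite (le_trans (magD _ _))// magN mulr_natl mulr2n.
  by apply: lerD; apply: H; split=> //=; rewrite ?aI ?bI ?cI ?dI.
rewrite /bdint; set I1 := cint a b _ in h1 *; set I2 := cint c d _ in h2 *.
have -> : I1 + 'i%C * I2 = (I1 - (l * ('i%C * (c - d)%:C)) * (b - a)%:C) +
   'i%C * (I2 - (l * (b - a)%:C) * (d - c)%:C).
  rewrite !rmorphB /=; ring.
rewrite (le_trans (magD _ _))// magM complexiE mag_i mul1r mulrDr.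
rewrite (_ : 4 * e = 2 * (2 * e)); last by ring.
exact: lerD.
Qed.

End Rectangle.

Lemma nested_intervals (a b : nat -> R) :
  (forall n, a n <= a n.+1) -> (forall n, b n.+1 <= b n) ->
  (forall n, a n <= b n) -> exists x, forall n, a n <= x <= b n.
Proof.
move=> ai bd ab.
have am : {homo a : m n / (m <= n)%N >-> m <= n} by apply/nondecreasing_seqP.
have bm : {homo b : m n / (m <= n)%N >-> n <= m} by apply/nonincreasing_seqP.
have amb m n : a m <= b n.
  have [mn|/ltnW nm] := leqP m n; first exact: le_trans (am _ _ mn) (ab _).
  exact: le_trans (ab _) (bm _ _ nm).
have ub n : ubound (range a) (b n) by move=> _ [m _ <-].
have hs : has_sup (range a) by split; [exists (a 0%N); exists 0%N|exists (b 0%N)].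
exists (sup (range a)) => n; apply/andP; split.
  by apply: ub_le_sup; [exists (b 0%N)|exists n].
by apply: ge_sup; [exists (a 0%N); exists 0%N|].
Qed.

(** The border integrals of the four quarters add up to that of the rectangle,
    so one of them has at least a fourth of its modulus. *)
Lemma quarter_rect q a b c d : a <= b -> c <= d ->
  (forall z, in_rect a b c d z -> cdiff_at q z) ->
  exists r : R * R * (R * R), [/\ a <= r.1.1, r.1.2 <= b, c <= r.2.1, r.2.2 <= d &
   [/\ r.1.2 - r.1.1 = (b - a) / 2, r.2.2 - r.2.1 = (d - c) / 2 &
    mag (bdint q a b c d) <= 4 * mag (bdint q r.1.1 r.1.2 r.2.1 r.2.2)]].
Proof.
move=> ab cd qd; pose e := (a + b) / 2; pose f := (c + d) / 2.
have e1 : a <= e by rewrite /e; lra.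
have e2 : e <= b by rewrite /e; lra.
have f1 : c <= f by rewrite /f; lra.
have f2 : f <= d by rewrite /f; lra.
have h1 : e - a = (b - a) / 2 by rewrite /e; lra.
have h2 : b - e = (b - a) / 2 by rewrite /e; lra.
have h3 : f - c = (d - c) / 2 by rewrite /f; lra.
have h4 : d - f = (d - c) / 2 by rewrite /f; lra.
have E : bdint q a b c d = bdint q a e c f + bdint q a e f d +
   (bdint q e b c f + bdint q e b f d).
  rewrite (@bdint_vsplit q a b c d e) ?e1 //; last by move=> z /qd.
  rewrite (@bdint_hsplit q a e c d f) ?(@bdint_hsplit q e b c d f) ?f1 //.
    by move=> z [H1 H2] _; apply: qd; split => //; clear h1 h2 h3 h4; lra.
  by move=> z [H1 H2] _; apply: qd; split => //; clear h1 h2 h3 h4; lra.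
have E' : mag (bdint q a b c d) <= mag (bdint q a e c f) + mag (bdint q a e f d) +
   (mag (bdint q e b c f) + mag (bdint q e b f d)).
  rewrite E (le_trans (magD _ _))// lerD// magD//.
have [l1|g1] := leP (mag (bdint q a b c d)) (4 * mag (bdint q a e c f)).
  by exists ((a, e), (c, f)).
have [l2|g2] := leP (mag (bdint q a b c d)) (4 * mag (bdint q a e f d)).
  by exists ((a, e), (f, d)).
have [l3|g3] := leP (mag (bdint q a b c d)) (4 * mag (bdint q e b c f)).
  by exists ((e, b), (c, f)).
exists ((e, b), (f, d)); split => //=; split => //.
move: E' g1 g2 g3; clear; move: (mag (bdint q e b f d)) (mag (bdint q e b c f))
  (mag (bdint q a e f d)) (mag (bdint q a e c f)) (mag (bdint q a b c d)).
move=> M1 M2 M3 M4 M5; lra.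
Qed.

(** Bisection: the chosen quarters shrink to a point near which [q] is affine
    up to [e] times the distance. After [n] steps the border integral is at
    most [4 ^ n] times [4 e] times the square of [p / 2 ^ n], where [p] is
    half the perimeter, that is, a constant times [e]. *)
Theorem goursat q a b c d : a <= b -> c <= d ->
  (forall z, in_rect a b c d z -> cdiff_at q z) -> bdint q a b c d = 0.
Proof.
move=> ab cd qd; apply/eqP; rewrite -mag_eq0 eq_le mag_ge0 andbT.
pose inv (r : R * R * (R * R)) := [/\ a <= r.1.1, r.1.2 <= b, c <= r.2.1, r.2.2 <= d &
  r.1.1 <= r.1.2 /\ r.2.1 <= r.2.2].
have /choice [F HF] : forall r, exists r', inv r ->
   [/\ r.1.1 <= r'.1.1, r'.1.2 <= r.1.2, r.2.1 <= r'.2.1, r'.2.2 <= r.2.2 &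
   [/\ r'.1.2 - r'.1.1 = (r.1.2 - r.1.1) / 2,
       r'.2.2 - r'.2.1 = (r.2.2 - r.2.1) / 2 &
    mag (bdint q r.1.1 r.1.2 r.2.1 r.2.2) <=
    4 * mag (bdint q r'.1.1 r'.1.2 r'.2.1 r'.2.2)]].
  move=> r; have [[]|] := pselect (inv r); last by exists r.
  move=> h1 h2 h3 h4 [h5 h6].
  have [|r' Hr'] := @quarter_rect q _ _ _ _ h5 h6; last by exists r'.
  by move=> z [z1 z2]; apply: qd; split; lra.
pose r n := iter n F ((a, b), (c, d)).
have rS n : r n.+1 = F (r n) by [].
have H n : inv (r n).
  elim: n => [|n IH]; first by split.
  have [g1 g2 g3 g4 [g5 g6 _]] := HF _ IH; have [h1 h2 h3 h4 [h5 h6]] := IH.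
  rewrite rS; split; try exact: le_trans _ g1; try exact: le_trans g2 _;
    try exact: le_trans _ g3; try exact: le_trans g4 _.
  by split; rewrite -subr_ge0 ?g5 ?g6 divr_ge0 ?subr_ge0.
have dx n : (r n).1.2 - (r n).1.1 = (b - a) / 2 ^+ n.
  elim: n => [|n IH]; first by rewrite expr0 divr1.
  have [_ _ _ _ [g5 _ _]] := HF _ (H n).
  by rewrite rS g5 IH exprS invfM mulrAC -mulrA.
have dy n : (r n).2.2 - (r n).2.1 = (d - c) / 2 ^+ n.
  elim: n => [|n IH]; first by rewrite expr0 divr1.
  have [_ _ _ _ [_ g5 _]] := HF _ (H n).
  by rewrite rS g5 IH exprS invfM mulrAC -mulrA.
have I n : mag (bdint q a b c d) <=
   4 ^+ n * mag (bdint q (r n).1.1 (r n).1.2 (r n).2.1 (r n).2.2).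
  elim: n => [|n IH]; first by rewrite expr0 mul1r.
  have [_ _ _ _ [_ _ g]] := HF _ (H n).
  apply: le_trans IH _; rewrite exprSr -mulrA ler_wpM2l // exprn_ge0//.
have [x Hx] : exists x, forall n, (r n).1.1 <= x <= (r n).1.2.
  apply: nested_intervals => n; first by have [] := HF _ (H n).
    by have [] := HF _ (H n).
  by have [_ _ _ _ []] := H n.
have [y Hy] : exists x, forall n, (r n).2.1 <= x <= (r n).2.2.
  apply: nested_intervals => n; first by have [] := HF _ (H n).
    by have [] := HF _ (H n).
  by have [_ _ _ _ []] := H n.
pose z := x +i* y.
have zin : in_rect a b c d z by split; [apply: (Hx 0%N)|apply: (Hy 0%N)].
have [l Hl] := qd _ zin.
pose p := (b - a) + (d - c).
have p0 : 0 <= p by rewrite /p; lra.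
have key e : 0 < e -> mag (bdint q a b c d) <= 4 * e * p ^+ 2.
  move=> e0; have [dl dl0 Hd] := Hl e e0.
  have [n Hn] : exists n, p / 2 ^+ n < dl.
    exists (Num.bound (p / dl)); rewrite ltr_pdivrMr ?exprn_gt0// mulrC.
    rewrite -ltr_pdivrMr//.
    apply: lt_trans (archi_boundP _) _; first by rewrite divr_ge0// ltW.
    by rewrite -natrX ltr_nat ltn_expl.
  apply: le_trans (I n) _.
  have pn0 : 0 <= p / 2 ^+ n by rewrite divr_ge0// exprn_ge0.
  have small w : in_rect (r n).1.1 (r n).1.2 (r n).2.1 (r n).2.2 w ->
      mag (w - z) <= p / 2 ^+ n.
    move=> [w1 w2]; apply: le_trans (mag_le_ReIm _) _.
    rewrite /p mulrDl -dx -dy; have := Hx n; have := Hy n.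
    move=> hy hx; rewrite !raddfB /=; apply: lerD; rewrite ler_norml; lra.
  have [h1 h2 h3 h4 [h5 h6]] := H n.
  have := @bdint_small q _ _ _ _ h5 h6 _ z l (e * (p / 2 ^+ n)).
  rewrite dx dy -mulrDl -/p => K.
  have {}K : mag (bdint q (r n).1.1 (r n).1.2 (r n).2.1 (r n).2.2) <=
     4 * (e * (p / 2 ^+ n)) * (p / 2 ^+ n).
    apply: K.
    - by move=> w [w1 w2]; apply: qd; split; lra.
    - by rewrite mulr_ge0// ltW.
    - move=> w /small ws; have := Hd (w - z).
      rewrite [z + _]addrC subrK => Hw; apply: le_trans (Hw _) _.
        exact: le_lt_trans Hn.
      by rewrite ler_wpM2l// ltW.
  apply: le_trans (ler_wpM2l _ K) _; first by rewrite exprn_ge0.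
  rewrite le_eqVlt; apply/orP; left; apply/eqP.
  have -> : (4 : R) ^+ n = 2 ^+ n * 2 ^+ n by rewrite -exprMn; congr (_ ^+ _); ring.
  have : (2 : R) ^+ n != 0 by rewrite expf_neq0.
  by move=> ?; field.
rewrite leNgt; apply/negP => M0.
have q0 : 0 < 4 * (p ^+ 2 + 1) by rewrite mulr_gt0// ltr_wpDl// exprn_ge0.
have := key (mag (bdint q a b c d) / (4 * (p ^+ 2 + 1)) / 2).
rewrite !divr_gt0// => /(_ isT).
set M := mag _ in M0 *.
have -> : 4 * (M / (4 * (p ^+ 2 + 1)) / 2) * p ^+ 2 = M * (p ^+ 2 / (2 * (p ^+ 2 + 1))).
  by field; rewrite lt0r_neq0// ltr_wpDl// exprn_ge0.
have : p ^+ 2 / (2 * (p ^+ 2 + 1)) < 1.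
  have := sqr_ge0 p => pp; rewrite ltr_pdivrMr; lra.
move=> h1 h2; have := ltr_pM2l M0 (p ^+ 2 / (2 * (p ^+ 2 + 1))) 1; rewrite h1 mulr1 => h3; lra.
Qed.

(** Around the small square the large one is cut into four rectangles, on
    which [goursat] applies. *)
Lemma excise q (x y s r : R) : 0 < s -> s <= r ->
  (forall z, in_rect (x - r) (x + r) (y - r) (y + r) z -> z != x +i* y -> cdiff_at q z) ->
  bdint q (x - r) (x + r) (y - r) (y + r) = bdint q (x - s) (x + s) (y - s) (y + s).
Proof.
move=> s0 sr qd.
have ne z : complex.Re z != x \/ complex.Im z != y -> z != x +i* y.
  by rewrite eq_complex negb_and => -[] -> //=; rewrite orbT.
have off z : [\/ complex.Re z <= x - s, x + s <= complex.Re z, complex.Im z <= y - s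
    | y + s <= complex.Im z] -> z != x +i* y.
  move=> H; apply: ne; case: H => H; [left|left|right|right]; apply/eqP => E; lra.
rewrite (@bdint_vsplit q (x - r) (x + r) (y - r) (y + r) (x - s)); first last.
- move=> z zin H; apply: qd => //; apply: off.
  case: H => [->|[->|->|->|->]]; by [constructor 1; lra|constructor 1; lra|
    constructor 2; lra|constructor 3; lra|constructor 4; lra].
- lra.
- by apply/andP; split; lra.
rewrite goursat ?add0r; [|lra|lra|]; last first.
  move=> z [H1 H2]; apply: qd; first by split; lra.
  by apply: off; constructor 1; lra.
rewrite (@bdint_vsplit q (x - s) (x + r) (y - r) (y + r) (x + s)); first last.
- move=> z [H1 H2] H; apply: qd => //; first by split; lra.
  apply: off; case: H => [->|[->|->|->|->]]; by [constructor 2; lra|constructor 1; lra|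
    constructor 2; lra|constructor 3; lra|constructor 4; lra].
- lra.
- by apply/andP; split; lra.
rewrite [X in _ + X]goursat ?addr0; [|lra|lra|]; last first.
  move=> z [H1 H2]; apply: qd; first by split; lra.
  by apply: off; constructor 2; lra.
rewrite (@bdint_hsplit q (x - s) (x + s) (y - r) (y + r) (y - s)); first last.
- move=> z [H1 H2] H; apply: qd => //; first by split; lra.
  apply: off; case: H => [->|[->|->|->|->]]; by [constructor 3; lra|constructor 1; lra|
    constructor 2; lra|constructor 3; lra|constructor 4; lra].
- by apply/andP; split; lra.
- lra.
rewrite goursat ?add0r; [|lra|lra|]; last first.
  move=> z [H1 H2]; apply: qd; first by split; lra.
  by apply: off; constructor 3; lra.
rewrite (@bdint_hsplit q (x - s) (x + s) (y - s) (y + r) (y + s)); first last.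
- move=> z [H1 H2] H; apply: qd => //; first by split; lra.
  apply: off; case: H => [->|[->|->|->|->]]; by [constructor 4; lra|constructor 1; lra|
    constructor 2; lra|constructor 3; lra|constructor 4; lra].
- by apply/andP; split; lra.
- lra.
rewrite [X in _ + X]goursat ?addr0 //; [lra|lra|].
move=> z [H1 H2]; apply: qd; first by split; lra.
by apply: off; constructor 4; lra.
Qed.

Lemma cdiff_atP q z : cdiff_at q z <-> differentiable q z.
Proof.
split=> [[l Hl]|dq].
  have [] := @cdiff_differentiable _ _ _ q z ( *:%R l) (mag l) _ Hl => //.
  by move=> h; rewrite magM.
exists ('d q z 1) => e e0; have [d d0 dH] := differentiable_cdiff dq e0.
exists d => // h /dH; congr (mag (_ - _) <= _).
by rewrite -[in LHS](mulr1 h) -[h * 1]/(h *: (1 : C)) linearZ /= mulrC.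
Qed.

Lemma cdiff_at_cauchy_kernel q z0 z : cdiff_at q z -> z != z0 ->
  cdiff_at (fun w => q w / (w - z0)) z.
Proof.
move=> /cdiff_atP qz zz0; apply/cdiff_atP.
apply: (@differentiableM _ _ q (fun w => (w - z0)^-1)); first exact: qz.
apply: (@differentiableV _ _ (fun w => w - z0)); last by rewrite subr_eq0.
by apply: (@differentiableB _ _ _ id (cst z0)); [|exact: differentiable_cst].
Qed.

Lemma border_dist (x y r : R) z : 0 <= r ->
  in_rect (x - r) (x + r) (y - r) (y + r) z ->
  on_border (x - r) (x + r) (y - r) (y + r) z ->
  r <= mag (z - (x +i* y)) <= 2 * r.
Proof.
move=> r0 [H1 H2] bz; apply/andP; split.
  case: bz => E;
   [apply: le_trans (le_Re_mag _)|apply: le_trans (le_Re_mag _)|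
    apply: le_trans (le_Im_mag _)|apply: le_trans (le_Im_mag _)];
   by rewrite raddfB /= E addrAC subrr add0r ?normrN ler_norm.
apply: le_trans (mag_le_ReIm _) _; rewrite !raddfB /= mulr_natl mulr2n.
by apply: lerD; rewrite ler_norml; lra.
Qed.

(** The integral is [2 pi i], but a crude lower bound suffices. Grouping
    opposite sides gives, up to the factor ['i], the integrand
    [2 r / (r ^+ 2 + t ^+ 2)], which lies between [1 / r] and [2 / r] as
    [`|t| <= r]. *)
Lemma mag_bdint_inv (x y r : R) : 0 < r ->
  2 <= mag (bdint (fun z => 1 / (z - (x +i* y))) (x - r) (x + r) (y - r) (y + r)).
Proof.
move=> r0; have r0' := ltW r0.
have d1 z : z != x +i* y -> cdiff_at (fun z => 1 / (z - (x +i* y))) z.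
  move=> zz; apply: cdiff_at_cauchy_kernel => //; apply/cdiff_atP; exact: differentiable_cst.
have ne z : complex.Re z != x \/ complex.Im z != y -> z != x +i* y.
  by rewrite eq_complex negb_and => -[] -> //=; rewrite orbT.
have E t : 1 / (r +i* t) + 1 / (r -i* t) = (2 * r / (r ^+ 2 + t ^+ 2))%:C :> C.
  apply/eqP; rewrite eq_complex /=; apply/andP; split; apply/eqP; field;
   rewrite ?sqrrN; apply: lt0r_neq0; rewrite ltr_wpDr// ?sqr_ge0// exprn_gt0//.
have B t : - r <= t <= r -> `|2 * r / (r ^+ 2 + t ^+ 2) - 3 / 2 / r| <= 1 / 2 / r.
  move=> tr; have p0 : 0 < r ^+ 2 + t ^+ 2 by rewrite ltr_wpDr// ?sqr_ge0// exprn_gt0.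
  have : t ^+ 2 <= r ^+ 2 by have /andP[? ?] := tr; nra.
  have := sqr_ge0 t => h1 h2.
  rewrite ler_norml; apply/andP; split.
    rewrite lerBrDl -subr_ge0.
    have -> : 2 * r / (r ^+ 2 + t ^+ 2) - (3 / 2 / r - 1 / 2 / r) =
       (r ^+ 2 - t ^+ 2) / (r * (r ^+ 2 + t ^+ 2)) by field; rewrite !lt0r_neq0.
    by rewrite divr_ge0 ?subr_ge0 ?mulr_ge0 // ltW.
  rewrite lerBlDl -subr_ge0.
  have -> : 3 / 2 / r + 1 / 2 / r - 2 * r / (r ^+ 2 + t ^+ 2) =
     (2 * t ^+ 2) / (r * (r ^+ 2 + t ^+ 2)) by field; rewrite !lt0r_neq0.
  by apply: divr_ge0; apply: mulr_ge0 => //; exact: ltW.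
rewrite /bdint.
set I1 := cint _ _ _; set I2 := cint _ _ _.
have h1 : mag (I1 - ('i%C * (3 / 2 / r)%:C) * ((x + r) - (x - r))%:C) <=
    2 * (1 / 2 / r) * ((x + r) - (x - r)).
  apply: cint_close; first by lra.
    apply: ccont_onD; [|apply: ccont_onN]; apply: (@ccont_hor (fun z => 1 / (z - (x +i* y)))) => t tx; apply: d1;
    by apply: ne; right => /=; apply/eqP; lra.
  move=> t tx.
  have -> : 1 / (t +i* (y - r) - x +i* y) - 1 / (t +i* (y + r) - x +i* y) =
     'i%C * (1 / (r +i* (t - x)) + 1 / (r -i* (t - x))).
    have -> : t +i* (y - r) - x +i* y = - 'i%C * (r +i* (t - x)).
      by apply/eqP; rewrite eq_complex /=; apply/andP; split; apply/eqP; ring.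
    have -> : t +i* (y + r) - x +i* y = 'i%C * (r -i* (t - x)).
      by apply/eqP; rewrite eq_complex /=; apply/andP; split; apply/eqP; ring.
    have i2 : 'i%C * 'i%C = -1 :> C by rewrite -expr2 sqr_i.
    have i0 : 'i%C != 0 :> C by apply/eqP => i0; move: i2; rewrite i0 mul0r => /eqP; rewrite eq_sym oppr_eq0 oner_eq0.
    have iV : 'i%C^-1 = - 'i%C :> C by apply: (mulfI i0); rewrite mulfV // mulrN i2 opprK.
    by rewrite !mul1r !invfM invrN iV opprK mulrDr mulNr opprK.
  rewrite E -mulrBr magM complexiE mag_i mul1r -rmorphB mag_real.
  by apply: B; lra.
have h2 : mag (I2 - ((3 / 2 / r)%:C) * ((y + r) - (y - r))%:C) <=
    2 * (1 / 2 / r) * ((y + r) - (y - r)).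
  apply: cint_close; first by lra.
    apply: ccont_onD; [|apply: ccont_onN]; apply: (@ccont_ver (fun z => 1 / (z - (x +i* y)))) => t tx; apply: d1;
    by apply: ne; left => /=; apply/eqP; lra.
  move=> t tx.
  have -> : 1 / ((x + r) +i* t - x +i* y) - 1 / ((x - r) +i* t - x +i* y) =
     (1 / (r +i* (t - y)) + 1 / (r -i* (t - y))).
    have -> : (x + r) +i* t - x +i* y = (r +i* (t - y)).
      by apply/eqP; rewrite eq_complex /=; apply/andP; split; apply/eqP; ring.
    have -> : (x - r) +i* t - x +i* y = - (r -i* (t - y)).
      by apply/eqP; rewrite eq_complex /=; apply/andP; split; apply/eqP; ring.
    by rewrite !mul1r invrN opprK.
  by rewrite E -rmorphB mag_real; apply: B; lra.
move: h1 h2; have -> : x + r - (x - r) = 2 * r by ring.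
have -> : y + r - (y - r) = 2 * r by ring.
have -> : 2 * (1 / 2 / r) * (2 * r) = 2 by field; rewrite lt0r_neq0.
have e3 : (3 / 2 / r)%:C * (2 * r)%:C = 3%:C :> C.
  by rewrite -rmorphM /=; congr _%:C; field; rewrite lt0r_neq0.
rewrite -mulrA e3 => h1 h2.
have : mag (I1 + 'i%C * I2 - 'i%C * 6%:C) <= 4.
  have -> : I1 + 'i%C * I2 - 'i%C * 6%:C = (I1 - 'i%C * 3%:C) + 'i%C * (I2 - 3%:C).
    have -> : 6%:C = 3%:C + 3%:C :> C by rewrite -rmorphD; congr _%:C; ring.
    ring.
  apply: le_trans (magD _ _) _; rewrite magM complexiE mag_i mul1r.
  rewrite -complexiE; move: h1 h2; lra.
have := mag_sub ('i%C * 6%:C) ('i%C * 6%:C - (I1 + 'i%C * I2)).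
rewrite opprB addrCA subrr addr0 mag_distC.
have -> : mag ('i%C * 6%:C : C) = 6.
  by rewrite magM mag_real complexiE mag_i mul1r ger0_norm.
lra.
Qed.

(** Cauchy's formula, reduced to an estimate. After division by [q z0] the
    value at the center is 1; the integrand [(p z - 1) / (z - z0)] is bounded
    near [z0], so its border integral vanishes by [excise], and the border
    integral of [1 / (z - z0)] is bounded below by [mag_bdint_inv]. *)
Lemma cauchy_center q (x y r M : R) : 0 < r ->
  (forall z, in_rect (x - r) (x + r) (y - r) (y + r) z -> cdiff_at q z) ->
  (forall z, in_rect (x - r) (x + r) (y - r) (y + r) z ->
     on_border (x - r) (x + r) (y - r) (y + r) z -> mag (q z) <= M) ->
  mag (q (x +i* y)) <= 16 * M.
Proof.
move=> r0 qd qM; set z0 := x +i* y.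
have xr : x - r <= x + r by lra.
have yr : y - r <= y + r by lra.
have [q0|q0] := eqVneq (q z0) 0.
  rewrite q0 mag0 mulr_ge0//.
  apply: le_trans (mag_ge0 _) (qM ((x + r) +i* y) _ _); first by split => /=; lra.
  by constructor 2.
(* dividing by [q z0], the value at the centre becomes 1 *)
pose p z := q z / q z0.
have pd z : in_rect (x - r) (x + r) (y - r) (y + r) z -> cdiff_at p z.
  move=> /qd/cdiff_atP qz; apply/cdiff_atP; apply: differentiableM => //.
have p0 : p z0 = 1 by rewrite /p divff.
have small s : 0 < s -> s <= r -> forall z,
    in_rect (x - s) (x + s) (y - s) (y + s) z -> in_rect (x - r) (x + r) (y - r) (y + r) z.
  by move=> s0 sr z [H1 H2]; split; lra.
have z0in : in_rect (x - r) (x + r) (y - r) (y + r) z0 by split => /=; lra.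
have bne s z : 0 < s -> in_rect (x - s) (x + s) (y - s) (y + s) z ->
    on_border (x - s) (x + s) (y - s) (y + s) z -> z != z0.
  move=> s0 zin /(border_dist (ltW s0) zin) /andP[h _].
  by rewrite -subr_eq0 -mag_gt0 (lt_le_trans s0 h).
pose G z := (p z - 1) / (z - z0).
have Gd z : in_rect (x - r) (x + r) (y - r) (y + r) z -> z != z0 -> cdiff_at G z.
  move=> zin zz; apply: cdiff_at_cauchy_kernel zz; apply/cdiff_atP.
  apply: (@differentiableB _ _ _ p (cst 1)); last exact: differentiable_cst.
  exact/cdiff_atP/pd.
have G0 : bdint G (x - r) (x + r) (y - r) (y + r) = 0.
  have [l Hl] := pd _ z0in.
  have [d d0 dH] := Hl 1 ltr01.
  have GB z : 0 < mag (z - z0) < d -> mag (G z) <= mag l + 1.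
    move=> /andP[z1 z2]; have := dH _ z2; rewrite [z0 + _]addrC subrK p0 mul1r => h.
    rewrite /G magM magV ler_pdivrMr// mulrDl mul1r -magM -lerBlDl.
    by apply: le_trans h; apply: mag_sub.
  apply/eqP; rewrite -mag_eq0 eq_le mag_ge0 andbT; apply/ler_addgt0Pr => e e0.
  rewrite add0r; pose k := 16 * (mag l + 1).
  have k0 : 0 < k by rewrite mulr_gt0// ltr_wpDl// mag_ge0.
  pose s := Num.min r (Num.min (d / 3) (e / k)).
  have s0 : 0 < s by rewrite !lt_min r0 !divr_gt0.
  have sr : s <= r by rewrite ge_min lexx.
  have sd : 2 * s < d.
    have : s <= d / 3 by rewrite !ge_min lexx orbT.
    lra.
  have se : k * s <= e by rewrite mulrC -ler_pdivlMr// !ge_min lexx !orbT.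
  rewrite (excise s0 sr Gd).
  have := @bdint_bound (x - s) (x + s) (y - s) (y + s) _ _ G (mag l + 1).
  have -> : x + s - (x - s) + (y + s - (y - s)) = 4 * s by ring.
  move=> H; apply: le_trans (H _ _ _ _) _; [lra|lra| | |].
  - by move=> z zin bz; apply: Gd; [exact: small zin|exact: bne bz].
  - move=> z zin bz; apply: GB; have /andP[b1 b2] := border_dist (ltW s0) zin bz.
    by rewrite (lt_le_trans s0 b1) (le_lt_trans b2 sd).
  - by apply: le_trans se; rewrite /k le_eqVlt; apply/orP; left; apply/eqP; ring.
have sum : bdint (fun z => p z / (z - z0)) (x - r) (x + r) (y - r) (y + r) =
    bdint (fun z => 1 / (z - z0)) (x - r) (x + r) (y - r) (y + r).
  rewrite -[RHS]add0r -G0; apply: bdint_eqD => //.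
  - by move=> z zin bz; apply: Gd => //; exact: bne bz.
  - move=> z zin bz; apply: cdiff_at_cauchy_kernel; last exact: bne bz.
    by apply/cdiff_atP; exact: differentiable_cst.
  - by move=> z _ _; rewrite /G -mulrDl subrK.
have := mag_bdint_inv x y r0; rewrite -sum => h.
have := @bdint_bound (x - r) (x + r) (y - r) (y + r) xr yr
   (fun z => p z / (z - z0)) (M / mag (q z0) / r).
have -> : x + r - (x - r) + (y + r - (y - r)) = 4 * r by ring.
move=> H; have {}H : mag (bdint (fun z => p z / (z - z0)) (x - r) (x + r) (y - r) (y + r)) <=
    4 * (M / mag (q z0) / r) * (4 * r).
  apply: H => z zin bz.
    by apply: cdiff_at_cauchy_kernel; [exact: pd|exact: bne bz].
  have /andP[b1 b2] := border_dist (ltW r0) zin bz.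
  rewrite /p !magM !magV; apply: ler_pM; rewrite ?divr_ge0 ?mag_ge0 ?invr_ge0 ?mag_ge0//.
    by rewrite ler_wpM2r ?invr_ge0 ?mag_ge0// qM.
  by rewrite lef_pV2// ?posrE// (lt_le_trans r0 b1).
have {}h := le_trans h H.
have qz : 0 < mag (q z0) by rewrite mag_gt0.
have : 2 <= 16 * M / mag (q z0).
  apply: le_trans h _; rewrite le_eqVlt; apply/orP; left; apply/eqP.
  by field; rewrite !lt0r_neq0.
rewrite ler_pdivlMr// => hh; have := mag_ge0 (q z0); lra.
Qed.

End Goursat.

(** * Strict differentiability and zeros of holomorphic functions *)

Section DifferentiableFunctions.
Variables (K : numFieldType) (V : normedModType K).

Lemma dfun_id (z : V) : differentiable (fun x : V => x) z.
Proof. exact: (@ex_diff _ _ _ _ _ _ _ (is_diff_id z)). Qed.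

Lemma dfun_cst (W : normedModType K) (a : W) (z : V) : differentiable (fun _ : V => a) z.
Proof. exact: differentiable_cst. Qed.

Lemma dfunD (W : normedModType K) (f g : V -> W) z : differentiable f z -> differentiable g z ->
  differentiable (fun x => f x + g x) z.
Proof. by move=> df dg; exact: (differentiableD df dg). Qed.

Lemma dfunB (W : normedModType K) (f g : V -> W) z : differentiable f z -> differentiable g z ->
  differentiable (fun x => f x - g x) z.
Proof. by move=> df dg; exact: (differentiableB df dg). Qed.

Lemma dfunM (f g : V -> K) z : differentiable f z -> differentiable g z ->
  differentiable (fun x => f x * g x) z.
Proof. by move=> df dg; exact: (differentiableM df dg). Qed.

Lemma dfunX (f : V -> K) k z : differentiable f z ->
  differentiable (fun x => f x ^+ k) z.
Proof.
move=> df; elim: k => [|k IH]; first exact: dfun_cst.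
have := dfunM df IH; congr (differentiable _ z).
by apply/funext => x; rewrite exprS.
Qed.

Lemma dfunZl (W : normedModType K) (f : V -> K) (w : W) z : differentiable f z ->
  differentiable (fun x => f x *: w) z.
Proof. by move=> df; exact: (differentiableZl w df). Qed.

Lemma dfun_comp (W U : normedModType K) (f : V -> W) (g : W -> U) z :
  differentiable f z -> differentiable g (f z) ->
  differentiable (fun x => g (f x)) z.
Proof. by move=> df dg; exact: (differentiable_comp df dg). Qed.

Lemma dfun_sum (W : normedModType K) I (r : seq I) (P : pred I) (F : I -> V -> W) z :
  (forall i, P i -> differentiable (F i) z) ->
  differentiable (fun x => \sum_(i <- r | P i) F i x) z.
Proof.
move=> dF; elim: r => [|i r IH].
  by under eq_fun do rewrite big_nil; exact: dfun_cst.
under eq_fun do rewrite big_cons.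
case Pi : (P i); last exact: IH.
by apply: dfunD IH; exact: dF.
Qed.

End DifferentiableFunctions.

Section HolomorphicEstimates.
Variable R : realType.
Local Notation C := R[i].

(** Taking [k]-th roots, the constants [c] and [K] disappear as [k] grows. *)
Lemma pow_dominated (c K A B : R) : 0 < c -> 0 < A ->
  (forall k, c * B ^+ k <= K * A ^+ k) -> B <= A.
Proof.
move=> c0 A0 H; rewrite leNgt; apply/negP => AB.
(* Bernoulli's inequality for [B / A = 1 + x] *)
pose x := B / A - 1.
have x0 : 0 < x by rewrite subr_gt0 ltr_pdivlMr// mul1r.
have bern k : 1 + k%:R * x <= (1 + x) ^+ k.
  elim: k => [|k IH]; first by rewrite mul0r addr0 expr0.
  rewrite exprS -natr1; have : 0 <= k%:R * x by rewrite mulr_ge0// ltW.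
  move: (k%:R) IH => t IH t0; nra.
have Hk k : c * (1 + k%:R * x) <= K.
  have : c * (1 + x) ^+ k <= K.
    rewrite /x addrC subrK expr_div_n mulrA ler_pdivrMr ?exprn_gt0//.
  by apply: le_trans; rewrite ler_wpM2l// ltW.
have cx : 0 < c * x by rewrite mulr_gt0.
have := archi_boundP (_ : 0 <= `|K| / (c * x)); rewrite divr_ge0 ?(ltW cx)// => /(_ isT).
rewrite ltr_pdivrMr// => h; have := Hk (Num.bound (`|K| / (c * x))).
have := ler_norm K; move: h; set t := _%:R; move=> h1 h2 h3.
have : t * (c * x) + c <= K by move: h3; rewrite mulrDr mulr1 mulrCA; lra.
lra.
Qed.

Lemma cdiff_at_near (p q : C -> C) z (d : R) : 0 < d ->
  (forall w, mag (w - z) < d -> p w = q w) -> cdiff_at q z -> cdiff_at p z.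
Proof.
move=> d0 E [l Hl]; exists l => e e0; have [d' d'0 H] := Hl e e0.
exists (Num.min d d'); first by rewrite lt_min d0.
move=> h; rewrite lt_min => /andP[h1 h2].
rewrite !E; first exact: H.
  by rewrite subrr mag0.
by rewrite addrAC subrr add0r.
Qed.

(** Without a zero, [1 / q] would contradict [cauchy_center]. Both the border
    condition and the condition at the center are stable under small
    perturbations of [q], which makes this a form of Hurwitz's theorem. *)
Lemma zero_in_square (q : C -> C) (x y r m : R) : 0 < r -> 0 < m ->
  (forall z, in_rect (x - r) (x + r) (y - r) (y + r) z -> cdiff_at q z) ->
  (forall z, in_rect (x - r) (x + r) (y - r) (y + r) z ->
     on_border (x - r) (x + r) (y - r) (y + r) z -> m <= mag (q z)) ->
  16 * mag (q (x +i* y)) < m ->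
  exists2 z, in_rect (x - r) (x + r) (y - r) (y + r) z & q z = 0.
Proof.
move=> r0 m0 qd qm q0; apply: contrapT => nz.
have q_neq0 z : in_rect (x - r) (x + r) (y - r) (y + r) z -> q z != 0.
  by move=> zin; apply/eqP => qz; apply: nz; exists z.
have := @cauchy_center _ (fun z => (q z)^-1) x y r m^-1 r0.
move=> H; have {}H : mag (q (x +i* y))^-1 <= 16 * m^-1.
  apply: H => z zin; last first.
    move=> bz; rewrite magV lef_pV2 ?posrE ?qm//.
    by rewrite mag_gt0 q_neq0.
  apply/cdiff_atP; apply: differentiableV; last exact: q_neq0.
  exact/cdiff_atP/qd.
have qp : 0 < mag (q (x +i* y)).
  by rewrite mag_gt0 q_neq0//; split => /=; lra.
move: H; rewrite magV -[16 * _]invrK lef_pV2 ?posrE ?invr_gt0 ?mulr_gt0 ?invr_gt0//.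
by rewrite invfM invrK ler_pdivrMl// leNgt q0.
Qed.

(** Schwarz's lemma. The quotient [q z = (f z - f 0) / z] extends continuously
    to 0, but its differentiability there is not yet known. The functions
    [z * q z ^+ k], however, are differentiable everywhere: [cauchy_center]
    bounds them, and the factor [z] and the constant 16 disappear by
    [pow_dominated]. *)
Lemma schwarz_lip (f : C -> C) (r M : R) : 0 < r -> 0 < M ->
  (forall z, mag z < r -> cdiff_at f z) ->
  (forall z, mag z < r -> mag (f z) <= M) ->
  forall z1, mag z1 <= r / 8 -> mag (f z1 - f 0) <= 16 * M / r * mag z1.
Proof.
move=> r0 M0 fd fM z1 z1r.
have [->|z10] := eqVneq z1 0; first by rewrite subrr !mag0 mulr0.
have z0r : mag (0 : C) < r by rewrite mag0.
have [l Hl] := fd 0 z0r.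
pose q z := if z == 0 then l else (f z - f 0) / z.
pose A := 16 * M / r.
have A0 : 0 < A by rewrite divr_gt0// mulr_gt0.
have qc : {for 0, continuous q}.
  apply/continuous_magP => e e0; have e20 : 0 < e / 2 by rewrite divr_gt0.
  have [d d0 dH] := Hl _ e20; exists d => // h; rewrite subr0 => hd.
  rewrite /q eqxx; case: eqVneq => [_|h0]; first by rewrite subrr mag0.
  have := dH h hd; rewrite add0r => H.
  have -> : (f h - f 0) / h - l = (f h - f 0 - l * h) / h by field.
  rewrite magM magV ltr_pdivrMr ?mag_gt0//; apply: le_lt_trans H _.
  by rewrite ltr_pM2r ?mag_gt0//; lra.
pose Psi k z := z * q z ^+ k.
have Psid k z : mag z < r -> cdiff_at (Psi k) z.
  move=> zr; have [->|z0] := eqVneq z 0.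
    exists (q 0 ^+ k) => e e0.
    have : {for 0, continuous (fun z => q z ^+ k)}.
      elim: k => [|k IH]; first exact: cst_continuous.
      rewrite (_ : (fun _ => _) = q \* (fun z => q z ^+ k)); last first.
        by apply/funext => u; rewrite exprS.
      exact: continuousM qc IH.
    move/continuous_magP => /(_ e e0) [d d0 dH]; exists d => // h hd.
    rewrite add0r /Psi mul0r subr0 [_ ^+ k * h]mulrC -mulrBr magM mulrC.
    by rewrite ler_wpM2r ?mag_ge0// ltW// dH// subr0.
  apply: (@cdiff_at_near _ (fun w => w * ((f w - f 0) / (w - 0)) ^+ k) _ (mag z)).
  - by rewrite mag_gt0.
  - move=> w wz; rewrite /Psi /q; case: eqVneq wz => [->|w0 _]; last by rewrite subr0.
    by rewrite sub0r magN ltxx.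
  apply/cdiff_atP.
  apply: (@dfunM _ _ id); first exact: dfun_id.
  apply: dfunX.
  apply/cdiff_atP; apply: (@cdiff_at_cauchy_kernel _ (fun w => f w - f 0)) => //.
  apply/cdiff_atP; apply: dfunB; last exact: dfun_cst.
  exact/cdiff_atP/fd.
suff : mag (q z1) <= A.
  rewrite /q (negbTE z10) magM magV ler_pdivrMr ?mag_gt0//.
apply: (@pow_dominated (mag z1) (16 * r)) => //; first by rewrite mag_gt0.
move=> k; rewrite -magX -magM -/(Psi k z1).
case: z1 z1r z10 => x y z1r z10; rewrite -mulrA.
have r4 : 0 < r / 4 by rewrite divr_gt0.
have near z : in_rect (x - r / 4) (x + r / 4) (y - r / 4) (y + r / 4) z -> mag z < r.
  move=> [h1 h2]; have : mag (z - (x +i* y)) <= r / 2.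
    apply: le_trans (mag_le_ReIm _) _; rewrite !raddfB /=.
    have -> : r / 2 = r / 4 + r / 4 by lra.
    by apply: lerD; rewrite ler_norml; lra.
  have := mag_sub z (z - (x +i* y)).
  rewrite subKr; lra.
apply: (cauchy_center r4) => z zin; first exact/Psid/near.
move=> bz; have /andP[b1 _] := border_dist (ltW r4) zin bz.
have zr := near _ zin.
(* [z] is at distance at least [r / 4] of the center, which is within [r / 8] of 0 *)
have z8 : r / 8 <= mag z.
  have := mag_sub (z - (x +i* y)) (- (x +i* y)).
  rewrite opprK subrK magN; lra.
have z0 : z != 0 by rewrite -mag_gt0; lra.
rewrite /Psi magM magX; apply: ler_pM; rewrite ?exprn_ge0 ?mag_ge0 ?(ltW zr)//.
rewrite lerXn2r ?nnegrE ?mag_ge0 ?(ltW A0)//.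
rewrite /q (negbTE z0) magM magV ler_pdivrMr ?mag_gt0//.
have h1 : mag (f z - f 0) <= M + M.
  by rewrite (le_trans (magD _ _))// magN lerD// fM.
have : A * (r / 8) <= A * mag z by rewrite ler_wpM2l// ltW.
have -> : A * (r / 8) = M + M by rewrite /A; field; rewrite lt0r_neq0.
lra.
Qed.

(** For two close points, [schwarz_lip] on the complex line that joins them;
    for distant ones the bound [M] is enough. *)
Lemma holo_lipschitz n (E : 'rV[C]_n -> C) p (r M : R) : 0 < r -> 0 < M ->
  (forall z, mag (z - p) < r -> differentiable E z) ->
  (forall z, mag (z - p) < r -> mag (E z) <= M) ->
  forall z w, mag (z - p) < r / 2 -> mag (w - p) < r / 2 ->
    mag (E w - E z) <= 32 * M / r * mag (w - z).
Proof.
move=> r0 M0 Ed EM z w zp wp.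
have [->|wz] := eqVneq w z; first by rewrite !subrr !mag0 mulr0.
pose dl := mag (w - z); have dl0 : 0 < dl by rewrite mag_gt0 subr_eq0.
have dl0' : dl%:C != 0 :> C by rewrite (inj_eq (@complexI R)) lt0r_neq0.
have [small|big] := leP dl (r / 2 / 8).
  pose v := (dl%:C)^-1 *: (w - z).
  have v1 : mag v = 1.
    by rewrite /v magZ magV mag_real gtr0_norm// mulVf// lt0r_neq0.
  pose f (t : C) := E (z + t *: v).
  have inb (t : C) : mag t < r / 2 -> mag (z + t *: v - p) < r.
    move=> tr; rewrite addrAC; have := magD (z - p) (t *: v).
    rewrite magZ v1 mulr1; lra.
  have := @schwarz_lip f (r / 2) M _ M0 _ _ (dl%:C).
  rewrite divr_gt0// => /(_ isT) H.
  have {}H : mag (f dl%:C - f 0) <= 16 * M / (r / 2) * mag (dl%:C : C).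
    apply: H.
    - move=> t /inb tr; apply/cdiff_atP.
      apply: (@dfun_comp _ _ _ _ (fun t : C => z + t *: v) E); last exact: Ed.
      by apply: dfunD; [exact: dfun_cst|apply: (@dfunZl _ _ _ id); exact: dfun_id].
    - by move=> t /inb tr; exact: EM.
    - by rewrite mag_real gtr0_norm.
  move: H; rewrite /f scale0r addr0 /v scalerA mulfV// scale1r [z + _]addrC subrK.
  rewrite mag_real gtr0_norm// => /le_trans; apply.
  by rewrite le_eqVlt; apply/orP; left; apply/eqP; rewrite -/dl; field; rewrite lt0r_neq0.
have zr : mag (z - p) < r by lra.
have wr : mag (w - p) < r by lra.
have h1 : mag (E w - E z) <= M + M.
  by rewrite (le_trans (magD _ _))// magN lerD// EM.
apply: le_trans h1 _.
have : 32 * M / r * (r / 2 / 8) <= 32 * M / r * dl.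
  by rewrite ler_wpM2l ?(ltW big)// divr_ge0 ?mulr_ge0// ltW.
have -> : 32 * M / r * (r / 2 / 8) = M + M by field; rewrite lt0r_neq0.
by [].
Qed.

(** The remainder [G u - G p - 'd G p (u - p)] is differentiable on a ball,
    and its size is small compared with the radius of the ball when this is
    small; [holo_lipschitz] then makes it Lipschitz with a small constant. *)
Lemma holo_strict n k (G : 'rV[C]_n -> 'rV[C]_k) p (r : R) : 0 < r ->
  (forall z, mag (z - p) < r -> differentiable G z) ->
  forall e : R, 0 < e -> exists2 d : R, 0 < d & forall z w,
    mag (z - p) < d -> mag (w - p) < d ->
    mag (G w - G z - 'd G p (w - z)) <= e * mag (w - z).
Proof.
move=> r0 Gd e e0; have Gp : differentiable G p by apply: Gd; rewrite subrr mag0.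
have e'0 : 0 < e / 32 by rewrite divr_gt0.
have [d d0 dH] := differentiable_cdiff Gp e'0.
pose s := Num.min r d; have s0 : 0 < s by rewrite lt_min r0.
exists (s / 2); first by rewrite divr_gt0.
move=> z w zs ws; apply: mag_mx_le; first by rewrite mulr_ge0 ?mag_ge0 ?ltW.
move=> i j; rewrite ord1.
pose E u := (G u - G p - 'd G p (u - p)) 0 j.
have -> : (G w - G z - 'd G p (w - z)) 0 j = E w - E z.
  rewrite /E -[w - z](subrKA p) linearD -[p - z]opprB linearN.
  rewrite !mxE; ring.
have := @holo_lipschitz _ E p s (e / 32 * s) s0 _ _ _ z w zs ws.
rewrite mulr_gt0// => /(_ isT) H.
have -> : e = 32 * (e / 32 * s) / s by field; rewrite lt0r_neq0.
apply: H => u us.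
  apply: (@dfun_comp _ _ _ _ (fun u => G u - G p - 'd G p (u - p)) (fun M => M 0 j)); last exact: differentiable_coord.
  apply: dfunB.
    apply: dfunB; last exact: dfun_cst.
    by apply: Gd; apply: lt_le_trans us _; rewrite ge_min lexx.
  apply: (@dfun_comp _ _ _ _ (fun u => u - p) ('d G p)).
    by apply: dfunB; [exact: dfun_id|exact: dfun_cst].
  by apply: linear_differentiable; exact: diff_continuous.
apply: le_trans (mag_entry _ _ _) _.
have := dH (u - p); rewrite [p + _]addrC subrK => H2.
apply: le_trans (H2 _) _; first by apply: lt_le_trans us _; rewrite ge_min lexx orbT.
by rewrite ler_wpM2l ?(ltW us)// ltW.
Qed.

End HolomorphicEstimates.

(** * The holomorphic inverse function theorem *)

Section InverseFunction.
Variable R : realType.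
Local Notation C := R[i].

Lemma small_pow2 (x e : R) : 0 < e -> exists n, x / 2 ^+ n < e.
Proof.
move=> e0; exists (Num.bound (`|x| / e)).
rewrite ltr_pdivrMr ?exprn_gt0// -ltr_pdivrMl// mulrC.
have : x / e <= `|x| / e by rewrite ler_pM2r ?invr_gt0// ler_norm.
move/le_lt_trans; apply.
apply: lt_trans (archi_boundP _) _; first by rewrite divr_ge0// ltW.
by rewrite -natrX ltr_nat ltn_expl.
Qed.

(** Nested intervals centered at the terms, with half-lengths
    [2 K / 2 ^ n]. *)
Lemma geometric_limit (u : nat -> R) (K : R) :
  (forall n, `|u n.+1 - u n| <= K / 2 ^+ n) ->
  exists l, forall n, `|l - u n| <= 2 * K / 2 ^+ n.
Proof.
move=> H; pose e n := 2 * K / 2 ^+ n.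
have eS n : e n.+1 = K / 2 ^+ n by rewrite /e exprS; field; rewrite expf_neq0.
have eE n : e n = K / 2 ^+ n + K / 2 ^+ n by rewrite /e; field; rewrite expf_neq0.
have K0 n : 0 <= K / 2 ^+ n by exact: le_trans (normr_ge0 _) (H n).
have [k|k|k|l Hl] := @nested_intervals R (fun n => u n - e n) (fun n => u n + e n).
- by have := H k; rewrite ler_norml eS eE; lra.
- by have := H k; rewrite ler_norml eS eE; lra.
- by have := K0 k; rewrite eE; lra.
- by exists l => n; have := Hl n; rewrite ler_norml -/(e n); lra.
Qed.

Lemma geometric_limit_rV a (z : nat -> 'rV[C]_a) (K : R) :
  (forall n, mag (z n.+1 - z n) <= K / 2 ^+ n) ->
  exists l, forall n, mag (l - z n) <= 4 * K / 2 ^+ n.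
Proof.
move=> H.
have K0 n : 0 <= K / 2 ^+ n by exact: le_trans (mag_ge0 _) (H n).
have /choice [x Hx] : forall j, exists l, forall n, `|l - complex.Re (z n 0 j)| <= 2 * K / 2 ^+ n.
  move=> j; apply: (@geometric_limit (fun n => complex.Re (z n 0 j))) => n.
  apply: le_trans (H n); apply: le_trans (mag_entry _ 0 j); rewrite !mxE -raddfB.
  exact: le_Re_mag.
have /choice [y Hy] : forall j, exists l, forall n, `|l - complex.Im (z n 0 j)| <= 2 * K / 2 ^+ n.
  move=> j; apply: (@geometric_limit (fun n => complex.Im (z n 0 j))) => n.
  apply: le_trans (H n); apply: le_trans (mag_entry _ 0 j); rewrite !mxE -raddfB.
  exact: le_Im_mag.
exists (\row_j (x j +i* y j)) => n; apply: mag_mx_le => [|i j].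
  by have := K0 n; rewrite -mulrA; lra.
rewrite ord1 !mxE; apply: le_trans (mag_le_ReIm _) _.
have := Hx j n; have := Hy j n; case: (z n 0 j) => u v /=.
move: (K0 n); rewrite -!mulrA; lra.
Qed.

(** With [Q] inverse to the differential at [p], the map
    [z |-> z + (w - Phi z) *m Q] is a contraction near [p], by strict
    differentiability, and its fixed points solve [Phi z = w]. The dimensions
    are distinct variables because in applications they are only provably
    equal. *)
Theorem inverse_function a b (Phi : 'rV[C]_a -> 'rV[C]_b) p (r : R) :
  a = b -> 0 < r ->
  (forall z, mag (z - p) < r -> differentiable Phi z) ->
  (forall h, 'd Phi p h = 0 -> h = 0) ->
  exists s t (Phiinv : 'rV[C]_b -> 'rV[C]_a),
    [/\ 0 < s <= r, 0 < t,
     forall w, mag (w - Phi p) < t ->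
       [/\ mag (Phiinv w - p) < s, Phi (Phiinv w) = w & differentiable Phiinv w] &
     forall z, mag (z - p) < s -> mag (Phi z - Phi p) < t -> Phiinv (Phi z) = z].
Proof.
move=> ab r0 Pd inj; subst b.
have linv (A : {linear 'rV[C]_a -> 'rV[C]_a}) : (forall h, A h = 0 -> h = 0) ->
    exists Q : 'M[C]_a, (forall h, A h *m Q = h) /\ (forall k, A (k *m Q) = k).
  move=> Ainj; have : row_free (lin1_mx A).
    by rewrite -kermx_eq0; apply/rowV0P => v /sub_kermxP; rewrite mul_rV_lin1 => /Ainj.
  move=> /row_freeP [Q HQ]; exists Q; split => h.
    by rewrite -mul_rV_lin1 -mulmxA HQ mulmx1.
  by rewrite -mul_rV_lin1 -mulmxA (mulmx1C HQ) mulmx1.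
have arith (m1 m2 m3 m4 x y e : R) : 0 < e -> m1 <= m2 + m3 -> m4 <= x -> m2 <= m4 / 2 ->
    m3 <= y -> y <= x -> x < e / 2 -> m1 <= e by clear; lra.
have half (m x : R) : 0 < m -> m <= x -> m / 2 < x by clear; lra.
have [Q [Q1 Q2]] := linv _ inj.
pose kap := a%:R * mag Q + 1.
have kap0 : 0 < kap by rewrite ltr_wpDl// mulr_ge0// mag_ge0.
have Qk (k : 'rV[C]_a) : mag (k *m Q) <= kap * mag k.
  apply: le_trans (mag_mulmx _ _) _; rewrite mulrC /kap ler_wpM2r ?mag_ge0//; lra.
have e0 : 0 < (2 * kap)^-1 by rewrite invr_gt0 mulr_gt0.
have [d d0 dH] := holo_strict r0 Pd e0.
pose s := Num.min d r.
have s0 : 0 < s by rewrite lt_min d0.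
have sd : s <= d by rewrite ge_min lexx.
have sr : s <= r by rewrite ge_min lexx orbT.
have contr z z' : mag (z - p) < s -> mag (z' - p) < s ->
    mag (z' - z - (Phi z' - Phi z) *m Q) <= mag (z' - z) / 2.
  move=> zs zs'.
  have -> : z' - z - (Phi z' - Phi z) *m Q = - ((Phi z' - Phi z - 'd Phi p (z' - z)) *m Q).
    by rewrite [in RHS]mulmxBl Q1 opprB.
  rewrite magN; apply: le_trans (Qk _) _; have := dH z z' (lt_le_trans zs sd) (lt_le_trans zs' sd).
  move=> h; apply: (@le_trans _ _ (kap * ((2 * kap)^-1 * mag (z' - z)))).
    by rewrite ler_wpM2l// ltW.
  by rewrite le_eqVlt; apply/orP; left; apply/eqP; field; rewrite lt0r_neq0.
have lip z z' : mag (z - p) < s -> mag (z' - p) < s ->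
    mag (z' - z) <= 2 * kap * mag (Phi z' - Phi z).
  move=> zs zs'; have := contr z z' zs zs'; have := Qk (Phi z' - Phi z).
  have := magD (z' - z - (Phi z' - Phi z) *m Q) ((Phi z' - Phi z) *m Q).
  rewrite subrK; clear; lra.
pose t := s / (4 * kap).
have t0 : 0 < t by rewrite divr_gt0// mulr_gt0.
have ex w : mag (w - Phi p) < t -> exists z, mag (z - p) < s /\ Phi z = w.
  move=> wt.
  (* Newton's method with the fixed inverse differential [Q], started at [p] *)
  pose N z := z + (w - Phi z) *m Q.
  pose z n := iter n N p.
  have zS n : z n.+1 = N (z n) by [].
  have z0 : z 0%N = p by [].
  have st : s / 4 = kap * t by rewrite /t; field; rewrite lt0r_neq0.
  clearbody z; pose D := kap * mag (w - Phi p).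
  have Ds : D < s / 4 by rewrite st /D ltr_pM2l.
  have inv n : mag (z n - p) <= 2 * D * (1 - (2 ^+ n)^-1) /\
               mag (z n.+1 - z n) <= D / 2 ^+ n.
    elim: n => [|n [IH1 IH2]].
      rewrite zS z0 subrr mag0 expr0 invr1 subrr mulr0 mulr1; split => //.
      by rewrite /N addrC addKr; exact: Qk.
    have D0 : 0 <= D by rewrite mulr_ge0 ?mag_ge0// ltW.
    have hn0 : 0 < (2 ^+ n)^-1 :> R by rewrite invr_gt0 exprn_gt0.
    have hn : (2 ^+ n.+1)^-1 = (2 ^+ n)^-1 / 2 :> R by rewrite exprS invfM mulrC.
    have hn1 : (2 ^+ n)^-1 <= 1 :> R by rewrite invf_le1 ?exprn_gt0// exprn_ege1// ler1n.
    have i1 : mag (z n.+1 - p) <= 2 * D * (1 - (2 ^+ n.+1)^-1).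
      have := magB (z n.+1) (z n) p.
      rewrite hn; move: IH1 IH2; move: ((2 ^+ n)^-1) => x; clear; lra.
    split => //; rewrite [z n.+2]zS [z n.+1 in X in _ - X]zS.
    have zs : mag (z n - p) < s.
      apply: le_lt_trans IH1 _; move: hn0 hn1; move: ((2 ^+ n)^-1) => x; nra.
    have zs' : mag (z n.+1 - p) < s.
      apply: le_lt_trans i1 _; rewrite hn; move: hn0 hn1; move: ((2 ^+ n)^-1) => x; nra.
    have -> : N (z n.+1) - N (z n) = z n.+1 - z n - (Phi (z n.+1) - Phi (z n)) *m Q.
      rewrite /N opprD addrACA; congr (_ + _); rewrite -mulmxBl -mulNmx; congr (_ *m _).
      by rewrite !opprB addrC addrA subrK.
    apply: le_trans (contr _ _ zs zs') _; rewrite hn mulrA.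
    by rewrite ler_wpM2r ?invr_ge0.
  have [l Hl] := geometric_limit_rV (fun n => (inv n).2).
  have D0 : 0 <= D by rewrite mulr_ge0 ?mag_ge0// ltW.
  have small e : 0 < e -> exists n, 4 * D / 2 ^+ n < e by exact: small_pow2.
  have lp : mag (l - p) <= 2 * D.
    apply/ler_addgt0Pr => e e1; have [n Hn] := small e e1.
    have := magB l (z n) p; have := Hl n; have [i1 _] := inv n.
    have : 0 <= (2 ^+ n)^-1 :> R by rewrite invr_ge0 exprn_ge0.
    move: i1 Hn; move: ((2 ^+ n)^-1) => x; nra.
  have ls : mag (l - p) < s by lra.
  exists l; split => //.
  suff N0 : N l - l = 0.
    move: N0; rewrite /N addrC addKr => /(congr1 ('d Phi p)); rewrite Q2 linear0.
    by move/eqP; rewrite subr_eq0 => /eqP.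
  apply/eqP; rewrite -mag_eq0 eq_le mag_ge0 andbT; apply/ler_addgt0Pr => e e1.
  have e2 : 0 < e / 2 by rewrite divr_gt0.
  have [n Hn] := small _ e2; rewrite add0r.
  have zs : mag (z n - p) < s.
    have := (inv n).1 => h; apply: le_lt_trans h _.
    have : 0 <= (2 ^+ n)^-1 :> R by rewrite invr_ge0 exprn_ge0.
    move: ((2 ^+ n)^-1) => x; nra.
  have h1 : mag (N l - N (z n)) <= mag (l - z n) / 2.
    have -> : N l - N (z n) = l - z n - (Phi l - Phi (z n)) *m Q.
      rewrite /N opprD addrACA; congr (_ + _); rewrite -mulmxBl -mulNmx; congr (_ *m _).
      by rewrite !opprB addrC addrA subrK.
    exact: contr.
  have h3 : mag (N (z n) - l) <= 4 * D / 2 ^+ n.+1 by rewrite mag_distC -zS; exact: (Hl n.+1).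
  have h4 : 4 * D / 2 ^+ n.+1 <= 4 * D / 2 ^+ n.
    have : 0 <= (2 ^+ n)^-1 :> R by rewrite invr_ge0 exprn_ge0.
    by rewrite exprS invfM; move: ((2 ^+ n)^-1) D0 => x; clear; nra.
  exact: (arith _ _ _ _ _ _ _ e1 (magB _ _ _) (Hl n) h1 h3 h4 Hn).
have /choice [Phiinv HT] : forall w, exists z, mag (w - Phi p) < t -> mag (z - p) < s /\ Phi z = w.
  move=> w; have [/ex [z Hz]|nt] := pselect (mag (w - Phi p) < t); first by exists z.
  by exists p => /nt.
exists s, t, Phiinv; split => //; first by rewrite s0.
- move=> w0 wt; have [Ts PT] := HT _ wt; split => //.
  have dz : differentiable Phi (Phiinv w0) by apply: Pd; exact: lt_le_trans sr.
  pose z0 := Phiinv w0.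
  (* by [lip], [Phi] expands distances, so its differential is injective near [p] too *)
  have inj0 h : 'd Phi z0 h = 0 -> h = 0.
    move=> h0; apply/eqP; apply: contraT => hn0.
    have e1 : 0 < (4 * kap)^-1 by rewrite invr_gt0 mulr_gt0.
    have [d1 d10 dH1] := differentiable_cdiff dz e1.
    pose q := Num.min d1 (s - mag (z0 - p)) / (2 * mag h).
    have hp : 0 < mag h by rewrite mag_gt0.
    have m0 : 0 < Num.min d1 (s - mag (z0 - p)) by rewrite lt_min d10 subr_gt0.
    have q0 : 0 < q by rewrite divr_gt0// mulr_gt0.
    pose k := q%:C *: h.
    have kE : mag k = Num.min d1 (s - mag (z0 - p)) / 2.
      by rewrite /k magZ mag_real gtr0_norm// /q; field; rewrite lt0r_neq0.
    have k0 : 0 < mag k by rewrite kE divr_gt0.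
    have kd : mag k < d1 by rewrite kE; apply: half => //; rewrite ge_min lexx.
    have ks : mag k < s - mag (z0 - p).
      by rewrite kE; apply: half => //; rewrite ge_min lexx orbT.
    have dk : 'd Phi z0 k = 0 by rewrite /k linearZ h0 /= scaler0.
    have := dH1 k kd; rewrite [X in _ - X]dk subr0 => h1.
    have zk : mag (z0 + k - p) < s.
      by rewrite addrAC (le_lt_trans (magD _ _))// -ltrBrDl.
    have := lip z0 (z0 + k) Ts zk; rewrite addrAC subrr add0r => h2.
    have : 2 * kap * mag (Phi (z0 + k) - Phi z0) <= 2 * kap * ((4 * kap)^-1 * mag k).
      by rewrite ler_wpM2l// mulr_ge0// ltW.
    have -> : 2 * kap * ((4 * kap)^-1 * mag k) = mag k / 2 by field; rewrite lt0r_neq0.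
    by move/(le_trans h2); rewrite leNgt half.
  have [Q0 [Q01 Q02]] := linv _ inj0.
  pose kap1 := a%:R * mag Q0 + 1.
  have kap10 : 0 < kap1 by rewrite ltr_wpDl// mulr_ge0// mag_ge0.
  have Qk1 (k : 'rV[C]_a) : mag (k *m Q0) <= kap1 * mag k.
    apply: le_trans (mag_mulmx _ _) _; rewrite mulrC /kap1 ler_wpM2r ?mag_ge0//; lra.
  have [] := @cdiff_differentiable _ _ _ Phiinv w0 (mulmxr Q0) kap1 Qk1 _ => //.
  move=> e e1; have e2 : 0 < e / (2 * kap * kap1) by rewrite divr_gt0// !mulr_gt0.
  have [d1 d10 dH1] := differentiable_cdiff dz e2.
  pose q := Num.min (t - mag (w0 - Phi p)) (d1 / (2 * kap)).
  have q0 : 0 < q by rewrite lt_min subr_gt0 wt divr_gt0// mulr_gt0.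
  exists q => // k; rewrite lt_min => /andP[k1 k2].
  have wk : mag (w0 + k - Phi p) < t.
    by rewrite addrAC (le_lt_trans (magD _ _))// -ltrBrDl.
  have [Ts' PT'] := HT _ wk.
  pose h := Phiinv (w0 + k) - z0.
  have hk : mag h <= 2 * kap * mag k.
    by have := lip _ _ Ts Ts'; rewrite PT PT' addrAC subrr add0r.
  have hd : mag h < d1.
    by apply: le_lt_trans hk _; rewrite mulrC -ltr_pdivlMr ?mulr_gt0.
  have hE : Phiinv w0 + h = Phiinv (w0 + k) by rewrite /h addrC subrK.
  have H1 : mag (k - 'd Phi z0 h) <= e / (2 * kap * kap1) * mag h.
    by have := dH1 h hd; rewrite hE PT PT' [w0 + k]addrC addrK.
  have -> : Phiinv (w0 + k) - Phiinv w0 - mulmxr Q0 k = - ((k - 'd Phi z0 h) *m Q0).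
    by rewrite [in RHS]mulmxBl Q01 opprB.
  rewrite magN; apply: le_trans (Qk1 _) _.
  apply: (@le_trans _ _ (kap1 * (e / (2 * kap * kap1) * (2 * kap * mag k)))).
    rewrite ler_wpM2l ?(ltW kap10)//; apply: le_trans H1 _.
    by rewrite ler_wpM2l ?(ltW e2).
  by rewrite le_eqVlt; apply/orP; left; apply/eqP; field; rewrite !lt0r_neq0.
- move=> z zs zt; have [Ts PT] := HT _ zt.
  have := lip _ _ zs Ts; rewrite PT subrr mag0 mulr0 => h.
  by apply/eqP; rewrite -subr_eq0 -mag_eq0 eq_le h mag_ge0.
Qed.

End InverseFunction.

(** * Sums of unordered families *)

Section Summation.
Variable R : realType.
Local Notation C := R[i].

Section Families.
Variable K : choiceType.
Implicit Types (u v : K -> C) (s : seq K).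

Definition summable_by u (B : R) : Prop :=
  forall s, uniq s -> \sum_(k <- s) mag (u k) <= B.

(** Convergence along the directed set of finite families of indices, which
    makes reindexing and grouping independent of any enumeration. *)
Definition has_sum u (S : C) : Prop :=
  forall e : R, 0 < e -> exists s0, forall s, uniq s -> {subset s0 <= s} ->
    mag (\sum_(k <- s) u k - S) < e.

Lemma summable_by_ge0 u B : summable_by u B -> 0 <= B.
Proof. by move/(_ [::] isT); rewrite big_nil. Qed.

Lemma summable_by_le u v B : (forall k, mag (u k) <= mag (v k)) ->
  summable_by v B -> summable_by u B.
Proof. by move=> uv H s us; apply: le_trans (H s us); apply: ler_sum. Qed.

Lemma summable_byZ u B (x : C) : summable_by u B ->
  summable_by (fun k => x * u k) (mag x * B).
Proof.
move=> H s us; under eq_bigr do rewrite magM.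
by rewrite -mulr_sumr ler_wpM2l ?mag_ge0// H.
Qed.

Lemma summable_byD u v B B' : summable_by u B -> summable_by v B' ->
  summable_by (fun k => u k + v k) (B + B').
Proof.
move=> Hu Hv s us; apply: le_trans (lerD (Hu s us) (Hv s us)).
by rewrite -big_split; apply: ler_sum => k _; exact: magD.
Qed.

(** A finite family whose absolute sum is close to the supremum leaves little
    for the others. *)
Lemma summable_tail u B (e : R) : summable_by u B -> 0 < e ->
  exists s0, uniq s0 /\ forall s, uniq s -> (forall k, k \in s -> k \notin s0) ->
    \sum_(k <- s) mag (u k) < e.
Proof.
move=> H e0; pose A := [set x | exists2 s, uniq s & x = \sum_(k <- s) mag (u k)].
have sA : has_sup A.
  by split; [exists 0, [::] => //; rewrite big_nil|exists B => _ [s us ->]; exact: H].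
have [_ [s0 us0 ->] lt0] := sup_adherent e0 sA.
exists s0; split => // s us dis.
have : \sum_(k <- s0 ++ s) mag (u k) <= sup A.
  apply: ub_le_sup; first by case: sA.
  exists (s0 ++ s) => //; rewrite cat_uniq us0 us andbT /=.
  by apply/hasPn => k /dis.
rewrite big_cat /=; move: lt0; lra.
Qed.

Lemma sum_sub_mem (V : zmodType) (f : K -> V) s0 s : uniq s0 -> uniq s ->
  {subset s0 <= s} ->
  \sum_(k <- s) f k = \sum_(k <- s0) f k + \sum_(k <- s | k \notin s0) f k.
Proof.
move=> us0 us sub; rewrite (bigID (mem s0)) /=; congr (_ + _).
rewrite -big_filter; apply: perm_big; apply: uniq_perm => //.
  exact: filter_uniq.
move=> k; rewrite mem_filter; case: (boolP (k \in s0)) => [/sub ->|_] //.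
Qed.

Lemma has_sum_uniq u S S' : has_sum u S -> has_sum u S' -> S = S'.
Proof.
move=> H H'; apply/eqP; rewrite -subr_eq0 -mag_eq0 eq_le mag_ge0 andbT.
apply/ler_addgt0Pr => e e0; rewrite add0r.
have e20 : 0 < e / 2 by rewrite divr_gt0.
have [s0 h0] := H _ e20; have [s1 h1] := H' _ e20.
pose s := undup (s0 ++ s1).
have us : uniq s by exact: undup_uniq.
have := h0 s us; have := h1 s us.
move=> /(_ _)/[swap]/(_ _) g0 g1.
have {}g1 : mag (\sum_(k <- s) u k - S') < e / 2.
  by apply: g1 => k ks; rewrite mem_undup mem_cat ks orbT.
have {}g0 : mag (\sum_(k <- s) u k - S) < e / 2.
  by apply: g0 => k ks; rewrite mem_undup mem_cat ks.
have := magB S (\sum_(k <- s) u k) S'.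
rewrite [mag (S - \sum_(k <- s) u k)]mag_distC; move: g0 g1; lra.
Qed.

Lemma has_sum_bound u S B : summable_by u B -> has_sum u S -> mag S <= B.
Proof.
move=> H HS; apply/ler_addgt0Pr => e e0; have [s0 h0] := HS e e0.
have := h0 (undup s0) (undup_uniq _); move=> /(_ _) h.
have {}h : mag (\sum_(k <- undup s0) u k - S) < e by apply: h => k; rewrite mem_undup.
have := mag_sub S (- (\sum_(k <- undup s0) u k - S)).
rewrite opprK addrCA subrr addr0 magN.
have := mag_sum (undup s0) predT u; have := H _ (undup_uniq s0).
move: h; lra.
Qed.

Lemma has_sumD u v S S' : has_sum u S -> has_sum v S' ->
  has_sum (fun k => u k + v k) (S + S').
Proof.
move=> H H' e e0; have e20 : 0 < e / 2 by rewrite divr_gt0.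
have [s0 h0] := H _ e20; have [s1 h1] := H' _ e20.
exists (s0 ++ s1) => s us sub; rewrite big_split /= opprD addrACA.
apply: le_lt_trans (magD _ _) _.
have g0 : mag (\sum_(k <- s) u k - S) < e / 2.
  by apply: h0 => // k ks; apply: sub; rewrite mem_cat ks.
have g1 : mag (\sum_(k <- s) v k - S') < e / 2.
  by apply: h1 => // k ks; apply: sub; rewrite mem_cat ks orbT.
move: g0 g1; lra.
Qed.

Lemma has_sumZ u S (x : C) : has_sum u S -> has_sum (fun k => x * u k) (x * S).
Proof.
move=> H e e0; have m0 : 0 < mag x + 1 by rewrite ltr_wpDl ?mag_ge0.
have [s0 h0] := H (e / (mag x + 1)) (divr_gt0 e0 m0).
exists s0 => s us sub; rewrite -mulr_sumr -mulrBr magM.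
have := h0 s us sub; rewrite ltr_pdivlMr// => h.
apply: le_lt_trans h; rewrite mulrC ler_wpM2l ?mag_ge0//; lra.
Qed.

Lemma eq_has_sum u v S : u =1 v -> has_sum u S -> has_sum v S.
Proof. by move=> /funext ->. Qed.

(** The sums over the finite families that [summable_tail] gives for
    [e = 2 ^ -n] form a Cauchy sequence. *)
Lemma has_sum_exists u B : summable_by u B -> exists S, has_sum u S.
Proof.
move=> H.
have /choice [t Ht] : forall n, exists s0, uniq s0 /\ forall s, uniq s ->
    (forall k, k \in s -> k \notin s0) -> \sum_(k <- s) mag (u k) < (2 ^+ n)^-1.
  by move=> n; apply: summable_tail H _; rewrite invr_gt0 exprn_gt0.
pose T n := undup (flatten [seq t i | i <- iota 0 n.+1]).
have tT i n : (i <= n)%N -> {subset t i <= T n}.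
  move=> lin k kt; rewrite mem_undup; apply/flattenP; exists (t i) => //.
  by apply: map_f; rewrite mem_iota.
have uT n : uniq (T n) by exact: undup_uniq.
have close n s : uniq s -> {subset t n <= s} ->
    forall s', uniq s' -> {subset s <= s'} ->
    mag (\sum_(k <- s') u k - \sum_(k <- s) u k) <= (2 ^+ n)^-1.
  move=> us sub s' us' sub'; rewrite (sum_sub_mem u us us' sub') addrC addKr.
  rewrite -big_filter; apply: le_trans (mag_sum _ _ _) _; apply: ltW.
  have [_ Hn] := Ht n; apply: Hn; first exact: filter_uniq.
  by move=> k; rewrite mem_filter => /andP[ks _]; apply: contra ks; exact: sub.
have [n|l Hl] := @geometric_limit_rV R 1 (fun n => (\sum_(k <- T n) u k)%:M) 1.
  rewrite -raddfB /= mul1r; apply: mag_mx_le; first by rewrite invr_ge0 exprn_ge0.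
  move=> i j; rewrite !ord1 mxE mulr1n; apply: close; [exact: uT|exact: tT|exact: uT|].
  move=> k; rewrite !mem_undup => /flattenP [s /mapP [i0 +] ->] ks.
  rewrite mem_iota add0n => /andP[_ i1]; apply/flattenP; exists (t i0) => //.
  by apply: map_f; rewrite mem_iota add0n /= (ltn_trans i1).
exists (l 0 0) => e e0.
have [n Hn] := small_pow2 6 e0.
exists (T n) => s us sub.
have h1 : mag (\sum_(k <- s) u k - \sum_(k <- T n) u k) <= (2 ^+ n)^-1.
  by apply: close => //; exact: tT.
have h2 : mag (l 0 0 - \sum_(k <- T n) u k) <= 4 * 1 / 2 ^+ n.
  apply: le_trans (Hl n); apply: le_trans (mag_entry _ 0 0).
  by rewrite !mxE mulr1n.
have := magB (\sum_(k <- s) u k) (\sum_(k <- T n) u k) (l 0 0).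
rewrite [mag (\sum_(k <- T n) u k - l 0 0)]mag_distC.
have : 0 < (2 ^+ n)^-1 :> R by rewrite invr_gt0 exprn_gt0.
move: h1 h2 Hn; move: ((2 ^+ n)^-1) => x; lra.
Qed.

End Families.

(** Indices outside the range of [f] carry the value 0 and can be dropped from
    finite families. *)
Lemma has_sum_inj (K K' : choiceType) (f : K -> K') (u : K' -> C) S :
  injective f -> (forall k', (forall k, k' != f k) -> u k' = 0) ->
  has_sum u S -> has_sum (u \o f) S.
Proof.
move=> finj u0 H e e0; have [s0 h0] := H e e0.
have /choice [g Hg] : forall k', exists k : option K, (if k is Some k then k' = f k else forall k, k' != f k).
  move=> k'; have [[k ->]|nk] := pselect (exists k, k' = f k); first by exists (Some k).
  by exists None => k; apply/eqP => E; apply: nk; exists k.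
exists (pmap g s0) => s us sub.
pose s' := map f s ++ [seq k' <- undup s0 | g k' == None].
have us' : uniq s'.
  rewrite cat_uniq map_inj_uniq// us filter_uniq ?undup_uniq// andbT /=.
  apply/hasPn => k'; rewrite mem_filter => /andP[/eqP gk _].
  by apply/negP => /mapP [k _ E]; have := Hg k'; rewrite gk => /(_ k); rewrite E eqxx.
have := h0 s' us'; rewrite big_cat big_map /= [X in _ + X - _]big1_seq ?addr0; last first.
  move=> k' /andP[_]; rewrite mem_filter => /andP[/eqP gk _].
  by have := Hg k'; rewrite gk => /u0.
apply=> k' k's0; rewrite mem_cat.
case gk : (g k') => [k|]; last by rewrite mem_filter gk eqxx mem_undup k's0 orbT.
have := Hg k'; rewrite gk => E; rewrite E map_f//; apply: sub.
by rewrite mem_pmap -gk map_f.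
Qed.

Lemma summable_by_inj (K K' : choiceType) (f : K -> K') (u : K' -> C) B :
  injective f -> summable_by u B -> summable_by (u \o f) B.
Proof.
move=> finj H s us; have := H (map f s); rewrite big_map; apply.
by rewrite map_inj_uniq.
Qed.

Section Blocks.
Variables (K K' : choiceType) (p : K' -> K) (fib : K -> seq K').
Hypothesis fib_uniq : forall k, uniq (fib k).
Hypothesis fibP : forall k k', (k' \in fib k) = (p k' == k).

Lemma uniq_blocks s : uniq s -> uniq (flatten [seq fib k | k <- s]).
Proof.
elim: s => //= k s IH /andP[ks us]; rewrite cat_uniq fib_uniq IH// andbT /=.
apply/hasPn => k' /flattenP [_ /mapP [k1 k1s ->]].
rewrite /= !fibP => /eqP pk; apply/negP => /eqP E.
by move: ks; rewrite -E pk k1s.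
Qed.

Lemma sum_blocks (V : zmodType) (w : K' -> V) s :
  \sum_(k <- s) \sum_(k' <- fib k) w k' = \sum_(k' <- flatten [seq fib k | k <- s]) w k'.
Proof. by rewrite big_flatten /= big_map. Qed.

Lemma has_sum_blocks w S : has_sum w S ->
  has_sum (fun k => \sum_(k' <- fib k) w k') S.
Proof.
move=> H e e0; have [s0 h0] := H e e0.
exists (undup (map p s0)) => s us sub; rewrite sum_blocks; apply: h0.
  exact: uniq_blocks.
move=> k' k's; apply/flattenP; exists (fib (p k')); last by rewrite fibP.
by apply: map_f; apply: sub; rewrite mem_undup map_f.
Qed.

Lemma summable_blocks w B : summable_by w B ->
  summable_by (fun k => \sum_(k' <- fib k) w k') B.
Proof.
move=> H s us; apply: le_trans (H _ (uniq_blocks us)).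
rewrite -(sum_blocks (fun k' => mag (w k'))); apply: ler_sum => k _; exact: mag_sum.
Qed.

End Blocks.

Lemma summable_prod (K L : choiceType) (u : K -> C) (v : L -> C) B B' :
  summable_by u B -> summable_by v B' ->
  summable_by (fun kl : K * L => u kl.1 * v kl.2) (B * B').
Proof.
move=> Hu Hv s us.
pose s1 := undup (map fst s); pose s2 := undup (map snd s).
apply: (@le_trans _ _ (\sum_(kl <- [seq (k, l) | k <- s1, l <- s2]) mag (u kl.1 * v kl.2))).
  have ap : uniq [seq (k, l) | k <- s1, l <- s2].
    by apply: allpairs_uniq; rewrite ?undup_uniq// => -[? ?] [? ?].
  rewrite (sum_sub_mem _ us ap) ?lerDl ?sumr_ge0// => [kl _|kl kls]; first exact: mag_ge0.
  by case: kl kls => k l kls; apply: allpairs_f; rewrite mem_undup; apply/mapP; exists (k, l).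
rewrite big_allpairs_dep /=.
under eq_bigr do (under eq_bigr do rewrite magM; rewrite -mulr_sumr).
rewrite -mulr_suml; apply: ler_pM; rewrite ?sumr_ge0//; try by move=> *; exact: mag_ge0.
  exact/Hu/undup_uniq.
exact/Hv/undup_uniq.
Qed.

(** The double family has a sum [T] by absolute convergence; over large
    products [s x t] the partial sums factor, which identifies [T]. *)
Lemma has_sum_prod (K L : choiceType) (u : K -> C) (v : L -> C) B B' S S' :
  summable_by u B -> summable_by v B' -> has_sum u S -> has_sum v S' ->
  has_sum (fun kl : K * L => u kl.1 * v kl.2) (S * S').
Proof.
move=> su sv hu hv.
have [T HT] := has_sum_exists (summable_prod su sv).
suff -> : S * S' = T by [].
apply/eqP; rewrite -subr_eq0 -mag_eq0 eq_le mag_ge0 andbT.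
apply/ler_addgt0Pr => e e0; rewrite add0r.
have B0 := summable_by_ge0 su; have B'0 := summable_by_ge0 sv.
pose q := B + B' + 1; have q0 : 0 < q by rewrite /q; lra.
have e1 : 0 < Num.min 1 (e / 2 / q) by rewrite lt_min ltr01 !divr_gt0.
have e2 : 0 < e / 2 by rewrite divr_gt0.
have [s0 h0] := hu _ e1; have [t0 k0] := hv _ e1; have [w0 l0] := HT _ e2.
pose s := undup (s0 ++ map fst w0); pose t := undup (t0 ++ map snd w0).
have us : uniq s by exact: undup_uniq. have ut : uniq t by exact: undup_uniq.
have := h0 s us; move=> /(_ _) hs.
have {}hs : mag (\sum_(k <- s) u k - S) < Num.min 1 (e / 2 / q).
  by apply: hs => k ks; rewrite mem_undup mem_cat ks.
have := k0 t ut; move=> /(_ _) ht.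
have {}ht : mag (\sum_(k <- t) v k - S') < Num.min 1 (e / 2 / q).
  by apply: ht => k ks; rewrite mem_undup mem_cat ks.
have ap : uniq [seq (k, l) | k <- s, l <- t].
  by apply: allpairs_uniq => // -[? ?] [? ?].
have hw : mag (\sum_(kl <- [seq (k, l) | k <- s, l <- t]) u kl.1 * v kl.2 - T) < e / 2.
  apply: l0 => // -[k l] kl; apply: allpairs_f; rewrite mem_undup mem_cat;
  by apply/orP; right; apply/mapP; exists (k, l).
move: hw; rewrite big_allpairs_dep /=; under eq_bigr do rewrite -mulr_sumr.
rewrite -mulr_suml; set a := \sum_(k <- s) u k in hs *; set b := \sum_(k <- t) v k in ht *.
move=> hw.
have aB : mag a <= B by apply: le_trans (mag_sum _ _ _) _; exact: su.
have S'B : mag S' <= B' by exact: has_sum_bound hv.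
have : mag (S * S' - a * b) <= e / 2.
  have -> : S * S' - a * b = - ((a - S) * S' + a * (b - S')) by ring.
  rewrite magN (le_trans (magD _ _))// !magM.
  have [m1 m2] : Num.min 1 (e / 2 / q) <= e / 2 / q /\ true by rewrite ge_min lexx orbT.
  apply: (@le_trans _ _ (e / 2 / q * B' + B * (e / 2 / q))).
    apply: lerD; apply: ler_pM; rewrite ?mag_ge0//.
      by apply: le_trans m1; exact: ltW.
    by apply: le_trans m1; exact: ltW.
  rewrite [B * _]mulrC -mulrDr -mulrA ler_piMr ?(ltW e2)//.
  by rewrite mulrC ler_pdivrMr// mul1r /q; lra.
have := magB (S * S') (a * b) T; move: hw; clear; lra.
Qed.

End Summation.

(** * Real-analytic functions of several variables *)

Section PowerSeries.
Variable R : realType.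
Local Notation C := R[i].

Section MultiIndices.
Variable N : nat.
Local Notation A := {ffun 'I_N -> nat}.
Implicit Types (al be ga : A) (y : 'rV[R]_N).

Definition deg al : nat := \sum_i al i.

Definition madd al be : A := [ffun i => (al i + be i)%N].

Definition mzero : A := [ffun=> 0%N].

Definition munit (i : 'I_N) : A := [ffun j => (j == i) : nat].

Definition mbox (M : nat) : seq A :=
  [seq [ffun i => nat_of_ord (be i)] | be : {ffun 'I_N -> 'I_M}].

Lemma mbox_uniq M : uniq (mbox M).
Proof.
rewrite map_inj_uniq ?enum_uniq// => be be' /ffunP E.
by apply/ffunP => i; apply: val_inj; have := E i; rewrite !ffunE.
Qed.

Lemma mem_mbox M al : (al \in mbox M) = [forall i, al i < M]%N.
Proof.
apply/mapP/forallP => [[be _ -> i]|H]; first by rewrite ffunE.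
exists [ffun i => Ordinal (H i)]; first by rewrite mem_enum.
by apply/ffunP => i; rewrite !ffunE.
Qed.

Lemma box_sumE (u : A -> C) M : box_sum u M = \sum_(al <- mbox M) u al.
Proof. by rewrite /box_sum /mbox big_map big_enum. Qed.

Lemma mbox_big (s : seq A) : exists M, forall M', (M <= M')%N -> {subset s <= mbox M'}.
Proof.
elim: s => [|al s [M HM]]; first by exists 0%N.
exists (maxn M (\max_i al i).+1) => M'; rewrite geq_max => /andP[h1 h2] be.
rewrite inE => /orP[/eqP ->|]; last exact: HM.
rewrite mem_mbox; apply/forallP => i; apply: leq_trans h2; rewrite ltnS.
exact: leq_bigmax.
Qed.

Lemma le_deg al i : (al i <= deg al)%N.
Proof. by rewrite /deg (bigD1 i) //= leq_addr. Qed.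

Lemma deg_madd al be : deg (madd al be) = (deg al + deg be)%N.
Proof. by rewrite /deg -big_split; apply: eq_bigr => i _; rewrite ffunE. Qed.

Lemma deg0 : deg mzero = 0%N.
Proof. by rewrite /deg big1// => i _; rewrite ffunE. Qed.

Lemma deg_munit i : deg (munit i) = 1%N.
Proof.
rewrite /deg (bigD1 i)//= ffunE eqxx big1 ?addn0// => j ji.
by rewrite ffunE (negbTE ji).
Qed.

Lemma deg_eq0 al : deg al = 0%N -> al = mzero.
Proof.
move=> d0; apply/ffunP => i; rewrite ffunE; apply/eqP; rewrite -leqn0 -d0.
exact: le_deg.
Qed.

Lemma mzero_or_succ al : al = mzero \/ exists be i, al = madd be (munit i).
Proof.
have [/forallP H|] := boolP [forall i, al i == 0%N].
  by left; apply/ffunP => i; rewrite ffunE; apply/eqP.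
rewrite negb_forall => /existsP [i ali]; right.
exists [ffun j => (al j - (j == i))%N], i; apply/ffunP => j; rewrite !ffunE.
by case: eqP => [->|_]; rewrite ?subn0 ?addn0// subnK// lt0n.
Qed.

Lemma deg_eq1 al : deg al = 1%N -> exists i, al = munit i.
Proof.
case: (mzero_or_succ al) => [->|[be [i ->]]]; first by rewrite deg0.
rewrite deg_madd deg_munit addn1 => -[/deg_eq0 ->]; exists i.
by apply/ffunP => j; rewrite !ffunE.
Qed.

Lemma monomialD y al be : monomial y (madd al be) = monomial y al * monomial y be.
Proof.
by rewrite /monomial -big_split; apply: eq_bigr => i _; rewrite ffunE exprD.
Qed.

Lemma monomial0 y : monomial y mzero = 1.
Proof. by rewrite /monomial big1// => i _; rewrite ffunE expr0. Qed.

Lemma monomial_unit y i : monomial y (munit i) = y 0 i.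
Proof.
rewrite /monomial (bigD1 i)//= ffunE eqxx expr1 big1 ?mulr1// => j ji.
by rewrite ffunE (negbTE ji).
Qed.

Lemma expr_deg (r : R) al : r ^+ deg al = \prod_i r ^+ al i.
Proof. by rewrite prodrXr. Qed.

Lemma monomial_const (r : R) al : monomial (const_mx r) al = r ^+ deg al.
Proof. by rewrite expr_deg; apply: eq_bigr => i _; rewrite mxE. Qed.

Lemma rV_entry y i : `|y 0 i| <= `|y|.
Proof.
by rewrite [leRHS]/Num.norm /= mx_normrE (le_bigmax _ (fun ij => `|y ij.1 ij.2|) (0, i)).
Qed.

Lemma rV_norm_le y (r : R) : 0 <= r -> (forall i, `|y 0 i| <= r) -> `|y| <= r.
Proof.
move=> r0 H; rewrite [leLHS]/Num.norm /= mx_normrE; apply/bigmax_leP; split => // -[i j] _.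
by rewrite ord1 /=.
Qed.

Lemma monomial_bound y (r : R) al : `|y| <= r -> `|monomial y al| <= r ^+ deg al.
Proof.
move=> yr; rewrite expr_deg normr_prod; apply: ler_prod => i _.
have h := le_trans (rV_entry y i) yr.
by rewrite normr_ge0 normrX lerXn2r ?nnegrE// (le_trans (normr_ge0 _) h).
Qed.

End MultiIndices.

Lemma cvg_magP (f : nat -> C) (l : C) : (f @ \oo --> l) <->
  (forall e : R, 0 < e -> exists n0, forall n, (n0 <= n)%N -> mag (f n - l) < e).
Proof.
split=> [/cvgrPdist_lt H e e0|H].
  have e0' : 0 < e%:C :> C by rewrite ltcR.
  have [n0 _ Hn] := H _ e0'; exists n0 => n /Hn /=.
  by rewrite distrC magE ltcR.
apply/cvgrPdist_lt => e /gt0_mag [e0 eE]; have [n0 Hn] := H _ e0.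
by exists n0 => // n /Hn; rewrite /= distrC magE eE ltcR.
Qed.

(** Boxes exhaust the multi-indices, so that an absolutely convergent family
    has the same limit along boxes and along finite families. *)
Lemma abs_converges_toP N (u : {ffun 'I_N -> nat} -> C) (S : C) :
  abs_converges_to u S <-> (exists B, summable_by u B) /\ has_sum u S.
Proof.
have toC M : box_sum (fun al => `|u al|) M = (\sum_(al <- mbox N M) mag (u al))%:C.
  by rewrite box_sumE rmorph_sum; apply: eq_bigr => al _; rewrite magE.
split.
  case=> -[B HB] /cvg_magP Hl.
  have su : summable_by u B.
    move=> s us; have [M /(_ M (leqnn M)) sM] := mbox_big s.
    have := HB M; rewrite toC lecR; apply: le_trans.
    by rewrite (sum_sub_mem _ us (@mbox_uniq N M) sM) lerDl sumr_ge0// => *; exact: mag_ge0.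
  split; first by exists B.
  have [T HT] := has_sum_exists su.
  suff -> : S = T by [].
  apply/eqP; rewrite -subr_eq0 -mag_eq0 eq_le mag_ge0 andbT.
  apply/ler_addgt0Pr => e e0; rewrite add0r.
  have e20 : 0 < e / 2 by rewrite divr_gt0.
  have [n0 Hn] := Hl _ e20; have [s0 Hs] := HT _ e20; have [M HM] := mbox_big s0.
  pose m := maxn n0 M.
  have h1 := Hn m (leq_maxl _ _).
  have h2 := Hs _ (@mbox_uniq N m) (HM m (leq_maxr _ _)); rewrite -box_sumE in h2.
  have := magB S (box_sum u m) T; rewrite [mag (S - box_sum u m)]mag_distC.
  move: h1 h2; clear; lra.
case=> -[B HB] HS; split.
  by exists B => M; rewrite toC lecR; apply: HB; exact: mbox_uniq.
apply/cvg_magP => e e0; have [s0 Hs] := HS e e0; have [M HM] := mbox_big s0.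
by exists M => n Mn; rewrite box_sumE; apply: Hs; [exact: mbox_uniq|exact: HM].
Qed.

Lemma minl (x y : R) : Num.min x y <= x.
Proof. by rewrite ge_min lexx. Qed.

Lemma minr (x y : R) : Num.min x y <= y.
Proof. by rewrite ge_min lexx orbT. Qed.

Section Series.
Variable N : nat.
Local Notation A := {ffun 'I_N -> nat}.
Implicit Types (c d : A -> C) (phi psi : 'rV[R]_N -> C) (a y : 'rV[R]_N).

(** Absolute convergence at the corner [(r, ..., r)] dominates the whole
    polydisc. *)
Definition ps_at phi a c (r B : R) : Prop :=
  [/\ 0 < r, summable_by (fun al => c al * (r ^+ deg al)%:C) B &
    forall y, `|y| <= r ->
      has_sum (fun al => c al * (monomial y al)%:C) (phi (a + y))].

Lemma ps_summable c (r B : R) y : `|y| <= r ->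
  summable_by (fun al => c al * (r ^+ deg al)%:C) B ->
  summable_by (fun al => c al * (monomial y al)%:C) B.
Proof.
move=> yr; apply: summable_by_le => al; rewrite !magM ler_wpM2l ?mag_ge0// !mag_real.
have r0 := le_trans (normr_ge0 _) yr.
by rewrite [leRHS]ger0_norm ?exprn_ge0// monomial_bound.
Qed.

Lemma nbhs_rVP a (P : set 'rV[R]_N) : nbhs a P <->
  exists2 r : R, 0 < r & forall y, `|y| <= r -> P (a + y).
Proof.
split.
  move=> /nbhs_ballP [e /= e0 He]; exists (e / 2); first by rewrite divr_gt0.
  move=> y ye; apply: He; rewrite -ball_normE /ball_ /= opprD addrA subrr add0r normrN.
  lra.
case=> r r0 H; apply/nbhs_ballP; exists r => // x.
rewrite -ball_normE /ball_ /= distrC => xa; rewrite -[x](subrK a) addrC; apply: H.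
exact: ltW.
Qed.

Lemma analytic_ps phi a : analytic_at phi a <-> exists c r B, ps_at phi a c r B.
Proof.
split.
  case=> c /nbhs_rVP [r r0 H].
  exists c, r.
  have cr : `|const_mx r : 'rV[R]_N| <= r.
    by apply: rV_norm_le => [|i]; [exact: ltW|rewrite mxE gtr0_norm].
  have [[B HB] _] := (abs_converges_toP _ _).1 (H _ cr).
  exists B; split => //.
    apply: summable_by_le HB => al.
    by rewrite [a + _]addrC addrK monomial_const.
  move=> y /H /abs_converges_toP [_].
  by rewrite [in monomial _](addrC a y) addrK.
case=> c [r [B [r0 sB hs]]]; exists c; apply/nbhs_rVP; exists r => // y yr.
apply/abs_converges_toP; rewrite [in monomial _](addrC a y) addrK; split; last exact: hs.
by exists B; exact: ps_summable yr sB.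
Qed.

Lemma ps_shrink phi a c (r r' B : R) : 0 < r' -> r' <= r ->
  ps_at phi a c r B -> ps_at phi a c r' B.
Proof.
move=> r'0 rr [r0 sB hs]; split => //; last by move=> y yr; apply: hs; exact: le_trans rr.
apply: summable_by_le sB => al; rewrite !magM ler_wpM2l ?mag_ge0// !mag_real.
have [r0' r'0'] := (ltW r0, ltW r'0).
by rewrite ger0_norm ?exprn_ge0// ger0_norm ?exprn_ge0// lerXn2r ?nnegrE.
Qed.

Lemma analytic_cst a (x : C) : analytic_at (fun _ : 'rV[R]_N => x) a.
Proof.
apply/analytic_ps; exists (fun al => if al == mzero N then x else 0), 1, (mag x).
have E (f : A -> R) s : uniq s -> f (mzero N) = 1 ->
    \sum_(al <- s) ((if al == mzero N then x else 0) * (f al)%:C) =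
    if mzero N \in s then x else 0.
  move=> us f1; case: ifPn => zs.
    rewrite (bigD1_seq (mzero N))//= eqxx f1 mulr1 big1 ?addr0// => al /negbTE ->.
    by rewrite mul0r.
  rewrite big1_seq// => al /andP[_ als]; case: eqP => [E|_]; last by rewrite mul0r.
  by rewrite -E als in zs.
split => //.
  move=> s us; apply: (@le_trans _ _ (\sum_(al <- s) (if al == mzero N then mag x else 0))).
    apply: ler_sum => al _; rewrite expr1n mulr1; case: ifP => //; by rewrite mag0.
  have [zs|zs] := boolP (mzero N \in s).
    rewrite (bigD1_seq (mzero N))//= eqxx big1 ?addr0// => al /negbTE -> //.
  rewrite big1_seq ?mag_ge0// => al /andP[_ als]; case: eqP => // E0.
  by rewrite -E0 als in zs.
move=> y _ e e0; exists [:: mzero N] => s us sub; rewrite E ?monomial0//.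
by rewrite sub ?mem_head// subrr mag0.
Qed.

Lemma analyticD phi psi a : analytic_at phi a -> analytic_at psi a ->
  analytic_at (fun x => phi x + psi x) a.
Proof.
move=> /analytic_ps [c [r [B P1]]] /analytic_ps [d [r' [B' P2]]].
have r0 : 0 < r by case: P1. have r'0 : 0 < r' by case: P2.
have m0 : 0 < Num.min r r' by rewrite lt_min r0.
have [_ s1 h1] := ps_shrink m0 (minl r r') P1.
have [_ s2 h2] := ps_shrink m0 (minr r r') P2.
apply/analytic_ps; exists (fun al => c al + d al), (Num.min r r'), (B + B'); split => //.
  by apply: summable_by_le (summable_byD s1 s2) => al; rewrite mulrDl.
move=> y yr; apply: eq_has_sum (has_sumD (h1 y yr) (h2 y yr)) => al.
by rewrite mulrDl.
Qed.

(** The pairs of multi-indices with sum [ga], which contribute to the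
    coefficient of index [ga] in a Cauchy product. *)
Definition mfib (ga : A) : seq (A * A) :=
  [seq ab <- [seq (al, be) | al <- mbox N (deg ga).+1, be <- mbox N (deg ga).+1]
   | madd ab.1 ab.2 == ga].

Lemma mfib_uniq ga : uniq (mfib ga).
Proof.
apply: filter_uniq; apply: allpairs_uniq; rewrite ?mbox_uniq//.
by move=> [? ?] [? ?].
Qed.

Lemma mem_mfib ga ab : (ab \in mfib ga) = (madd ab.1 ab.2 == ga).
Proof.
rewrite mem_filter; case: eqP => //= <-; case: ab => al be /=.
by apply: allpairs_f; rewrite mem_mbox; apply/forallP => i; rewrite ltnS;
  apply: leq_trans (le_deg _ _) _; rewrite deg_madd ?leq_addr ?leq_addl.
Qed.

Lemma analyticM phi psi a : analytic_at phi a -> analytic_at psi a ->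
  analytic_at (fun x => phi x * psi x) a.
Proof.
move=> /analytic_ps [c [r [B P1]]] /analytic_ps [d [r' [B' P2]]].
have r0 : 0 < r by case: P1. have r'0 : 0 < r' by case: P2.
have m0 : 0 < Num.min r r' by rewrite lt_min r0.
have [_ s1 h1] := ps_shrink m0 (minl r r') P1.
have [_ s2 h2] := ps_shrink m0 (minr r r') P2.
apply/analytic_ps.
exists (fun ga => \sum_(ab <- mfib ga) c ab.1 * d ab.2), (Num.min r r'), (B * B').
have E (f : A -> R) : (forall al be, f (madd al be) = f al * f be) -> forall ga,
    (\sum_(ab <- mfib ga) c ab.1 * d ab.2) * (f ga)%:C =
    \sum_(ab <- mfib ga) (c ab.1 * (f ab.1)%:C) * (d ab.2 * (f ab.2)%:C).
  move=> fM ga; rewrite mulr_suml !big_seq; apply: eq_bigr => -[al be].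
  by rewrite mem_mfib /= => /eqP <-; rewrite fM rmorphM mulrACA.
split => //.
  apply: summable_by_le (summable_blocks mfib_uniq mem_mfib (summable_prod s1 s2)) => ga.
  rewrite (E (fun al => Num.min r r' ^+ deg al))// => al be.
  by rewrite deg_madd exprD.
move=> y yr.
have := has_sum_blocks mfib_uniq mem_mfib (has_sum_prod (ps_summable yr s1) (ps_summable yr s2) (h1 y yr) (h2 y yr)).
by apply: eq_has_sum => ga; rewrite (E (monomial y))// => al be; exact: monomialD.
Qed.

End Series.
End PowerSeries.

(** * Termwise differentiation *)

Section TermwiseDerivative.
Variable R : realType.
Local Notation C := R[i].

(** In the binomial expansion of the remainder every power of [t] is at least
    the second, so after division by [t ^ 2] it is largest at [`|t| = tau]
    with positive signs. *)
Lemma pow_taylor2 (y t tau : R) k : 0 < tau -> `|t| <= tau ->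
  `|(y + t) ^+ k - y ^+ k - k%:R * t * y ^+ k.-1| <=
  (`|t| / tau) ^+ 2 *
  ((`|y| + tau) ^+ k - `|y| ^+ k - k%:R * tau * `|y| ^+ k.-1).
Proof.
move=> t0 tt; elim: k => [|k IH].
  by rewrite !expr0 !mul0r !subr0 !subrr normr0 mulr0.
have pS (x : R) : k%:R * x ^+ k = k%:R * x ^+ k.-1 * x.
  by case: (k) => [|j]; rewrite ?mul0r// exprSr mulrA.
have E (x s : R) : (x + s) ^+ k.+1 - x ^+ k.+1 - k.+1%:R * s * x ^+ k.+1.-1 =
    (x + s) * ((x + s) ^+ k - x ^+ k - k%:R * s * x ^+ k.-1) +
    k%:R * x ^+ k.-1 * s ^+ 2.
  rewrite /= !exprS expr0 -natr1; have := pS x.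
  move: (x ^+ k) (x ^+ k.-1) ((x + s) ^+ k) k%:R => p q w j H.
  have -> : (j + 1) * s * p = j * p * s + s * p by ring.
  by rewrite H; ring.
rewrite (E y t) (E `|y| tau); apply: le_trans (ler_normD _ _) _.
rewrite [leRHS]mulrDr; apply: lerD.
  rewrite normrM [leRHS]mulrCA; apply: ler_pM => //.
  by apply: le_trans (ler_normD _ _) _; rewrite lerD2l.
rewrite !normrM !normrX normr_nat mulrC expr_div_n mulrACA -mulrA.
rewrite [X in _ <= _ * X]mulrA.
have tau2 : tau ^+ 2 != 0 by rewrite expf_neq0// lt0r_neq0.
rewrite le_eqVlt; apply/orP; left; apply/eqP.
by field; rewrite lt0r_neq0.
Qed.

Lemma pow_gap_ge0 (y tau : R) k : 0 < tau ->
  0 <= (`|y| + tau) ^+ k - `|y| ^+ k - k%:R * tau * `|y| ^+ k.-1.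
Proof.
move=> t0; have := @pow_taylor2 y tau tau k t0; rewrite gtr0_norm// lexx => /(_ isT).
by rewrite divff ?lt0r_neq0// expr1n mul1r; apply: le_trans.
Qed.

Lemma pow_quad (y t tau r : R) k : 0 < tau -> `|t| <= tau -> `|y| + tau <= r ->
  `|(y + t) ^+ k - y ^+ k - k%:R * t * y ^+ k.-1| <= (`|t| / tau) ^+ 2 * r ^+ k.
Proof.
move=> t0 tt yr; apply: le_trans (pow_taylor2 y k t0 tt) _.
rewrite ler_wpM2l ?exprn_ge0 ?divr_ge0 ?(ltW t0)//.
have h : (`|y| + tau) ^+ k <= r ^+ k.
  have : 0 <= `|y| + tau by rewrite addr_ge0// ltW.
  by move=> p0; rewrite lerXn2r ?nnegrE// (le_trans p0).
have : 0 <= `|y| ^+ k by rewrite exprn_ge0.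
have : 0 <= k%:R * tau * `|y| ^+ k.-1 by rewrite !mulr_ge0 ?exprn_ge0// ltW.
move: h; clear; lra.
Qed.

Lemma pow_lin (y tau r : R) k : 0 < tau -> `|y| + tau <= r ->
  k%:R * `|y| ^+ k.-1 <= r ^+ k / tau.
Proof.
move=> t0 yr; rewrite ler_pdivlMr//.
have h : (`|y| + tau) ^+ k <= r ^+ k.
  have : 0 <= `|y| + tau by rewrite addr_ge0// ltW.
  by move=> p0; rewrite lerXn2r ?nnegrE// (le_trans p0).
have : 0 <= `|y| ^+ k by rewrite exprn_ge0.
have := pow_gap_ge0 y k t0; rewrite mulrAC; move: h; clear; lra.
Qed.

Lemma is_derive_quad (V : normedModType R) (f : V -> R) a v l (K tau : R) : 0 < tau ->
  (forall t, `|t| <= tau -> `|f (a + t *: v) - f a - t * l| <= K * t ^+ 2) ->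
  is_derive a v f l.
Proof.
move=> t0 H.
have cv : (fun h => h^-1 *: ((f \o shift a) (h *: v) - f a)) @ 0^' --> l.
  apply/cvgrPdist_lt => e e0.
  have K0 : 0 < `|K| + 1 by rewrite ltr_wpDl.
  have m0 : 0 < Num.min tau (e / (`|K| + 1)) by rewrite lt_min t0 divr_gt0.
  apply/nbhs_ballP; exists (Num.min tau (e / (`|K| + 1))) => //= h.
  rewrite -ball_normE /ball_ /= sub0r normrN lt_min => /andP[h1 h2] h0.
  have := H h (ltW h1); rewrite [h *: v + a]addrC => Hh.
  have -> : l - h^-1 *: (f (a + h *: v) - f a) = - (h^-1 * (f (a + h *: v) - f a - h * l)).
    by rewrite [in RHS]mulrBr mulKf// opprB.
  rewrite normrN normrM normfV mulrC ltr_pdivrMr ?normr_gt0//.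
  apply: le_lt_trans Hh _; rewrite -normr_gt0 in h0.
  move: h2; rewrite ltr_pdivlMr// => h2.
  rewrite -[h ^+ 2]real_normK ?num_real//.
  apply: (@le_lt_trans _ _ (`|h| * (`|K| + 1) * `|h| - `|h| ^+ 2)).
    have := ler_norm K; move: h0; move: `|h| `|K| => x y; clear; nra.
  have : 0 < `|h| ^+ 2 by rewrite exprn_gt0.
  have : `|h| * (`|K| + 1) * `|h| < e * `|h| by rewrite ltr_pM2r.
  clear; lra.
split; first by apply/cvg_ex; exists l.
exact: cvg_lim cv.
Qed.

Section Series.
Variable N : nat.
Local Notation A := {ffun 'I_N -> nat}.
Implicit Types (c d : A -> C) (phi psi : 'rV[R]_N -> C) (a y : 'rV[R]_N).

(** Unlike [Dreal], which always has a value, this says that the derivative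
    exists. *)
Definition dreal_at phi (v a : 'rV[R]_N) (S : C) : Prop :=
  is_derive a v (fun x => complex.Re (phi x)) (complex.Re S) /\
  is_derive a v (fun x => complex.Im (phi x)) (complex.Im S).

Lemma dreal_atE phi v a S : dreal_at phi v a S -> Dreal phi v a = S.
Proof.
case=> H1 H2; rewrite /Dreal (@derive_val _ _ _ _ _ _ _ H1) (@derive_val _ _ _ _ _ _ _ H2).
by case: S H1 H2.
Qed.

Lemma dreal_quad phi v a S (K tau : R) : 0 < tau ->
  (forall t, `|t| <= tau -> mag (phi (a + t *: v) - phi a - t%:C * S) <= K * t ^+ 2) ->
  dreal_at phi v a S.
Proof.
move=> t0 H; split; apply: (is_derive_quad (K := K) t0) => t /H; apply: le_trans.
  apply: le_trans (le_Re_mag _); rewrite !raddfB /=.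
  by case: S {H} => p q /=; rewrite mul0r subr0.
apply: le_trans (le_Im_mag _); rewrite !raddfB /=.
by case: S {H} => p q /=; rewrite mul0r addr0.
Qed.

Lemma dreal_at_cst (x : C) v a : dreal_at (fun=> x) v a 0.
Proof. by split; exact: is_derive_cst. Qed.

Lemma dreal_atD phi psi v a S T : dreal_at phi v a S -> dreal_at psi v a T ->
  dreal_at (fun x => phi x + psi x) v a (S + T).
Proof.
case=> H1 H2 [H3 H4]; split; rewrite raddfD; under eq_fun do rewrite raddfD.
  exact: is_deriveD.
exact: is_deriveD.
Qed.

Lemma dreal_atM phi psi v a S T : dreal_at phi v a S -> dreal_at psi v a T ->
  dreal_at (fun x => phi x * psi x) v a (phi a * T + psi a * S).
Proof.
case=> H1 H2 [H3 H4]; split.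
  have := is_deriveB (is_deriveM H1 H3) (is_deriveM H2 H4).
  rewrite (_ : _ - _ = fun x => complex.Re (phi x * psi x)); last first.
    by apply/funext => x; rewrite -[LHS]/(complex.Re (phi x) * complex.Re (psi x) -
      complex.Im (phi x) * complex.Im (psi x)); case: (phi x) (psi x) => [? ?] [? ?].
  move=> H; apply: (is_derive_eq H); rewrite /GRing.scale /=.
  case: (phi a) (psi a) S T {H H1 H2 H3 H4} => [p q] [s t] [u v'] [w x] /=; ring.
have := is_deriveD (is_deriveM H1 H4) (is_deriveM H2 H3).
rewrite (_ : _ + _ = fun x => complex.Im (phi x * psi x)); last first.
  by apply/funext => x; rewrite -[LHS]/(complex.Re (phi x) * complex.Im (psi x) +
    complex.Im (phi x) * complex.Re (psi x)); case: (phi x) (psi x) => [? ?] [? ?].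
move=> H; apply: (is_derive_eq H); rewrite /GRing.scale /=.
case: (phi a) (psi a) S T {H H1 H2 H3 H4} => [p q] [s t] [u v'] [w x] /=; ring.
Qed.

Definition pderiv_coef (i : 'I_N) c : A -> C :=
  fun al => (al i).+1%:R * c (madd al (munit i)).

(** The radius is halved so that increments of size up to [r / 2] stay in the
    polydisc: then the second-order remainders of all the terms are dominated
    by the terms of the series at radius [r], and the error of termwise
    differentiation is quadratic. *)
Lemma ps_deriv phi a c (r B : R) i : ps_at phi a c r B ->
  ps_at (fun x => Dreal phi (delta_mx 0 i) x) a (pderiv_coef i c) (r / 2) (B / (r / 2)) /\
  forall y, `|y| <= r / 2 ->
    exists S, dreal_at phi (delta_mx 0 i) (a + y) S.
Proof.
move=> [r0 sB hs]; pose tau := r / 2; have t0 : 0 < tau by rewrite divr_gt0.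
have tr : tau + tau = r by rewrite /tau; lra.
pose pm (y : 'rV[R]_N) (be : A) := \prod_(j | j != i) y 0 j ^+ be j.
have mE y be : monomial y be = y 0 i ^+ be i * pm y be by rewrite /monomial (bigD1 i).
pose W y (be : A) := c be * ((be i)%:R * (y 0 i ^+ (be i).-1 * pm y be))%:C.
have degE (be : A) : r ^+ deg be = r ^+ be i * \prod_(j | j != i) r ^+ be j.
  by rewrite expr_deg (bigD1 i).
have pmB y be : `|y| <= r -> `|pm y be| <= \prod_(j | j != i) r ^+ be j.
  move=> yr; rewrite /pm normr_prod; apply: ler_prod => j _.
  have h := le_trans (rV_entry y j) yr.
  by rewrite normr_ge0 normrX lerXn2r ?nnegrE// (le_trans (normr_ge0 _) h).
have Wsum y : `|y| <= tau -> summable_by (W y) (B / tau).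
  move=> yt; rewrite mulrC.
  have sB' := summable_byZ (tau^-1)%:C sB; rewrite mag_real gtr0_norm ?invr_gt0// in sB'.
  apply: summable_by_le sB' => be.
  rewrite /W [in leRHS]mulrCA !magM ler_wpM2l ?mag_ge0// !mag_real -normrM [leRHS]ger0_norm; last first.
    by rewrite mulr_ge0 ?invr_ge0 ?exprn_ge0 ?ltW.
  have yi := le_trans (rV_entry y i) yt.
  have yr : `|y| <= r by rewrite -tr; lra.
  rewrite degE [in leLHS]mulrA [in leRHS]mulrA [tau^-1 * _]mulrC !normrM normr_nat normrX.
  apply: ler_pM; [by rewrite mulr_ge0// exprn_ge0|exact: normr_ge0| |exact: pmB].
  by apply: pow_lin => //; rewrite -tr lerD2r.
have Wder y S : `|y| <= tau -> has_sum (W y) S ->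
    dreal_at phi (delta_mx 0 i) (a + y) S.
  move=> yt hS; apply: (@dreal_quad _ _ _ _ (B / tau ^+ 2) tau) => // t tt.
  pose y' := y + t *: delta_mx 0 i.
  have y'i : y' 0 i = y 0 i + t by rewrite !mxE !eqxx mulr1.
  have y'j j : j != i -> y' 0 j = y 0 j.
    by move=> ji; rewrite !mxE !eqxx (negbTE ji) mulr0 addr0.
  have yr : `|y| <= r by rewrite -tr; lra.
  have y'r : `|y'| <= r.
    apply: rV_norm_le => [|j]; first exact: ltW.
    have yj := le_trans (rV_entry y j) yt.
    have [->|ji] := eqVneq j i; last by rewrite y'j// (le_trans (rV_entry y j)).
    by rewrite y'i (le_trans (ler_normD _ _))// -tr lerD// (le_trans (rV_entry y i)).
  have pmE be : pm y' be = pm y be by apply: eq_bigr => j ji; rewrite y'j.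
  have hsum := has_sumD (has_sumD (hs _ y'r) (has_sumZ (-1) (hs _ yr))) (has_sumZ (- t%:C) hS).
  have -> : phi (a + y + t *: delta_mx 0 i) - phi (a + y) - t%:C * S =
      phi (a + y') + -1 * phi (a + y) + - t%:C * S.
    by rewrite /y' addrA mulN1r mulNr.
  apply: has_sum_bound hsum.
  have sB' := summable_byZ ((t / tau) ^+ 2)%:C sB.
  rewrite mag_real ger0_norm ?sqr_ge0// in sB'.
  have -> : B / tau ^+ 2 * t ^+ 2 = (t / tau) ^+ 2 * B by field; rewrite lt0r_neq0.
  apply: summable_by_le sB' => be.
  have -> : c be * (monomial y' be)%:C + -1 * (c be * (monomial y be)%:C) + - t%:C * W y be =
     c be * (((y 0 i + t) ^+ be i - y 0 i ^+ be i - (be i)%:R * t * y 0 i ^+ (be i).-1) * pm y be)%:C.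
    rewrite !mE pmE y'i /W.
    rewrite !rmorphM !rmorphB /= !rmorphM /=; ring.
  rewrite [in leRHS]mulrCA !magM ler_wpM2l ?mag_ge0// !mag_real -normrM.
  rewrite [leRHS]ger0_norm; last by rewrite mulr_ge0 ?sqr_ge0 ?exprn_ge0 ?ltW.
  rewrite degE mulrA normrM; apply: ler_pM => //; last exact: pmB.
  have yi := le_trans (rV_entry y i) yt.
  have -> : (t / tau) ^+ 2 = (`|t| / tau) ^+ 2.
    by rewrite !expr_div_n real_normK ?num_real.
  by apply: pow_quad => //; rewrite -tr lerD2r.
have finj : injective (fun al : A => madd al (munit i)).
  by move=> al be /ffunP E; apply/ffunP => j; have := E j; rewrite !ffunE => /addIn.
have WE y al : W y (madd al (munit i)) = pderiv_coef i c al * (monomial y al)%:C.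
  have pmE : pm y (madd al (munit i)) = pm y al.
    by apply: eq_bigr => j ji; rewrite !ffunE (negbTE ji) addn0.
  rewrite /W /pderiv_coef pmE mE !ffunE eqxx addn1 /= !rmorphM rmorph_nat /=.
  by rewrite mulrCA mulrA.
have W0 y (be : A) : (forall al, be != madd al (munit i)) -> W y be = 0.
  move=> H; suff bi0 : be i = 0%N :> nat by rewrite /W bi0 mul0r mulr0.
  apply/eqP; apply: contraT => bi.
  have := H [ffun j => (be j - (j == i))%N]; rewrite (_ : madd _ _ = be) ?eqxx//.
  apply/ffunP => j; rewrite !ffunE.
  by case: eqP => [->|_]; rewrite ?subn0 ?addn0// subnK// lt0n.
split; last first.
  move=> y yt; have [S HS] := has_sum_exists (Wsum y yt).
  by exists S; exact: Wder.
split => //.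
  have ct : `|const_mx tau : 'rV[R]_N| <= tau.
    by apply: rV_norm_le => [|j]; [exact: ltW|rewrite mxE gtr0_norm].
  have := summable_by_inj finj (Wsum _ ct); apply: summable_by_le => al /=.
  by rewrite WE monomial_const.
move=> y yt; have [S HS] := has_sum_exists (Wsum y yt).
rewrite (dreal_atE (Wder _ _ yt HS)).
by apply: eq_has_sum (has_sum_inj finj (W0 y) HS) => al /=; rewrite WE.
Qed.

Lemma analytic_Dreal phi a i : analytic_at phi a ->
  analytic_at (fun x => Dreal phi (delta_mx 0 i) x) a.
Proof.
move=> /analytic_ps [c [r [B P]]]; apply/analytic_ps.
by exists (pderiv_coef i c), (r / 2), (B / (r / 2)); have [] := ps_deriv i P.
Qed.

Lemma analytic_dreal phi a i : analytic_at phi a ->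
  dreal_at phi (delta_mx 0 i) a (Dreal phi (delta_mx 0 i) a).
Proof.
move=> /analytic_ps [c [r [B P]]]; have [_ H] := ps_deriv i P.
have [r0 _ _] := P.
have [|S HS] := H 0; first by rewrite normr0 divr_ge0// ltW.
by rewrite addr0 in HS; rewrite (dreal_atE HS).
Qed.

Lemma ps_center phi a c (r B : R) : ps_at phi a c r B -> phi a = c (mzero N).
Proof.
move=> [r0 sB hs]; have := hs 0; rewrite normr0 addr0 => /(_ (ltW r0)) h.
apply: has_sum_uniq h _ => e e0; exists [:: mzero N] => s us sub.
rewrite (bigD1_seq (mzero N))/= ?sub ?mem_head// monomial0 mulr1 big1 ?addr0 ?subrr ?mag0//.
move=> al al0; rewrite /monomial; have [d0|] := boolP [forall j, al j == 0%N].
  case/negP: al0; apply/eqP/ffunP => j; rewrite ffunE; apply/eqP; exact: (forallP d0).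
rewrite negb_forall => /existsP [j alj]; rewrite (bigD1 j)//= mxE expr0n (negbTE alj).
by rewrite mul0r mulr0.
Qed.

Lemma has_sum_finite (K : choiceType) (u : K -> C) (s0 : seq K) : uniq s0 ->
  has_sum (fun k => if k \in s0 then u k else 0) (\sum_(k <- s0) u k).
Proof.
move=> us0 e e0; exists s0 => s us sub.
rewrite (sum_sub_mem _ us0 us sub) [X in _ + X - _]big1 ?addr0; last first.
  by move=> k /negbTE ->.
by rewrite !big_seq (eq_bigr u) ?subrr ?mag0// => k ->.
Qed.

Lemma ps_first_order phi a c (r B : R) : ps_at phi a c r B ->
  forall y, `|y| <= r ->
    mag (phi (a + y) - phi a - \sum_i c (munit i) * (y 0 i)%:C) <= B / r ^+ 2 * `|y| ^+ 2.
Proof.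
move=> P y yr; have [r0 sB hs] := P.
pose u al := c al * (monomial y al)%:C.
pose s0 := mzero N :: [seq munit i | i <- enum 'I_N].
have us0 : uniq s0.
  rewrite /s0 /= map_inj_uniq ?enum_uniq ?andbT; last first.
    by move=> i j /ffunP /(_ i); rewrite !ffunE eqxx; case: eqP.
  apply/mapP => -[i _ /ffunP /(_ i)]; by rewrite !ffunE eqxx.
have := has_sumD (hs y yr) (has_sumZ (-1) (has_sum_finite u us0)).
have uz : u (mzero N) = phi a by rewrite /u monomial0 mulr1 (ps_center P).
rewrite big_cons big_map big_enum /= uz.
have -> : phi (a + y) + -1 * (phi a + \sum_(i in 'I_N) u (munit i)) =
   phi (a + y) - phi a - \sum_i c (munit i) * (y 0 i)%:C.
  rewrite mulN1r opprD addrA; congr (_ - _); apply: eq_bigr => i _.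
  by rewrite /u monomial_unit.
apply: has_sum_bound.
have sB' := summable_byZ ((`|y| / r) ^+ 2)%:C sB.
rewrite mag_real ger0_norm ?sqr_ge0// in sB'.
have -> : B / r ^+ 2 * `|y| ^+ 2 = (`|y| / r) ^+ 2 * B by field; rewrite lt0r_neq0.
apply: summable_by_le sB' => al.
case: ifPn => als; first by rewrite /u mulN1r subrr mag0 mag_ge0.
rewrite mulr0 addr0 /u [in leRHS]mulrCA !magM ler_wpM2l ?mag_ge0// !mag_real -normrM.
rewrite [leRHS]ger0_norm; last by rewrite mulr_ge0 ?sqr_ge0 ?exprn_ge0 ?ltW.
have d2 : (2 <= deg al)%N.
  case d : (deg al) => [|[|k]] //; case/negP: als; rewrite inE.
    by rewrite (deg_eq0 d) eqxx.
  by have [i ->] := deg_eq1 d; rewrite map_f ?orbT// mem_enum.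
apply: le_trans (monomial_bound al (lexx `|y|)) _.
rewrite -(subnK d2) [in leLHS]exprD [in leRHS]exprD expr_div_n [in leLHS]mulrC.
have -> (x : R) : `|y| ^+ 2 / r ^+ 2 * (x * r ^+ 2) = `|y| ^+ 2 * x.
  by field; rewrite lt0r_neq0.
by rewrite ler_wpM2l ?sqr_ge0// lerXn2r ?nnegrE// ltW.
Qed.

Lemma norm_delta i : `|delta_mx 0 i : 'rV[R]_N| <= 1.
Proof.
apply: rV_norm_le => // j; rewrite mxE eqxx /=.
by case: (j == i); rewrite ?normr1 ?normr0.
Qed.

(** The terms of degree at least 2 are quadratically small. *)
Lemma ps_coef1 phi a c (r B : R) i : ps_at phi a c r B ->
  Dreal phi (delta_mx 0 i) a = c (munit i).
Proof.
move=> P; apply: dreal_atE; have [r0 sB _] := P.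
apply: (@dreal_quad _ _ _ _ (B / r ^+ 2) r) => // t tr.
have nt : `|t *: delta_mx 0 i : 'rV[R]_N| <= `|t|.
  by rewrite normrZ ler_piMr// norm_delta.
have := ps_first_order P (le_trans nt tr).
rewrite (bigD1 i)//= big1 ?addr0; last first.
  by move=> j ji; rewrite !mxE eqxx (negbTE ji) mulr0 mulr0.
rewrite !mxE !eqxx mulr1 mulrC => /le_trans; apply.
rewrite ler_wpM2l ?divr_ge0 ?exprn_ge0 ?(ltW r0) ?(summable_by_ge0 sB)//.
by rewrite -[t ^+ 2]real_normK ?num_real// lerXn2r ?nnegrE.
Qed.

(** Both sides are read off the same coefficient of the series at [a]. *)
Lemma DrealC phi a i j : analytic_at phi a ->
  Dreal (fun x => Dreal phi (delta_mx 0 i) x) (delta_mx 0 j) a =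
  Dreal (fun x => Dreal phi (delta_mx 0 j) x) (delta_mx 0 i) a.
Proof.
move=> /analytic_ps [c [r [B P]]].
have [Pi _] := ps_deriv i P; have [Pj _] := ps_deriv j P.
rewrite (ps_coef1 j Pi) (ps_coef1 i Pj) /pderiv_coef !ffunE [i == j]eq_sym.
congr (_ * c _); apply/ffunP => k; by rewrite !ffunE addnC.
Qed.

Lemma analytic_first_order phi a : analytic_at phi a ->
  exists (r K : R), 0 < r /\ forall y, `|y| <= r ->
    mag (phi (a + y) - phi a - \sum_i Dreal phi (delta_mx 0 i) a * (y 0 i)%:C)
      <= K * `|y| ^+ 2.
Proof.
move=> /analytic_ps [c [r [B P]]]; exists r, (B / r ^+ 2); split; first by case: P.
move=> y yr; have := ps_first_order P yr; apply: le_trans.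
rewrite le_eqVlt; apply/orP; left; apply/eqP; congr (mag (_ - _)).
by apply: eq_bigr => i _; rewrite (ps_coef1 i P).
Qed.

End Series.
End TermwiseDerivative.

(** * Iterated derivatives and flatness *)

Section Flatness.
Variable R : realType.
Local Notation C := R[i].
Variable N : nat.
Local Notation A := {ffun 'I_N -> nat}.
Implicit Types (c : A -> C) (phi psi : 'rV[R]_N -> C) (a y : 'rV[R]_N).

(** The head of the list is the last derivative taken. *)
Definition Dl (l : seq 'I_N) phi : 'rV[R]_N -> C :=
  foldr (fun i psi => Dreal psi (delta_mx 0 i)) phi l.

Definition supported (P : pred 'I_N) y : Prop := forall i, ~~ P i -> y 0 i = 0.

(** [P] selects the directions: all of them, or those tangent to the
    leaves. *)
Definition flat_at (P : pred 'I_N) phi a : Prop :=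
  forall l, all P l -> Dl l phi a = 0.

Lemma Dl_rcons l i phi : Dl (rcons l i) phi = Dl l (Dreal phi (delta_mx 0 i)).
Proof. by rewrite /Dl foldr_rcons. Qed.

Lemma analytic_Dl l phi a : (\forall x \near a, analytic_at phi x) ->
  analytic_at (Dl l phi) a.
Proof.
move=> H; suff : \forall x \near a, analytic_at (Dl l phi) x by exact: nbhs_singleton.
elim: l => [//|i l IH]; apply: filterS IH => x; exact: analytic_Dreal.
Qed.

(** By induction on the degree: a derivative turns a coefficient into one of
    lower degree, up to a nonzero factor. *)
Lemma flat_coef (P : pred 'I_N) n : forall (al : A) phi a c (r B : R),
  deg al = n -> ps_at phi a c r B -> flat_at P phi a ->
  (forall i, ~~ P i -> al i = 0%N) -> c al = 0.
Proof.
elim: n => [|n IH] al phi a c r B d ps fl sup.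
  by rewrite (deg_eq0 d) -(ps_center ps); exact: (fl [::]).
case: (mzero_or_succ al) d sup => [->|[be [i ->]]]; first by rewrite deg0.
rewrite deg_madd deg_munit addn1 => -[d] sup.
have Pi : P i.
  by apply: contraT => /sup; rewrite !ffunE eqxx addn1.
have [psi _] := ps_deriv i ps.
have := IH be _ _ _ _ _ d psi.
rewrite /pderiv_coef => H; have {}H : (be i).+1%:R * c (madd be (munit i)) = 0.
  apply: H.
    move=> l Pl; have := fl (rcons l i); rewrite Dl_rcons; apply.
    by rewrite all_rcons Pi.
  by move=> j /sup; rewrite !ffunE => /eqP; rewrite addn_eq0 => /andP[/eqP].
by move/eqP: H; rewrite mulf_eq0 pnatr_eq0 /= => /eqP.
Qed.

(** At a point displaced in the directions of [P], only the monomials in these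
    directions are nonzero. *)
Lemma flat_zero (P : pred 'I_N) phi a : analytic_at phi a -> flat_at P phi a ->
  exists2 r : R, 0 < r & forall y, `|y| <= r -> supported P y -> phi (a + y) = 0.
Proof.
move=> /analytic_ps [c [r [B ps]]] fl; have [r0 _ hs] := ps.
exists r => // y yr sy; apply: has_sum_uniq (hs y yr) _ => e e0.
exists [::] => s _ _; rewrite big1 ?subrr ?mag0// => al _.
have [/forallP H|] := boolP [forall i, ~~ P i ==> (al i == 0%N)].
  by rewrite (flat_coef erefl ps fl) ?mul0r// => i /(implyP (H i))/eqP.
rewrite negb_forall => /existsP[i +]; rewrite negb_imply => /andP[Pi ali].
by rewrite /monomial (bigD1 i)//= (sy i Pi) expr0n (negbTE ali) mul0r mulr0.
Qed.

Lemma Dreal_line0 phi v a (tau : R) : 0 < tau ->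
  (forall t, `|t| <= tau -> phi (a + t *: v) = 0) -> Dreal phi v a = 0.
Proof.
move=> t0 H; apply: dreal_atE; apply: (@dreal_quad _ _ _ _ _ _ 0 tau) => // t /H ->.
have := H 0; rewrite normr0 scale0r addr0 => -> ; last exact: ltW.
by rewrite mulr0 !subr0 mag0 mul0r.
Qed.

Lemma zero_flat (P : pred 'I_N) phi a (r : R) :
  (forall y, `|y| < r -> supported P y -> phi (a + y) = 0) ->
  forall l, all P l -> forall y, `|y| < r -> supported P y -> Dl l phi (a + y) = 0.
Proof.
move=> H; elim=> [|i l IH] //= /andP[Pi Pl] y yr sy.
have r0 : 0 < (r - `|y|) / 2 by rewrite divr_gt0 ?subr_gt0.
apply: (Dreal_line0 r0) => t tr; rewrite -addrA; apply: IH => //.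
  apply: le_lt_trans (ler_normD _ _) _.
  have : `|t *: delta_mx 0 i : 'rV[R]_N| <= `|t| by rewrite normrZ ler_piMr// norm_delta.
  lra.
move=> j Pj; rewrite !mxE sy// add0r.
have -> : (j == i) = false by apply: contraNF Pj => /eqP ->.
by rewrite andbF mulr0.
Qed.

Lemma analytic_continuous phi a : analytic_at phi a ->
  forall e : R, 0 < e -> exists2 d : R, 0 < d &
    forall y, `|y| <= d -> mag (phi (a + y) - phi a) < e.
Proof.
move=> /analytic_first_order [r [K [r0 H]]] e e0.
pose L := \sum_i mag (Dreal phi (delta_mx 0 i) a).
have L0 : 0 <= L by apply: sumr_ge0 => *; exact: mag_ge0.
pose q := L + `|K| * r + 1; have q0 : 0 < q.
  by rewrite /q ltr_wpDl// addr_ge0// mulr_ge0// ltW.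
exists (Num.min r (e / q / 2)); first by rewrite lt_min r0 !divr_gt0.
move=> y; rewrite le_min => /andP[yr ye].
have h1 := H y yr.
have h2 : mag (\sum_i Dreal phi (delta_mx 0 i) a * (y 0 i)%:C) <= L * `|y|.
  apply: le_trans (mag_sum _ _ _) _; rewrite mulr_suml; apply: ler_sum => i _.
  by rewrite magM mag_real ler_wpM2l ?mag_ge0// rV_entry.
have h3 := magD (phi (a + y) - phi a - \sum_i Dreal phi (delta_mx 0 i) a * (y 0 i)%:C)
   (\sum_i Dreal phi (delta_mx 0 i) a * (y 0 i)%:C).
rewrite subrK in h3.
have h4 : K * `|y| ^+ 2 <= `|K| * r * `|y|.
  apply: (@le_trans _ _ (`|K| * `|y| ^+ 2)); first by rewrite ler_wpM2r ?sqr_ge0// ler_norm.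
  by rewrite -mulrA ler_wpM2l// expr2 ler_wpM2r.
have h5 : q * `|y| <= e / 2.
  by rewrite mulrC -ler_pdivlMr// mulrAC.
have : (L + `|K| * r) * `|y| <= q * `|y| by rewrite ler_wpM2r// /q; lra.
move: h1 h2 h3 h4 h5; rewrite mulrDl; move: e0; clear; lra.
Qed.

End Flatness.

(** * The space R^d x C^m and functions holomorphic in the second variable *)

Section RealCoordinatesTopology.
Variable R : realType.
Local Notation C := R[i].
Variables d m : nat.
Local Notation N := (d + (m + m))%N.
Local Notation E := ('rV[R]_d * 'rV[C]_m)%type.
Implicit Types (p q : E) (y : 'rV[R]_N).

Lemma map_mxReD (x z : 'rV[C]_m) :
  map_mx (@complex.Re R) (x + z) = map_mx (@complex.Re R) x + map_mx (@complex.Re R) z.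
Proof. by apply/rowP => j; rewrite !mxE raddfD. Qed.

Lemma map_mxImD (x z : 'rV[C]_m) :
  map_mx (@complex.Im R) (x + z) = map_mx (@complex.Im R) x + map_mx (@complex.Im R) z.
Proof. by apply/rowP => j; rewrite !mxE raddfD. Qed.

Lemma to_realD p q : to_real (p + q) = to_real p + to_real q.
Proof.
by rewrite /to_real /realify /= map_mxReD map_mxImD !add_row_mx.
Qed.

Lemma of_realD (y y' : 'rV[R]_N) : @of_real R d m (y + y') = of_real y + of_real y'.
Proof. by rewrite -[RHS](@to_realK R d m) to_realD !of_realK. Qed.

Lemma to_real0 : to_real (0 : E) = 0.
Proof. by apply: (addrI (to_real (0 : E))); rewrite -to_realD !addr0. Qed.

Lemma norm_to_real_le p (r : R) : 0 <= r -> `|p.1| <= r -> mag p.2 <= r -> `|to_real p| <= r.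
Proof.
move=> r0 h1 h2; apply: rV_norm_le => // i; rewrite /to_real /realify mxE.
case: splitP => j _; first exact: le_trans (rV_entry _ _) h1.
rewrite mxE; case: splitP => k _; rewrite mxE; apply: le_trans h2.
  exact: le_trans (le_Re_mag _) (mag_entry _ _ _).
exact: le_trans (le_Im_mag _) (mag_entry _ _ _).
Qed.

Lemma norm_of_real1 y : `|(of_real y).1 : 'rV[R]_d| <= `|y|.
Proof. by apply: rV_norm_le => // i; rewrite mxE; exact: rV_entry. Qed.

Lemma mag_of_real2 y : mag ((of_real y).2 : 'rV[C]_m) <= 2 * `|y|.
Proof.
apply: mag_mx_le => [|i j]; first by rewrite mulr_ge0.
rewrite mxE; apply: le_trans (mag_le_ReIm _) _ => /=.
by rewrite mulr_natl mulr2n; apply: lerD; rewrite !mxE; exact: rV_entry.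
Qed.

Lemma nbhs_prodP p (B : set E) : nbhs p B <-> exists2 r : R, 0 < r &
  forall q, `|q.1 - p.1| <= r -> mag (q.2 - p.2) <= r -> B q.
Proof.
split.
  case=> -[B1 B2] /= [/nbhs_rVP [r1 r10 H1] /nbhs_magP [r2 r20 H2]] H.
  exists (Num.min r1 (r2 / 2)); first by rewrite lt_min r10 divr_gt0.
  move=> [q1 q2] /=; rewrite !le_min => /andP[h1 _] /andP[_ h2].
  apply: H; split => /=.
    by have := H1 _ h1; rewrite addrC subrK.
  by apply: H2; lra.
case=> r r0 H; exists ([set x | `|x - p.1| <= r], [set z | mag (z - p.2) < r]) => /=.
  split; last by apply/nbhs_magP; exists r.
  by apply/nbhs_rVP; exists r => // y yr /=; rewrite [p.1 + y]addrC addrK.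
by move=> q [/= h1 h2]; apply: H => //; exact: ltW.
Qed.

Lemma nbhs_to_realP p (B : set E) : nbhs p B <-> exists2 r : R, 0 < r &
  forall y, `|y| <= r -> B (of_real (to_real p + y)).
Proof.
split=> [/nbhs_prodP [r r0 H]|[r r0 H]].
  exists (r / 2) => [|y yr]; first by rewrite divr_gt0.
  apply: H; rewrite of_realD to_realK /= addrAC subrr add0r.
    by apply: le_trans (norm_of_real1 y) _; lra.
  by apply: le_trans (mag_of_real2 y) _; lra.
apply/nbhs_prodP; exists r => // q h1 h2.
rewrite -[q](@to_realK R d m) -[to_real q](subrK (to_real p)) addrC; apply: H.
rewrite -[to_real q - to_real p](_ : to_real (q - p) = _).
  by apply: norm_to_real_le => //; exact: ltW.
by apply: (addIr (to_real p)); rewrite -to_realD !subrK.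
Qed.

Lemma near_to_realP p (B : set E) : nbhs p B <-> nbhs (to_real p) (@of_real R d m @^-1` B).
Proof. by rewrite nbhs_to_realP nbhs_rVP. Qed.

Lemma open_to_real (U : set E) : open U -> open (@of_real R d m @^-1` U).
Proof.
rewrite !openE => UO a /= Ua; apply/nbhs_rVP.
have /nbhs_to_realP [r r0 H] := UO _ Ua; exists r => // y /H; by rewrite of_realK.
Qed.

Definition ux (k : 'I_m) : 'I_N := rshift d (lshift m k).
Definition vx (k : 'I_m) : 'I_N := rshift d (rshift m k).

Definition leafdir : pred 'I_N := fun i => if fintype.split i is inr _ then true else false.

Lemma leafdirP i : leafdir i -> (exists k, i = ux k) \/ (exists k, i = vx k).
Proof.
rewrite /leafdir; case: splitP => // j ij _; case: (split_ordP j) ij => k -> ij.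
  by left; exists k; apply: val_inj; rewrite /= ij.
by right; exists k; apply: val_inj; rewrite /= ij.
Qed.

Lemma supported_leaf y : supported leafdir y <-> (of_real y).1 = 0 :> 'rV[R]_d.
Proof.
split=> [H|/rowP H i].
  by apply/rowP => j; rewrite !mxE H// /leafdir; case: splitP => // k /= E;
    have := ltn_ord j; rewrite E ltnNge leq_addr.
rewrite /leafdir; case: splitP => // j ij _; have := H j; rewrite !mxE => <-.
by congr (y 0 _); apply: val_inj.
Qed.

End RealCoordinatesTopology.

Section PartiallyHolomorphic.
Variable R : realType.
Local Notation C := R[i].
Variables d m : nat.
Local Notation N := (d + (m + m))%N.
Local Notation E := ('rV[R]_d * 'rV[C]_m)%type.
Implicit Types (phi psi : 'rV[R]_N -> C) (O : set 'rV[R]_N) (p q : E).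

(** Real-analytic functions that satisfy the Cauchy-Riemann equations along
    the leaves [x = const]. *)
Definition holo_on O phi : Prop := forall a, O a -> analytic_at phi a /\
  forall k, Dreal phi (delta_mx 0 (vx d k)) a = 'i%C * Dreal phi (delta_mx 0 (ux d k)) a.

Lemma holo_cst O x : holo_on O (fun=> x).
Proof.
move=> a _; split; first exact: analytic_cst.
by move=> k; rewrite !(dreal_atE (dreal_at_cst x _ a)) mulr0.
Qed.

Lemma holoD O phi psi : holo_on O phi -> holo_on O psi ->
  holo_on O (fun x => phi x + psi x).
Proof.
move=> h1 h2 a Oa; have [a1 c1] := h1 a Oa; have [a2 c2] := h2 a Oa.
split; first exact: analyticD.
move=> k.
rewrite (dreal_atE (dreal_atD (analytic_dreal (vx d k) a1) (analytic_dreal (vx d k) a2))).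
rewrite (dreal_atE (dreal_atD (analytic_dreal (ux d k) a1) (analytic_dreal (ux d k) a2))).
by rewrite c1 c2 mulrDr.
Qed.

Lemma holoM O phi psi : holo_on O phi -> holo_on O psi ->
  holo_on O (fun x => phi x * psi x).
Proof.
move=> h1 h2 a Oa; have [a1 c1] := h1 a Oa; have [a2 c2] := h2 a Oa.
split; first exact: analyticM.
move=> k.
rewrite (dreal_atE (dreal_atM (analytic_dreal (vx d k) a1) (analytic_dreal (vx d k) a2))).
rewrite (dreal_atE (dreal_atM (analytic_dreal (ux d k) a1) (analytic_dreal (ux d k) a2))).
by rewrite c1 c2; ring.
Qed.

Lemma holo_sum O I (r : seq I) (P : pred I) (F : I -> 'rV[R]_N -> C) :
  (forall i, P i -> holo_on O (F i)) -> holo_on O (fun x => \sum_(i <- r | P i) F i x).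
Proof.
move=> dF; elim: r => [|i r IH].
  by under eq_fun do rewrite big_nil; exact: holo_cst.
under eq_fun do rewrite big_cons.
case Pi : (P i); last exact: IH.
by apply: holoD IH; exact: dF.
Qed.

Lemma holo_prod O I (r : seq I) (P : pred I) (F : I -> 'rV[R]_N -> C) :
  (forall i, P i -> holo_on O (F i)) -> holo_on O (fun x => \prod_(i <- r | P i) F i x).
Proof.
move=> dF; elim: r => [|i r IH].
  by under eq_fun do rewrite big_nil; exact: holo_cst.
under eq_fun do rewrite big_cons.
case Pi : (P i); last exact: IH.
by apply: holoM IH; exact: dF.
Qed.

Lemma holo_det O n (F : 'I_n -> 'I_n -> 'rV[R]_N -> C) :
  (forall i j, holo_on O (F i j)) ->
  holo_on O (fun x => \det (\matrix_(i, j) F i j x)).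
Proof.
move=> HF; rewrite /determinant.
apply: holo_sum => s _; apply: holoM; first exact: holo_cst.
under eq_fun do under eq_bigr do rewrite mxE.
by apply: holo_prod => i _; exact: HF.
Qed.

Lemma Dreal_germ phi psi v a : (\forall x \near a, phi x = psi x) ->
  Dreal phi v a = Dreal psi v a.
Proof.
have [->|v0] := eqVneq v 0; first by rewrite /Dreal !derive0.
move=> H; rewrite /Dreal; congr (_ +i* _); apply: near_eq_derive => //;
  by apply: filterS H => x ->.
Qed.

Lemma holo_Dreal O phi i : open O -> holo_on O phi ->
  holo_on O (Dreal phi (delta_mx 0 i)).
Proof.
move=> oO h a Oa; have [ha _] := h a Oa; split; first exact: analytic_Dreal.
move=> k; rewrite -(DrealC _ _ ha).
rewrite (@Dreal_germ _ (fun x => 'i%C * Dreal phi (delta_mx 0 (ux d k)) x)); last first.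
  by apply: filterS (open_nbhs_nbhs (conj oO Oa)) => x /h [_].
rewrite (dreal_atE (dreal_atM (dreal_at_cst 'i%C _ a)
   (analytic_dreal i (analytic_Dreal (ux d k) ha)))) mulr0 addr0.
by rewrite (DrealC _ _ ha).
Qed.

Lemma holo_Dl O phi l : open O -> holo_on O phi -> holo_on O (Dl l phi).
Proof. by move=> oO h; elim: l => [//|i l IH]; exact: holo_Dreal. Qed.

Definition leaf_derivative phi a (zeta : 'rV[C]_m) : C :=
  \sum_k zeta 0 k * Dreal phi (delta_mx 0 (ux d k)) a.

Lemma leaf_derivative_is_linear phi a : linear (leaf_derivative phi a).
Proof.
move=> t x y; rewrite /leaf_derivative scaler_sumr -big_split; apply: eq_bigr => k _.
by rewrite !mxE mulrDl -[_ *: (_ * _)]/(_ * (_ * _)) mulrA.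
Qed.

HB.instance Definition _ phi a := GRing.isLinear.Build C 'rV[C]_m C _
  (leaf_derivative phi a) (leaf_derivative_is_linear phi a).

(** By the Cauchy-Riemann equations, the first-order expansion in real
    coordinates is complex linear in the leaf directions. *)
Lemma holo_leaf_diff O phi p : holo_on O phi -> O (to_real p) ->
  differentiable (fun xi : 'rV[C]_m => phi (to_real (p.1, xi))) (p.2) /\
  'd (fun xi : 'rV[C]_m => phi (to_real (p.1, xi))) (p.2) =
     leaf_derivative phi (to_real p) :> ('rV[C]_m -> C).
Proof.
move=> h Op; have [an cr] := h _ Op.
pose K := \sum_(k < m) mag (Dreal phi (delta_mx 0 (ux d k)) (to_real p)).
apply: (@cdiff_differentiable _ _ _ _ _ (leaf_derivative phi (to_real p)) K).
  move=> z; apply: le_trans (mag_sum _ _ _) _; rewrite mulr_suml.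
  by apply: ler_sum => k _; rewrite magM mulrC ler_wpM2l ?mag_ge0// mag_entry.
have [r [L [r0 H]]] := analytic_first_order an.
move=> e e0; have L0 : 0 < `|L| + 1 by rewrite ltr_wpDl.
exists (Num.min r (e / (`|L| + 1))); first by rewrite lt_min r0 divr_gt0.
move=> z; rewrite lt_min => /andP[zr ze].
pose y := to_real ((0 : 'rV[R]_d), z).
have yz : `|y| <= mag z by apply: norm_to_real_le => //=; rewrite ?normr0 ?mag_ge0.
have yr : `|y| <= r by apply: le_trans yz _; exact: ltW.
have := H y yr.
have -> : to_real p + y = to_real (p.1, p.2 + z).
  by rewrite /y -to_realD; congr to_real; rewrite -[p + _]/(p.1 + 0, p.2 + z) addr0.
have -> : \sum_i Dreal phi (delta_mx 0 i) (to_real p) * (y 0 i)%:C =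
    leaf_derivative phi (to_real p) z.
  rewrite big_split_ord /= big1 ?add0r; last first.
    by move=> i _; rewrite /y /to_real /= row_mxEl mxE mulr0.
  rewrite big_split_ord /= -big_split /=; apply: eq_bigr => k _.
  rewrite cr /y /to_real /realify /= !row_mxEr row_mxEl !mxE.
  by rewrite [z 0 k in RHS]complexE; ring.
case: p {Op an cr K H} @y yz yr => x xi y yz yr /= => /le_trans; apply.
apply: (@le_trans _ _ ((`|L| + 1) * mag z ^+ 2)).
  apply: (@le_trans _ _ ((`|L| + 1) * `|y| ^+ 2)).
    by rewrite ler_wpM2r ?sqr_ge0// (le_trans (ler_norm _))// lerDl.
  by rewrite ler_wpM2l ?(ltW L0)// lerXn2r ?nnegrE// mag_ge0.
rewrite expr2 mulrA ler_wpM2r ?mag_ge0//.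
by move: ze; rewrite ltr_pdivlMr// mulrC => /ltW.
Qed.

End PartiallyHolomorphic.

(** * The Levi foliation and the identity theorem *)

Section ConnectedInduction.
Variable T : topologicalType.

Lemma connected_locally_constant (X : set T) (Q : T -> Prop) x0 :
  connected X -> X x0 -> Q x0 ->
  (forall x, X x -> Q x -> \forall y \near x, X y -> Q y) ->
  (forall x, X x -> ~ Q x -> \forall y \near x, X y -> ~ Q y) ->
  forall x, X x -> Q x.
Proof.
move=> cX X0 Q0 oQ cQ x Xx.
suff XE : X `&` [set y | Q y] = X by move: Xx; rewrite -XE => -[].
apply: cX; first by exists x0.
- exists ([set y | X y -> Q y]°); first exact: open_interior.
  apply/seteqP; split => [y [Xy Qy]|y [Xy Qy]]; split => //.
    exact: oQ.
  exact: (interior_subset Qy).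
- exists (~` ([set y | X y -> ~ Q y]°)); first exact/open_closedC/open_interior.
  apply/seteqP; split => [y [Xy Qy]|y [Xy nQy]]; split => //.
    by move=> /interior_subset /(_ Xy).
  by apply: contrapT => nQ; apply: nQy; exact: cQ.
Qed.

End ConnectedInduction.

Section Slices.
Variable R : realType.
Local Notation C := R[i].
Variables d m : nat.
Local Notation N := (d + (m + m))%N.
Local Notation E := ('rV[R]_d * 'rV[C]_m)%type.
Implicit Types (phi psi : 'rV[R]_N -> C) (U X : set E) (p q : E).

Lemma segment_in_component (A : set E) (x : 'rV[R]_d) (xi v : 'rV[C]_m) :
  (forall t : R, 0 <= t <= 1 -> A (x, xi + t%:C *: v)) ->
  connected_component A (x, xi) (x, xi + v).
Proof.
move=> H; pose g (t : R) : E := (x, xi + t%:C *: v).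
have gc : continuous g.
  move=> t B /nbhs_prodP [r r0 Hr].
  have v1 : 0 < mag v + 1 by rewrite ltr_wpDl ?mag_ge0.
  apply/nbhs_ballP; exists (r / (mag v + 1)) => /=; first by rewrite divr_gt0.
  move=> s; rewrite -ball_normE /ball_ /= distrC ltr_pdivlMr// => st.
  apply: Hr => /=; first by rewrite subrr normr0 ltW.
  rewrite opprD addrACA subrr add0r -scalerBl -rmorphB magZ mag_real.
  apply: le_trans (ltW st); rewrite ler_wpM2l//; lra.
have : connected (g @` `[0, 1]).
  apply: connected_continuous_connected; first exact: segment_connected.
  exact: continuous_subspaceT.
have g0 : (x, xi) = g 0 by rewrite /g scale0r addr0.
have g1 : (x, xi + v) = g 1 by rewrite /g scale1r.
move=> cg; apply: (@connected_component_max _ A (g @` `[0, 1])) => //.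
- by exists 0; rewrite ?g0//= in_itv /= lexx ler01.
- by move=> _ [t + <-]; rewrite /= in_itv /= => /H.
- by exists 1; rewrite ?g1//= in_itv /= lexx ler01.
Qed.

Definition slice U (x : 'rV[R]_d) : set E := U `&` [set q | q.1 = x].

Lemma Levi_leaf_sub U p : Levi_leaf U p `<=` slice U p.1.
Proof. exact: connected_component_sub. Qed.

Lemma Levi_leaf_connected U p : connected (Levi_leaf U p).
Proof. exact: component_connected. Qed.

Lemma Levi_leaf_self U p : U p -> Levi_leaf U p p.
Proof. by move=> Up; apply: connected_component_refl. Qed.

Lemma Levi_leaf_eq U p q : Levi_leaf U p q -> Levi_leaf U p = Levi_leaf U q.
Proof.
move=> pq; have [_ qE] := Levi_leaf_sub pq.
by rewrite /Levi_leaf (same_connected_component pq) qE.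
Qed.

(** A segment between two points of a ball with the same [x] stays in the
    ball, and thus in the leaf. *)
Lemma Levi_leaf_ball U p : open U -> U p -> exists2 r : R, 0 < r &
  forall q q', `|q.1 - p.1| <= r -> q'.1 = q.1 -> mag (q.2 - p.2) <= r ->
    mag (q'.2 - p.2) <= r -> U q /\ Levi_leaf U q q'.
Proof.
move=> oU Up; have /nbhs_prodP [r r0 H] := open_nbhs_nbhs (conj oU Up).
exists r => // -[x xi] [x' xi'] /= xr -> xir xir'; split; first exact: H.
rewrite /Levi_leaf -[xi'](subrK xi) addrC; apply: segment_in_component => t /andP[t0 t1].
split => //=; apply: H => //=.
have -> : xi + t%:C *: (xi' - xi) - p.2 =
    (1 - t)%:C *: (xi - p.2) + t%:C *: (xi' - p.2).
  by apply/rowP => i; rewrite !mxE rmorphB /=; ring.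
apply: le_trans (magD _ _) _; rewrite !magZ !mag_real ger0_norm ?subr_ge0// ger0_norm//.
have : (1 - t) * mag (xi - p.2) <= (1 - t) * r by rewrite ler_wpM2l// subr_ge0.
have : t * mag (xi' - p.2) <= t * r by rewrite ler_wpM2l.
clear; lra.
Qed.

(** A flat point has a neighborhood in [X] on which [phi] and its derivatives
    in the directions of [P] vanish, so flatness is an open condition; it is a
    closed one because each derivative is continuous. *)
Lemma flat_connected (P : pred 'I_N) U X phi q0 : open U -> connected X -> X `<=` U ->
  (forall q, U q -> analytic_at phi (to_real q)) ->
  (forall q q', X q -> X q' -> supported P (to_real q' - to_real q)) ->
  X q0 -> flat_at P phi (to_real q0) ->
  forall q, X q -> flat_at P phi (to_real q).
Proof.
move=> oU cX XU an sup X0 f0.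
have nearU q : U q -> \forall x \near to_real q, analytic_at phi x.
  move=> Uq; have := open_nbhs_nbhs (conj oU Uq) => /near_to_realP.
  by apply: filterS => x /= /an; rewrite of_realK.
apply: (connected_locally_constant cX X0 f0) => q Xq.
  move=> fq; have [r r0 H] := flat_zero (an _ (XU _ Xq)) fq.
  apply/nbhs_to_realP; exists (r / 2); first by rewrite divr_gt0.
  move=> y yr Xq' l Pl; rewrite of_realK.
  apply: (@zero_flat _ _ P phi (to_real q) r _ l Pl); last 1 first.
  - by have := sup _ _ Xq Xq'; rewrite of_realK addrAC subrr add0r.
  - by move=> y' /ltW; exact: H.
  - lra.
move=> nf; have [l Pl Dn0] : exists2 l, all P l & Dl l phi (to_real q) != 0.
  by apply: contrapT => nl; apply: nf => l Pl; apply/eqP; apply: contraT => Dn; case: nl; exists l.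
have := analytic_continuous (analytic_Dl l (nearU _ (XU _ Xq))) (e := mag (Dl l phi (to_real q))).
rewrite mag_gt0 => /(_ Dn0) [r r0 H].
apply/nbhs_to_realP; exists r => // y /H; rewrite mag_distC => h Xq' /(_ l Pl).
by rewrite of_realK => D0; rewrite D0 subr0 ltxx in h.
Qed.

(** Flatness in all directions spreads over [U]. In [identity_leaf], it is
    flatness in the leaf directions that spreads along the leaf. *)
Lemma identity_open U phi q0 (r : R) : open U -> connected U ->
  (forall q, U q -> analytic_at phi (to_real q)) ->
  U q0 -> 0 < r -> (forall y, `|y| <= r -> phi (to_real q0 + y) = 0) ->
  forall q, U q -> phi (to_real q) = 0.
Proof.
move=> oU cU an U0 r0 z q Uq.
have := @flat_connected predT U U phi q0 oU cU (fun x h => h) an _ U0 _ q Uq.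
move=> H; apply: (H _ _ [::]) => // l Pl.
have := @zero_flat _ _ predT phi (to_real q0) r _ l Pl 0.
by rewrite normr0 addr0; apply => // y /ltW yr _; exact: z.
Qed.

Lemma identity_leaf U phi p q0 (r : R) : open U ->
  (forall q, U q -> analytic_at phi (to_real q)) ->
  Levi_leaf U p q0 -> 0 < r ->
  (forall q, q.1 = p.1 -> mag (q.2 - q0.2) <= r -> phi (to_real q) = 0) ->
  forall q, Levi_leaf U p q -> phi (to_real q) = 0.
Proof.
move=> oU an L0 r0 z q Lq.
have := @flat_connected (@leafdir d m) U (Levi_leaf U p) phi q0 oU (@Levi_leaf_connected U p)
   (fun x h => (Levi_leaf_sub h).1) an _ L0 _ q Lq.
move=> H; apply: (H _ _ [::]) => // [q1 q2 L1 L2|l Pl].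
  apply/supported_leaf; rewrite -[to_real q2 - _](_ : to_real (q2 - q1) = _).
    by rewrite to_realK /= (Levi_leaf_sub L1).2 (Levi_leaf_sub L2).2 subrr.
  by apply: (addIr (to_real q1)); rewrite -to_realD !subrK.
have := @zero_flat _ _ (@leafdir d m) phi (to_real q0) (r / 2) _ l Pl 0.
rewrite normr0 addr0; apply => [y yr sy| |]; first last.
- by move=> i _; rewrite mxE.
- by rewrite divr_gt0.
rewrite -[y]of_realK -to_realD; apply: z => /=.
  have -> : lsubmx y = 0 by exact: ((supported_leaf y).1 sy).
  by rewrite addr0; exact: (Levi_leaf_sub L0).2.
rewrite addrAC subrr add0r; apply: le_trans (mag_of_real2 _) _; lra.
Qed.

(** Otherwise [phi] would be flat along the leaf at [q'], hence 0 on the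
    leaf. *)
Lemma leaf_flat_nonzero U phi p q : open U ->
  (forall q, U q -> analytic_at phi (to_real q)) ->
  Levi_leaf U p q -> phi (to_real q) <> 0 ->
  forall q', Levi_leaf U p q' -> exists2 l, all (@leafdir d m) l & Dl l phi (to_real q') != 0.
Proof.
move=> oU an Lq nz q' Lq'; apply: contrapT => nl; apply: nz.
have := @flat_connected (@leafdir d m) U (Levi_leaf U p) phi q' oU (@Levi_leaf_connected U p)
   (fun x h => (Levi_leaf_sub h).1) an _ Lq' _ q Lq.
move=> H; apply: (H _ _ [::]) => // [q1 q2 L1 L2|l Pl].
  apply/supported_leaf; rewrite -[to_real q2 - _](_ : to_real (q2 - q1) = _).
    by rewrite to_realK /= (Levi_leaf_sub L1).2 (Levi_leaf_sub L2).2 subrr.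
  by apply: (addIr (to_real q1)); rewrite -to_realD !subrK.
by apply/eqP; apply: contraT => Dn; case: nl; exists l.
Qed.

End Slices.

(** * Tangent spaces and the CR singular set *)

Section RowSpaceDimension.
Variable R : realType.
Local Notation C := R[i].

Lemma cdim_row_space k n (A : 'M[C]_(k, n)) (V : set 'rV[C]_n) :
  (forall c, V c <-> (c <= A)%MS) -> cdim V = \rank A.
Proof.
move=> HV; apply/eqP; rewrite eqn_leq; apply/andP; split.
  apply/bigmax_leqP => r /asboolP [B [Bf HB]].
  rewrite -(eqP Bf); apply: mxrankS; apply/row_subP => i.
  by apply/HV.
have lt : (\rank A < n.+1)%N by rewrite ltnS rank_leq_col.
apply: (@leq_bigmax_cond _ _ (fun r : 'I_n.+1 => nat_of_ord r) (Ordinal lt)).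
apply/asboolP; exists (row_base A); split; first exact: row_base_free.
by move=> i; apply/HV; rewrite (submx_trans (row_sub _ _))// eq_row_base.
Qed.

Lemma mag_complexify n (x : 'rV[R]_(n + n)) : mag (complexify x) <= 2 * `|x|.
Proof.
apply: mag_mx_le => [|i j]; first by rewrite mulr_ge0.
rewrite mxE; apply: le_trans (mag_le_ReIm _) _ => /=.
by rewrite mulr_natl mulr2n; apply: lerD; rewrite !mxE; exact: rV_entry.
Qed.

Lemma norm_realify n (z : 'rV[C]_n) : `|realify z| <= mag z.
Proof.
apply: rV_norm_le => [|i]; first exact: mag_ge0.
rewrite /realify mxE; case: splitP => k _; rewrite mxE; apply: le_trans (mag_entry z 0 k).
  exact: le_Re_mag.
exact: le_Im_mag.
Qed.

Lemma realifyD n (x z : 'rV[C]_n) : realify (x + z) = realify x + realify z.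
Proof. by rewrite /realify map_mxReD map_mxImD add_row_mx. Qed.

Lemma realifyB n (x z : 'rV[C]_n) : realify (x - z) = realify x - realify z.
Proof. by apply: (addIr (realify z)); rewrite -realifyD !subrK. Qed.

Lemma complexifyD n (x z : 'rV[R]_(n + n)) : complexify (x + z) = complexify x + complexify z.
Proof. by rewrite -[RHS]realifyK realifyD !complexifyK. Qed.

Lemma complexifyB n (x z : 'rV[R]_(n + n)) : complexify (x - z) = complexify x - complexify z.
Proof. by apply: (addIr (complexify z)); rewrite -complexifyD !subrK. Qed.

End RowSpaceDimension.

Section DrealParts.
Variable R : realType.
Variable N : nat.
Lemma Re_Dreal (phi : 'rV[R]_N -> R[i]) v a :
  complex.Re (Dreal phi v a) = 'D_v (fun x => complex.Re (phi x)) a.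
Proof. by []. Qed.
Lemma Im_Dreal (phi : 'rV[R]_N -> R[i]) v a :
  complex.Im (Dreal phi v a) = 'D_v (fun x => complex.Im (phi x)) a.
Proof. by []. Qed.
End DrealParts.

Lemma scale_combination (K : comPzRingType) n (s t : K) (x1 x2 x3 x4 : 'rV[K]_n) :
  s *: (x1 + x2) + t *: (s *: (x3 + x4)) = s *: (x1 + t *: x3 + (x2 + t *: x4)).
Proof. by apply/rowP => j; rewrite !mxE; ring. Qed.

Lemma scale_combinationB (K : comPzRingType) n (s t : K) (x1 x2 x3 x4 : 'rV[K]_n) :
  s *: (x1 - x2) + t *: (s *: (x3 - x4)) = s *: (x1 + t *: x3 - (x2 + t *: x4)).
Proof. by apply/rowP => j; rewrite !mxE; ring. Qed.

Lemma diff_line (R : realType) (V : normedModType R) (a w : V) :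
  'd (fun t : R => a + t *: w) 0 1 = w.
Proof.
have di : differentiable (@id R) 0 by exact: dfun_id.
have dw : differentiable (fun t : R => t *: w) 0 by exact: (@differentiableZl _ _ _ id w).
rewrite (@diffD _ _ _ (cst a) (fun t : R => t *: w))//.
have -> : 'd (cst a) 0 = 0 :> (R -> V) by exact: diff_cst.
have -> : (0 : R -> V) \+ 'd (fun t : R => t *: w) 0 = 'd (fun t : R => t *: w) 0 :> (R -> V).
  by apply/funext => t /=; rewrite add0r.
rewrite (@diffZl _ _ _ id w)//.
have := @diff_lin _ _ _ (@idfun R) 0.
by move=> H; rewrite [X in X 1]H ?scale1r// => x; exact: cvg_id.
Qed.

Definition real_domain (R : realType) d m (U : set ('rV[R]_d * 'rV[R[i]]_m)) :
  set 'rV[R]_(d + (m + m)) := @of_real R d m @^-1` U.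

Definition coordinate_map (R : realType) d m n (f : 'rV[R]_d * 'rV[R[i]]_m -> 'rV[R[i]]_n) :
  'rV[R]_(d + (m + m)) -> 'rV[R]_(n + n) := @realify R n \o f \o @of_real R d m.

Section CRSingularities.
Variable R : realType.
Local Notation C := R[i].
Variables d m : nat.
Local Notation n := (d + m)%N.
Local Notation N := (d + (m + m))%N.
Local Notation E := ('rV[R]_d * 'rV[C]_m)%type.
Variables (U : set E) (f : E -> 'rV[C]_n).
Hypotheses (U_open : open U) (f_analytic : real_analytic_map U f) (f_CR : CR_map U f)
  (f_diffeo : mixed_diffeo_onto_image U f).

Local Notation F := (coordinate_map f).
Local Notation O := (real_domain U).

Definition fcoord (j : 'I_n) (y : 'rV[R]_N) : C := f (of_real y) 0 j.

Lemma holo_fcoord j : holo_on O (fcoord j).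
Proof.
move=> a Oa; split; first by have := f_analytic j Oa; rewrite of_realK.
move=> k; have := f_CR Oa j k; rewrite /dbar of_realK => /eqP.
rewrite mulf_eq0 invr_eq0 pnatr_eq0 /= -/(fcoord j) => /eqP H.
apply: (mulfI (_ : 'i%C != 0 :> C)); first by rewrite complexiE neq0Ci.
rewrite mulrA -expr2 sqr_i mulN1r; apply/eqP; rewrite -subr_eq0 opprK addrC.
by rewrite complexiE; apply/eqP.
Qed.

Lemma F_diff a : O a -> differentiable F a.
Proof. by case: f_diffeo => /(_ 1%N) [H _] _ _; exact: H. Qed.

Definition full_jacobian a : 'M[C]_(N, n) :=
  \matrix_(i, j) Dreal (fcoord j) (delta_mx 0 i) a.
Local Notation JC := full_jacobian.

(** The coordinates of [f] have complex derivatives along the real directions;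
    the differential of the realified map collects their real and imaginary
    parts. *)
Lemma dF_JC a v : O a ->
  'd F a v = realify (map_mx (real_complex R) v *m JC a).
Proof.
move=> Oa; have dF := F_diff Oa.
have col i k : ('d F a (delta_mx 0 i)) 0 k = 'D_(delta_mx 0 i) (fun y => F y 0 k) a.
  by rewrite -deriveE// derive_mx ?mxE//; exact: diff_derivable.
have lin k : ('d F a v) 0 k = \sum_i v 0 i * 'D_(delta_mx 0 i) (fun y => F y 0 k) a.
  rewrite {1}[v]row_sum_delta linear_sum summxE; apply: eq_bigr => i _.
  by rewrite linearZ mxE col.
have toR (x : R) (z : C) : complex.Re (x%:C * z) = x * complex.Re z /\
    complex.Im (x%:C * z) = x * complex.Im z.
  by case: z => p q /=; rewrite !mul0r subr0 addr0.
have Fl i j : 'D_(delta_mx 0 i) (fun y => F y 0 (lshift n j)) a = complex.Re (JC a i j).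
  rewrite mxE Re_Dreal; suff -> : (fun y => F y 0 (lshift n j)) = (fun y => complex.Re (fcoord j y)) by [].
  by apply/funext => y; rewrite /coordinate_map /= /realify row_mxEl mxE.
have Fr i j : 'D_(delta_mx 0 i) (fun y => F y 0 (rshift n j)) a = complex.Im (JC a i j).
  rewrite mxE Im_Dreal; suff -> : (fun y => F y 0 (rshift n j)) = (fun y => complex.Im (fcoord j y)) by [].
  by apply/funext => y; rewrite /coordinate_map /= /realify row_mxEr mxE.
apply/rowP => k; rewrite lin /realify; case: (split_ordP k) => j ->.
  rewrite row_mxEl mxE [X in complex.Re X]mxE raddf_sum; apply: eq_bigr => i _.
  by rewrite Fl [map_mx _ _ 0 i]mxE; apply: esym; exact: (toR _ _).1.
rewrite row_mxEr mxE [X in complex.Im X]mxE raddf_sum; apply: eq_bigr => i _.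
by rewrite Fr [map_mx _ _ 0 i]mxE; apply: esym; exact: (toR _ _).2.
Qed.

Lemma local_inverse a : O a -> exists (W : set 'rV[R]_(n + n)) (g : 'rV[R]_(n + n) -> 'rV[R]_N),
  [/\ open W, W (F a), forall x, W x -> differentiable g x &
    forall x, O x -> W (F x) -> g (F x) = x].
Proof.
move=> Oa; case: f_diffeo => _ _ /(_ a Oa) [W [g [oW Wa sg gF]]].
by exists W, g; split => //; have [] := sg 1%N.
Qed.

Lemma O_open : open O. Proof. exact: open_to_real. Qed.

(** The differential of a local inverse is a left inverse of the
    differential. *)
Lemma dF_inj a v : O a -> 'd F a v = 0 -> v = 0.
Proof.
move=> Oa v0; have dF := F_diff Oa.
have [W [g [oW Wa dg gF]]] := local_inverse Oa.
have near_id : \forall x \near a, (g \o F) x = x.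
  have : \forall x \near a, W (F x).
    by apply: (differentiable_continuous dF); exact: open_nbhs_nbhs.
  have : \forall x \near a, O x by apply: open_nbhs_nbhs; split => //; exact: O_open.
  by apply: filterS2 => x Ox WFx; exact: gF.
have := diff_comp dF (dg _ Wa) => /(congr1 (fun L => L v)) /=.
rewrite v0 linear0 => <-.
rewrite -deriveE; last exact: differentiable_comp dF (dg _ Wa).
by rewrite (near_eq_derive v near_id) derive_id.
Qed.

Local Notation M := (f @` U).

(** A curve in [M] is lifted to a curve of parameters by a smooth local
    inverse; conversely the images of segments realize all the vectors of the
    image of the differential. *)
Lemma tangentP p v : U p ->
  tangent_space M (f p) v <-> exists w, v = 'd F (to_real p) w.
Proof.
move=> Up; set a := to_real p.
have Oa : O a by rewrite /real_domain /= to_realK.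
have dF := F_diff Oa.
have Fa : F a = realify (f p) by rewrite /coordinate_map /= to_realK.
split.
  case=> gam [g0 gM dgam].
  have [W [g [oW Wa dg gF]]] := local_inverse Oa.
  have dif : differentiable gam 0 by apply/derivable1_diffP; case: dgam.
  have Wn : \forall t \near (0 : R), W (gam t).
    by apply: (differentiable_continuous dif); rewrite g0 -Fa; exact: open_nbhs_nbhs.
  have E : \forall t \near (0 : R), gam t = (F \o (g \o gam)) t.
    apply: filterS2 gM Wn => t [p' Up' E] Wt.
    have Ft : gam t = F (to_real p') by rewrite /coordinate_map /= to_realK E complexifyK.
    by rewrite /= Ft gF ?/real_domain /= ?to_realK//; rewrite Ft in Wt.
  have dgam' : differentiable (g \o gam) 0.
    apply: differentiable_comp; first exact: dif.
    by apply: dg; exact: (nbhs_singleton Wn).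
  have g0a : (g \o gam) 0 = a by rewrite /= g0 -Fa gF.
  exists ('d (g \o gam) 0 (1 : R)).
  have <- := @derive_val _ _ _ _ _ _ _ dgam; rewrite (near_eq_derive (1 : R) E).
  have dFg : differentiable F ((g \o gam) 0) by rewrite g0a.
  rewrite deriveE; last exact: differentiable_comp dgam' dFg.
  by rewrite (diff_comp dgam' dFg) -[(_ \o _) 1]/('d F ((g \o gam) 0) ('d (g \o gam) 0 1)) g0a.
case=> w ->; exists (fun t => F (a + t *: w)); split.
- by rewrite scale0r addr0 Fa.
- have : \forall x \near a, O x by apply: open_nbhs_nbhs; split => //; exact: O_open.
  have c : {for (0 : R), continuous (fun t : R => a + t *: w)}.
    apply: differentiable_continuous; apply: dfunD; first exact: dfun_cst.
    by apply: (@dfunZl _ _ _ id); exact: dfun_id.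
  move=> On; have cO : \forall t \near (0 : R), O (a + t *: w).
    by apply: c; rewrite scale0r addr0.
  apply: filterS cO => t Ot; exists (of_real (a + t *: w)); first exact: Ot.
  by rewrite /coordinate_map /= realifyK.
- have dl : differentiable (fun t : R => a + t *: w) 0.
    by apply: dfunD; [exact: dfun_cst|apply: (@dfunZl _ _ _ id); exact: dfun_id].
  have dF' : differentiable F (a + 0 *: w) by rewrite scale0r addr0.
  have dFl : differentiable (F \o (fun t : R => a + t *: w)) 0 by exact: differentiable_comp.
  split; first by apply: diff_derivable.
  rewrite deriveE// diff_comp//= scale0r addr0; congr ('d F a _).
  exact: diff_line.
Qed.

Local Notation conjM := (map_mx (@conjc R)).

(** The decomposition of a real vector into its parts of type (1,0) and
    (0,1). *)
Lemma map_realify (z : 'rV[C]_n) : map_mx (real_complex R) (realify z) =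
  row_mx (2^-1 *: (z + conjM z)) ((2^-1 * - 'i) *: (z - conjM z)).
Proof.
rewrite /realify map_row_mx; congr row_mx; apply/rowP => j; rewrite !mxE; case: (z 0 j) => x y /=.
  rewrite -[x +i* y]/(x +i* y)%C; apply/eqP; rewrite eq_complex /=; apply/andP; split; apply/eqP.
    by field.
  by field.
by apply/eqP; rewrite eq_complex /=; apply/andP; split; apply/eqP; field.
Qed.

Lemma conj_real k (x : 'rV[R]_k) : conjM (map_mx (real_complex R) x) = map_mx (real_complex R) x.
Proof. by apply/rowP => j; rewrite !mxE conjc_real. Qed.

(** A vector with coordinates [W1] and [W2] has (1,0) part [W1 + 'i W2 = z1]
    and (0,1) part [W1 - 'i W2 = z2]; it is antiholomorphic when the first one
    vanishes. *)
Lemma antiholomorphic_vectorP (c z1 z2 : 'rV[C]_n) :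
  antiholomorphic_vector c = row_mx (2^-1 *: (z1 + z2)) ((2^-1 * - 'i) *: (z1 - z2)) <->
  z1 = 0 /\ c = z2.
Proof.
split; last first.
  case=> -> ->; rewrite add0r sub0r /antiholomorphic_vector; congr row_mx.
  by rewrite scalerN -scaleNr mulrN opprK.
case/eq_row_mx => e1 e2; suff H j : z1 0 j = 0 /\ c 0 j = z2 0 j.
  by split; apply/rowP => j; [rewrite mxE|]; case: (H j).
move/rowP/(_ j): e1; move/rowP/(_ j): e2; rewrite !mxE.
move: (c 0 j) (z1 0 j) (z2 0 j) => {}c x y; rewrite -!mulrA => e2 e1.
have /mulfI h2 : 2^-1 != 0 :> C by rewrite invr_eq0 pnatr_eq0.
move: e2 => /h2 e2; move: e1 => /h2 e1.
have i2 : 'i * 'i = -1 :> C by rewrite -expr2 sqrCi.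
have : 'i * ('i * c) = 'i * (- 'i * (x - y)) by rewrite e2.
rewrite mulrA mulrA mulrN i2 opprK e1 mul1r mulN1r => e.
have x0 : x = 0.
  apply: (mulfI (_ : (2 : C) != 0)); first by rewrite pnatr_eq0.
  have -> : 2 * x = (x + y) + (x - y) by ring.
  by rewrite -e addrN mulr0.
by move: e1; rewrite x0 add0r.
Qed.

Lemma Re_conjM k (w : 'rV[C]_k) :
  map_mx (real_complex R) (map_mx (@complex.Re R) w) = 2^-1 *: (w + conjM w).
Proof.
apply/rowP => j; rewrite !mxE; case: (w 0 j) => x y.
by apply/eqP; rewrite eq_complex /=; apply/andP; split; apply/eqP; field.
Qed.

Lemma Im_conjM k (w : 'rV[C]_k) :
  map_mx (real_complex R) (map_mx (@complex.Im R) w) = (2^-1 * - 'i) *: (w - conjM w).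
Proof.
apply/rowP => j; rewrite !mxE; case: (w 0 j) => x y.
by apply/eqP; rewrite eq_complex /=; apply/andP; split; apply/eqP; field.
Qed.

Lemma Re_Im_decomposition k (w : 'rV[C]_k) : w =
  map_mx (real_complex R) (map_mx (@complex.Re R) w) +
  'i *: map_mx (real_complex R) (map_mx (@complex.Im R) w).
Proof. by apply/rowP => j; rewrite !mxE -complexiE; exact: complexE. Qed.

Lemma realify0 k : realify (0 : 'rV[C]_k) = 0.
Proof. by apply/rowP => j; rewrite mxE; case: splitP => i _; rewrite !mxE. Qed.

(** The complexified differential sends [w] to the vector with (1,0) part
    [w *m J] and (0,1) part [w *m conj J]. *)
Lemma T01P p c : U p -> let a := to_real p in
  T01 M (f p) c <-> exists2 w, w *m JC a = 0 & c = w *m conjM (JC a).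
Proof.
move=> Up a; have Oa : O a by rewrite /real_domain /= to_realK.
have key u v : let w := map_mx (real_complex R) u + 'i *: map_mx (real_complex R) v in
   map_mx (real_complex R) ('d F a u) + 'i *: map_mx (real_complex R) ('d F a v) =
   row_mx (2^-1 *: (w *m JC a + w *m conjM (JC a)))
          ((2^-1 * - 'i) *: (w *m JC a - w *m conjM (JC a))).
  move=> w; rewrite !dF_JC// !map_realify !map_mxM !conj_real scale_row_mx add_row_mx.
  rewrite /w !mulmxDl -!scalemxAl.
  congr row_mx; [exact: scale_combination|exact: scale_combinationB].
split.
  case=> u [v [/(tangentP _ Up) [u' ->] /(tangentP _ Up) [v' ->]]]; rewrite key.
  by move/antiholomorphic_vectorP => [h1 h2]; eexists; [exact: h1|].
case=> w w0 ->; exists ('d F a (map_mx (@complex.Re R) w)), ('d F a (map_mx (@complex.Im R) w)).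
split; [by apply/tangentP => //; eexists|by apply/tangentP => //; eexists|].
by rewrite key -Re_Im_decomposition; apply/antiholomorphic_vectorP.
Qed.

(** The map [w |-> w *m conj J] is injective on the kernel of [J]: if both
    products vanish, the real differential kills the real and imaginary parts
    of [w]. *)
Lemma dim_T01E p : U p -> dim_T01 M (f p) = (N - \rank (JC (to_real p)))%N.
Proof.
move=> Up; set A := JC (to_real p).
have Oa : O (to_real p) by rewrite /real_domain /= to_realK.
rewrite /dim_T01 (@cdim_row_space _ _ _ (kermx A *m conjM A)).
  rewrite -mxrank_ker -(mxrank_mul_ker (kermx A) (conjM A)) -[LHS]addn0; congr addn.
  apply/esym/eqP; rewrite mxrank_eq0; apply/eqP/row_matrixP => i; rewrite row0.
  set w := row i _.
  have : (w <= kermx A :&: kermx (conjM A))%MS by exact: row_sub.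
  rewrite sub_capmx => /andP[/sub_kermxP w1 /sub_kermxP w2].
  have conjK k l : involutive (map_mx (@conjc R) : 'M[C]_(k, l) -> 'M[C]_(k, l)).
    by move=> B; apply/matrixP => x y; rewrite !mxE conjcK.
  have w3 : conjM w *m A = 0 by rewrite -[A]conjK -map_mxM w2 map_mx0.
  have re0 : map_mx (@complex.Re R) w = 0.
    apply: (dF_inj Oa); rewrite dF_JC// Re_conjM.
    by rewrite -scalemxAl mulmxDl w1 w3 addr0 scaler0 realify0.
  have im0 : map_mx (@complex.Im R) w = 0.
    apply: (dF_inj Oa); rewrite dF_JC// Im_conjM.
    by rewrite -scalemxAl mulmxBl w1 w3 subr0 scaler0 realify0.
  by rewrite [LHS]Re_Im_decomposition re0 im0 !map_mx0 scaler0 addr0.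
move=> c; rewrite (T01P _ Up) -/A; split.
  by case=> w /sub_kermxP/submxP[D ->] ->; rewrite -mulmxA submxMl.
case/submxP => D ->; exists (D *m kermx A); last by rewrite mulmxA.
by rewrite -mulmxA mulmx_ker mulmx0.
Qed.

(** The derivatives along [v] are multiples of those along [u], so the
    coordinates [x] and [u] give a square matrix with the same rank. *)
Definition x_or_u (i : 'I_n) : 'I_N :=
  match fintype.split i with inl j => lshift (m + m) j | inr k => ux d k end.

Definition complex_jacobian a : 'M[C]_n := \matrix_(i, j) Dreal (fcoord j) (delta_mx 0 (x_or_u i)) a.

Definition degeneracy a : C := \det (complex_jacobian a).

Lemma holo_degeneracy : holo_on O degeneracy.
Proof.
apply: (holo_det (F := fun i j => Dreal (fcoord j) (delta_mx 0 (x_or_u i)))) => i j.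
by apply: holo_Dreal; [exact: O_open|exact: holo_fcoord].
Qed.

Lemma rank_full_jacobian a : O a -> \rank (JC a) = \rank (complex_jacobian a).
Proof.
move=> Oa.
have uxE k : x_or_u (rshift d k) = ux d k.
  by rewrite /x_or_u -[rshift d k]/(unsplit (inr k)) unsplitK.
have lxE k : x_or_u (lshift m k) = lshift (m + m) k.
  by rewrite /x_or_u -[lshift m k]/(unsplit (inl k)) unsplitK.
apply/eqP; rewrite eqn_leq; apply/andP; split; apply: mxrankS; apply/row_subP => i.
  case: (split_ordP i) => j ->.
    have -> : row (lshift (m + m) j) (JC a) = row (lshift m j) (complex_jacobian a).
      by apply/rowP => l; rewrite !mxE lxE.
    exact: row_sub.
  case: (split_ordP j) => k ->.
    have -> : row (rshift d (lshift m k)) (JC a) = row (rshift d k) (complex_jacobian a).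
      by apply/rowP => l; rewrite !mxE uxE.
    exact: row_sub.
  have -> : row (rshift d (rshift m k)) (JC a) = 'i%C *: row (rshift d k) (complex_jacobian a).
    by apply/rowP => l; rewrite !mxE uxE; exact: (holo_fcoord l Oa).2.
  by apply: scalemx_sub; exact: row_sub.
have -> : row i (complex_jacobian a) = row (x_or_u i) (JC a) by apply/rowP => l; rewrite !mxE.
exact: row_sub.
Qed.

Lemma dim_T01_generic p : U p -> (dim_T01 M (f p) == m) = (degeneracy (to_real p) != 0).
Proof.
move=> Up; have Oa : O (to_real p) by rewrite /real_domain /= to_realK.
rewrite dim_T01E// rank_full_jacobian// /degeneracy -unitfE -unitmxE -row_free_unit /row_free.
have := rank_leq_row (complex_jacobian (to_real p)).
by set r := \rank _; move=> rn; apply/eqP/eqP; lia.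
Qed.

Lemma f_continuous p (B : set 'rV[C]_n) : U p -> nbhs (f p) B ->
  \forall q \near p, U q /\ B (f q).
Proof.
move=> Up /nbhs_magP [e e0 HB]; have Oa : O (to_real p) by rewrite /real_domain /= to_realK.
have : \forall y \near to_real p, `|F y - F (to_real p)| < e / 2.
  have := differentiable_continuous (F_diff Oa).
  move=> /cvgr_dist_lt/(_ (e / 2)) H; have {}H := H (divr_gt0 e0 (ltr0Sn _ 1)).
  by apply: filterS H => y; rewrite distrC.
have := open_nbhs_nbhs (conj U_open Up).
move=> Un H; have {}H : \forall q \near p, `|F (to_real q) - F (to_real p)| < e / 2.
  by apply/near_to_realP; apply: filterS H => y /=; rewrite of_realK.
apply: filterS2 Un H => q Uq H; split => //; apply: HB.
rewrite -[f q]realifyK -[f p]realifyK -complexifyB; apply: le_lt_trans (mag_complexify _) _.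
by move: H; rewrite /coordinate_map /= !to_realK => H; rewrite mulrC -ltr_pdivlMr.
Qed.

(** The local inverse is continuous, and therefore points of [M] near [f p]
    have parameters near [p]. *)
Lemma f_embedding p (B : set E) : U p -> nbhs p B ->
  exists V, [/\ open V, V (f p) & forall q, U q -> V (f q) -> B q].
Proof.
move=> Up /near_to_realP nB; have Oa : O (to_real p) by rewrite /real_domain /= to_realK.
have [W [g [oW Wa dg gF]]] := local_inverse Oa.
have Fq q : F (to_real q) = realify (f q) by rewrite /coordinate_map /= to_realK.
have : \forall y \near F (to_real p), W y /\ (@of_real R d m @^-1` B) (g y).
  have h1 := open_nbhs_nbhs (conj oW Wa).
  have h2 : \forall y \near F (to_real p), (@of_real R d m @^-1` B) (g y).
    by apply: (differentiable_continuous (dg _ Wa)); rewrite gF.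
  exact: filterI.
rewrite Fq => /nbhs_rVP [e e0 He].
exists [set z | mag (z - f p) < e]; split.
- exact: open_mag_ball.
- by rewrite /= subrr mag0.
move=> q Uq /= H.
have Oq : O (to_real q) by rewrite /real_domain /= to_realK.
have := He (realify (f q) - realify (f p)); rewrite -realifyB => /(_ (le_trans (norm_realify _) (ltW H))).
by rewrite realifyB addrC subrK -Fq => -[Wq]; rewrite gF//= to_realK.
Qed.

(** Where the determinant is nonzero, the dimension is [m] nearby. Where it is
    0, the dimension differs from [m], but takes the value [m] at points
    arbitrarily close, since by the identity theorem the determinant vanishes
    on no open set. *)
Lemma CR_singularE p : connected U -> (exists q, generic_at d M q) -> U p ->
  CR_singular_set M (f p) <-> degeneracy (to_real p) = 0.
Proof.
move=> cU [q0 [[p0 Up0 <-] gen]] Up.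
have near_dim q k : U q -> (\forall x \near q, U x -> dim_T01 M (f x) = k) ->
    \forall z \near within M (nbhs (f q)), dim_T01 M z = k.
  move=> Uq H; have [V [oV Vq HV]] := f_embedding Uq H.
  apply: filterS (open_nbhs_nbhs (conj oV Vq)) => z Vz [x Ux E]; rewrite -E; apply: (HV x) => //.
  by rewrite E.
have an q : U q -> analytic_at degeneracy (to_real q).
  by move=> Uq; apply: (holo_degeneracy _).1; rewrite /real_domain /= to_realK.
have nz : (\forall q \near p, degeneracy (to_real q) = 0) -> False.
  move=> /nbhs_to_realP [r r0 H].
  have := identity_open U_open cU an Up r0 _ Up0.
  have := dim_T01_generic Up0; rewrite (nbhs_singleton gen) ?addKn ?eqxx; last by exists p0.
  move=> /esym/eqP h0 /(_ _)/h0 []// y yr.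
  by have := H y yr; rewrite of_realK.
have Mp : M (f p) by exists p.
split=> [[_ nc]|h0]; last first.
  split=> // /(_ [set dim_T01 M (f p)]); rewrite nbhs_principalE => /(_ _) H.
  have {}H : \forall z \near f p, M z -> dim_T01 M z = dim_T01 M (f p) by exact: H.
  apply: nz; apply: filterS (f_continuous Up H) => q [Uq Hq].
  have := dim_T01_generic Up; have := dim_T01_generic Uq; rewrite Hq; last by exists q.
  by move=> ->; rewrite h0 eqxx => /negbT; rewrite negbK => /eqP.
apply: contrapT => h0; apply: nc.
have near_m : \forall q \near p, U q -> dim_T01 M (f q) = m.
  have h1 : 0 < mag (degeneracy (to_real p)) by rewrite mag_gt0; apply/eqP.
  have [dl dl0 Hd] := analytic_continuous (an _ Up) h1.
  apply/nbhs_to_realP; exists dl => // y /Hd Hy Uy.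
  apply/eqP; rewrite dim_T01_generic// of_realK; apply: contraTneq Hy => ->.
  by rewrite sub0r magN ltxx.
have -> : dim_T01 M (f p) = m by exact: (nbhs_singleton near_m).
move=> A nA; have Am : A m := nbhs_singleton nA.
have H : \forall z \near f p, M z -> dim_T01 M z = m := near_dim _ _ Up near_m.
change (\forall z \near f p, M z -> A (dim_T01 M z)).
by apply: filterS H => z zm /zm ->.
Qed.

End CRSingularities.

(** * Holomorphic maps and submanifolds *)

Section DifferentialRules.
Variables (K : numFieldType) (V W X : normedModType K).

Lemma diff_chain (g : V -> W) (h : W -> X) z v :
  differentiable g z -> differentiable h (g z) ->
  'd (fun x => h (g x)) z v = 'd h (g z) ('d g z v).
Proof. by move=> dg dh; rewrite -[fun x => _]/(h \o g) diff_comp. Qed.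

Lemma diff_germ (g h : V -> W) z v :
  differentiable g z -> differentiable h z -> (\forall x \near z, g x = h x) ->
  'd g z v = 'd h z v.
Proof.
move=> dg dh gh; rewrite -(deriveE v dg) -(deriveE v dh); exact: near_eq_derive.
Qed.

Lemma diff_add (g h : V -> W) z v : differentiable g z -> differentiable h z ->
  'd (fun x => g x + h x) z v = 'd g z v + 'd h z v.
Proof. by move=> dg dh; rewrite -[fun x => _]/(g \+ h) diffD. Qed.

Lemma diff_const (w : W) (z v : V) : 'd (fun _ : V => w) z v = 0.
Proof. by rewrite -[fun _ => _]/(cst w) diff_cst. Qed.

End DifferentialRules.

Section DerivedRules.
Variables (K : numFieldType) (V W : normedModType K).

Lemma diff_bigsum I (r : seq I) (F : I -> V -> W) z v :
  (forall i, differentiable (F i) z) ->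
  'd (fun x => \sum_(i <- r) F i x) z v = \sum_(i <- r) 'd (F i) z v.
Proof.
move=> dF; elim: r => [|i r IH].
  under eq_fun do rewrite big_nil.
  by rewrite big_nil -[fun x => _]/(cst 0) diff_cst.
under eq_fun do rewrite big_cons.
rewrite big_cons -IH; apply: diff_add; first exact: dF.
by apply: dfun_sum => j _; exact: dF.
Qed.

Lemma diff_scale (k : V -> K) (w : W) z v : differentiable k z ->
  'd (fun x => k x *: w) z v = 'd k z v *: w.
Proof. by move=> dk; rewrite diffZl. Qed.

(** The chain rule for a left inverse that is only known near the point. *)
Lemma diff_left_inverse (g : V -> W) (h : W -> V) z v :
  differentiable g z -> differentiable h (g z) -> (\forall x \near z, h (g x) = x) ->
  'd h (g z) ('d g z v) = v.
Proof.
move=> dg dh hg; rewrite -(diff_chain v dg dh).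
apply: etrans (diff_germ v (dfun_comp dg dh) (dfun_id z) hg) _.
by rewrite diff_val.
Qed.

End DerivedRules.

Section HolomorphicMaps.
Variable R : realType.
Local Notation C := R[i].

Lemma linear_diff k l (g : {linear 'rV[C]_k -> 'rV[C]_l}) z :
  differentiable g z /\ 'd g z = g :> ('rV[C]_k -> 'rV[C]_l).
Proof.
apply: (@cdiff_differentiable _ _ _ g z g (k%:R * mag (lin1_mx g))) => [h|e e0].
  by rewrite -{1}(mul_rV_lin1 g) mulrC; exact: mag_mulmx.
exists 1 => // h _; have -> : g (z + h) = g z + g h by rewrite linearD.
by rewrite addrAC addrK subrr mag0 mulr_ge0 ?mag_ge0// ltW.
Qed.

Lemma diff_mulmx k l (A : 'M[C]_(k, l)) z : differentiable (fun x : 'rV[C]_k => x *m A) z /\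
  forall v, 'd (fun x : 'rV[C]_k => x *m A) z v = v *m A.
Proof.
have [h1 h2] := linear_diff (mulmxr A : {linear 'rV[C]_k -> 'rV[C]_l}) z.
by split=> // v; rewrite -[RHS]/(mulmxr A v) -h2.
Qed.

Lemma row_mx_E k l (x : 'rV[C]_k) (y : 'rV[C]_l) :
  row_mx x y = x *m row_mx 1%:M 0 + y *m row_mx 0 1%:M.
Proof. by rewrite !mul_mx_row !mulmx1 !mulmx0 add_row_mx addr0 add0r. Qed.

Lemma diff_row_mx a k l (g : 'rV[C]_a -> 'rV[C]_k) (h : 'rV[C]_a -> 'rV[C]_l) z :
  differentiable g z -> differentiable h z ->
  differentiable (fun x => row_mx (g x) (h x)) z /\
  forall v, 'd (fun x => row_mx (g x) (h x)) z v = row_mx ('d g z v) ('d h z v).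
Proof.
move=> dg dh.
have -> : (fun x => row_mx (g x) (h x)) =
    fun x => g x *m row_mx 1%:M 0 + h x *m row_mx 0 1%:M.
  by apply/funext => x; exact: row_mx_E.
pose A : 'M[C]_(k, k + l) := row_mx 1%:M 0; pose B : 'M[C]_(l, k + l) := row_mx 0 1%:M.
have dA := diff_mulmx A (g z); have dB := diff_mulmx B (h z).
have d1 : differentiable (fun x => g x *m A) z := dfun_comp dg dA.1.
have d2 : differentiable (fun x => h x *m B) z := dfun_comp dh dB.1.
split; first exact: dfunD.
move=> v; apply: etrans (diff_add v d1 d2) _; rewrite [RHS]row_mx_E; congr (_ + _).
  exact: etrans (diff_chain v dg dA.1) (dA.2 _).
exact: etrans (diff_chain v dh dB.1) (dB.2 _).
Qed.

Lemma diff_lsubmx a k l (g : 'rV[C]_a -> 'rV[C]_(k + l)) z : differentiable g z ->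
  differentiable (fun x => lsubmx (g x)) z /\
  forall v, 'd (fun x => lsubmx (g x)) z v = lsubmx ('d g z v).
Proof.
move=> dg; have [h1 h2] := linear_diff (@lsubmx C 1 k l : {linear 'rV[C]_(k + l) -> 'rV[C]_k}) (g z).
by split=> [|v]; [exact: dfun_comp|rewrite (diff_chain v dg h1) h2].
Qed.

Lemma diff_rsubmx a k l (g : 'rV[C]_a -> 'rV[C]_(k + l)) z : differentiable g z ->
  differentiable (fun x => rsubmx (g x)) z /\
  forall v, 'd (fun x => rsubmx (g x)) z v = rsubmx ('d g z v).
Proof.
move=> dg; have [h1 h2] := linear_diff (@rsubmx C 1 k l : {linear 'rV[C]_(k + l) -> 'rV[C]_l}) (g z).
by split=> [|v]; [exact: dfun_comp|rewrite (diff_chain v dg h1) h2].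
Qed.

Lemma rank_jacobian k l (g : 'rV[C]_k -> 'rV[C]_l) z :
  \rank ('J g z) = l <-> forall y, exists w, 'd g z w = y.
Proof.
split=> [rk y|H].
  have : (y <= 'J g z)%MS by rewrite submx_full// /row_full rk.
  by case/submxP => w ->; exists w; rewrite /jacobian mul_rV_lin1.
apply/eqP; rewrite -/(row_full _) -sub1mx; apply/row_subP => i.
have [w <-] := H (row i 1%:M); apply/submxP; exists w.
by rewrite /jacobian mul_rV_lin1.
Qed.

(** The codimension is a variable [k], so that [g] need not be cast to [n - r]
    coordinates. *)
Lemma regular_pointI n r k (X V : set 'rV[C]_n) (g : 'rV[C]_n -> 'rV[C]_k) p :
  (r <= n)%N -> k = (n - r)%N -> X p -> open V -> V p -> holomorphic_on V g ->
  X `&` V = V `&` [set z | g z = 0] -> (forall y, exists w, 'd g p w = y) ->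
  regular_point X r p.
Proof.
move=> rn kE Xp oV Vp gV XV sur; subst k; split => //; exists V, g; split => //.
exact/rank_jacobian.
Qed.

Lemma complement_matrix k r n (A : 'M[C]_(k, n)) : n = (\rank A + r)%N ->
  exists B : 'M[C]_(r, n), row_full (col_mx A B).
Proof.
move=> nE; have : \rank (A^C)%MS = r by rewrite mxrank_compl; lia.
move=> <-; exists (row_base (A^C)%MS); rewrite -sub1mx.
have := addsmx_compl_full A; rewrite -sub1mx => /submx_trans; apply.
by rewrite addsmxE -!addsmxE addsmxS// eq_row_base.
Qed.

Lemma row_full_inj k r n (A : 'M[C]_(k, n)) (B : 'M[C]_(r, n)) (x : 'rV_k) (y : 'rV_r) :
  n = (k + r)%N -> row_full (col_mx A B) -> x *m A + y *m B = 0 -> x = 0 /\ y = 0.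
Proof.
move=> nE rf; rewrite -mul_row_col => H.
have fr : row_free (col_mx A B) by rewrite /row_free -[X in _ == X]nE.
have := row_free_inj fr (etrans H (esym (mul0mx _ _))).
by rewrite -[0]row_mx0 => /eq_row_mx.
Qed.

End HolomorphicMaps.

(** * Straightening a leaf *)

Section LeafGeometry.
Variable R : realType.
Local Notation C := R[i].
Variables d m : nat.
Local Notation n := (d + m)%N.
Local Notation N := (d + (m + m))%N.
Local Notation E := ('rV[R]_d * 'rV[C]_m)%type.
Variables (U : set E) (f : E -> 'rV[C]_n).
Hypotheses (U_open : open U) (f_analytic : real_analytic_map U f) (f_CR : CR_map U f)
  (f_diffeo : mixed_diffeo_onto_image U f).
Local Notation O := (real_domain U).

Lemma leaf_map_diff q : U q ->
  differentiable (fun xi : 'rV[C]_m => f (q.1, xi)) (q.2) /\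
  forall v, 'd (fun xi : 'rV[C]_m => f (q.1, xi)) (q.2) v =
    \sum_j leaf_derivative (fcoord f j) (to_real q) v *: delta_mx 0 j.
Proof.
move=> Uq; have Oq : O (to_real q) by rewrite /real_domain /= to_realK.
have H j := holo_leaf_diff (holo_fcoord f_analytic f_CR j) Oq.
have -> : (fun xi : 'rV[C]_m => f (q.1, xi)) =
    fun xi => \sum_j fcoord f j (to_real (q.1, xi)) *: delta_mx 0 j.
  by apply/funext => xi; rewrite {1}[f _]row_sum_delta; apply: eq_bigr => j _; rewrite /fcoord to_realK.
have dj j : differentiable (fun xi : 'rV[C]_m => fcoord f j (to_real (q.1, xi)) *: (delta_mx 0 j : 'rV[C]_n)) (q.2).
  by apply: dfunZl; exact: (H j).1.
split; first by apply: dfun_sum => j _; exact: dj.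
move=> v; apply: etrans (diff_bigsum _ _ dj) _; apply: eq_bigr => j _.
apply: etrans (diff_scale _ _ (H j).1) _; congr (_ *: _).
by have := (H j).2 => /(congr1 (fun g => g v)).
Qed.

(** A leaf direction is a real direction, on which the differential of the
    realified map is injective. *)
Lemma leaf_map_immersion q v : U q ->
  'd (fun xi : 'rV[C]_m => f (q.1, xi)) (q.2) v = 0 -> v = 0.
Proof.
move=> Uq; have Oq : O (to_real q) by rewrite /real_domain /= to_realK.
rewrite (leaf_map_diff Uq).2 => /rowP H.
have ld j : leaf_derivative (fcoord f j) (to_real q) v = 0.
  have := H j; rewrite summxE (bigD1 j)//= big1 ?addr0 => [|i ij]; rewrite !mxE ?eqxx ?mulr1//.
  by rewrite eq_sym (negbTE ij) mulr0.
suff w0 : to_real (0 : 'rV[R]_d, v) = 0.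
  by have := congr1 (@of_real R d m) w0; rewrite to_realK -(@to_real0 R d m) to_realK => -[].
apply: (dF_inj U_open f_diffeo Oq); rewrite (dF_JC f_diffeo _ Oq).
suff -> : map_mx (real_complex R) (to_real (0 : 'rV[R]_d, v)) *m full_jacobian f (to_real q) = 0.
  exact: realify0.
apply/rowP => j; rewrite !mxE big_split_ord /= big1 ?add0r => [|i _]; last first.
  by rewrite [map_mx _ _ _ _]mxE /to_real row_mxEl mxE mul0r.
rewrite big_split_ord /= -big_split /= -[RHS](ld j) /leaf_derivative; apply: eq_bigr => k _.
have wu : map_mx (real_complex R) (to_real (0 : 'rV[R]_d, v)) 0 (ux d k) = (complex.Re (v 0 k))%:C.
  by rewrite mxE /to_real row_mxEr /realify row_mxEl mxE.
have wv : map_mx (real_complex R) (to_real (0 : 'rV[R]_d, v)) 0 (vx d k) = (complex.Im (v 0 k))%:C.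
  by rewrite mxE /to_real row_mxEr /realify row_mxEr mxE.
rewrite -/(ux d k) -/(vx d k) wu wv !mxE.
rewrite (holo_fcoord f_analytic f_CR j Oq).2 [X in _ = X * _]complexE; ring.
Qed.

(** The leaf is the image of the immersion [xi |-> f (q.1, xi)]. With a
    complement [B] of its tangent space, [f (q.1, lsubmx z) + rsubmx z *m B]
    is a local biholomorphism, of which [chi] is an inverse. Near [f q] the
    leaf is the zero set of [rsubmx \o chi]; that no distant part of the leaf
    comes back to [f q] is the embedding property of [f]. *)
Lemma leaf_straightening q (dl : R) : U q -> 0 < dl ->
  exists (V : set 'rV[C]_n) (chi : 'rV[C]_n -> 'rV[C]_(m + d)),
  [/\ open V /\ V (f q), holomorphic_on V chi,
   (chi (f q) = row_mx q.2 0) /\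
   (forall z, V z -> mag (lsubmx (chi z) - q.2) < dl),
   (forall z, V z -> rsubmx (chi z) = 0 ->
      Levi_leaf U q (q.1, lsubmx (chi z)) /\ f (q.1, lsubmx (chi z)) = z) /\
   (forall xi, Levi_leaf U q (q.1, xi) -> V (f (q.1, xi)) -> chi (f (q.1, xi)) = row_mx xi 0) &
   (forall w, 'd chi (f q) w = 0 -> w = 0) /\ (forall y, exists w, 'd chi (f q) w = y)].
Proof.
move=> Uq dl0; have [r0 r00 Hball] := Levi_leaf_ball U_open Uq.
pose r := Num.min r0 dl; have rp : 0 < r by rewrite lt_min r00.
have ball xi : mag (xi - q.2) < r -> U (q.1, xi) /\ Levi_leaf U q (q.1, xi).
  rewrite lt_min => /andP[h1 h2].
  have h3 := Hball q (q.1, xi); have h4 := Hball (q.1, xi) q.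
  rewrite /= !subrr normr0 !mag0 in h3 h4; split.
    exact: (h4 (ltW r00) erefl (ltW h1) (ltW r00)).1.
  exact: (h3 (ltW r00) erefl (ltW r00) (ltW h1)).2.
pose D := 'd (fun xi : 'rV[C]_m => f (q.1, xi)) (q.2).
pose A := lin1_mx D.
have DA v : D v = v *m A by rewrite mul_rV_lin1.
have rA : \rank A = m.
  apply/eqP; rewrite -/(row_free A) -kermx_eq0; apply/eqP/row_matrixP => i; rewrite row0.
  by apply: (leaf_map_immersion Uq); rewrite -/D DA; apply/sub_kermxP; exact: row_sub.
have [B Bf] : exists B : 'M[C]_(d, n), row_full (col_mx A B).
  by apply: complement_matrix; rewrite rA addnC.
pose Phi (z : 'rV[C]_(m + d)) : 'rV[C]_n := f (q.1, lsubmx z) + rsubmx z *m B.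
pose p : 'rV[C]_(m + d) := row_mx q.2 0.
have sub_le (z : 'rV[C]_(m + d)) : mag (lsubmx z - q.2) <= mag (z - p).
  have -> : lsubmx z - q.2 = lsubmx (z - p) by rewrite linearB /= row_mxKl.
  by apply: mag_mx_le => [|i j]; [exact: mag_ge0|rewrite mxE; exact: mag_entry].
have dPhi z : mag (z - p) < r -> differentiable Phi z /\
   forall v, 'd Phi z v = 'd (fun xi : 'rV[C]_m => f (q.1, xi)) (lsubmx z) (lsubmx v) + rsubmx v *m B.
  move=> zr; have [Uz _] := ball _ (le_lt_trans (sub_le z) zr).
  have [d1 _] := leaf_map_diff Uz; rewrite /= in d1.
  have [l1 l2] := @diff_lsubmx R (m + d) m d id z (dfun_id _).
  have [r1 r2] := @diff_rsubmx R (m + d) m d id z (dfun_id _).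
  have [b1 b2] := diff_mulmx B (rsubmx z).
  have e1 : differentiable (fun z : 'rV[C]_(m + d) => f (q.1, lsubmx z)) z := dfun_comp l1 d1.
  have e2 : differentiable (fun z : 'rV[C]_(m + d) => rsubmx z *m B) z := dfun_comp r1 b1.
  have idE v : 'd (id : 'rV[C]_(m + d) -> 'rV[C]_(m + d)) z v = v by rewrite diff_val.
  split; first exact: dfunD.
  move=> v; apply: etrans (diff_add v e1 e2) _; congr (_ + _).
    by apply: etrans (diff_chain v l1 d1) _; congr ('d _ _ _); rewrite l2 idE.
  by apply: etrans (diff_chain v r1 b1) _; rewrite b2 r2 idE.
have pr : mag (p - p) < r by rewrite subrr mag0.
have lp : lsubmx p = q.2 by rewrite row_mxKl.
have rsp : rsubmx p = 0 by rewrite row_mxKr.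
have Phip : Phi p = f q by rewrite /Phi lp rsp mul0mx addr0; case: (q).
have inj h : 'd Phi p h = 0 -> h = 0.
  rewrite (dPhi p pr).2 lp -/D DA => /(row_full_inj (addnC _ _) Bf) [h1 h2].
  by rewrite -[h]hsubmxK h1 h2 row_mx0.
have [s [t [chi [/andP[s0 sr] t0 Hinv Hback]]]] :=
  inverse_function (addnC m d) rp (fun z zr => (dPhi z zr).1) inj.
(* points of [M] near [f q] have parameters near [q] *)
have [V1 [oV1 V1q HV1]] : exists V, [/\ open V, V (f q) &
    forall q', U q' -> V (f q') -> mag (q'.2 - q.2) < s].
  apply: (f_embedding f_diffeo Uq); apply/nbhs_prodP; exists (s / 2); first by rewrite divr_gt0.
  by move=> q' _ h; apply: le_lt_trans h _; rewrite ltr_pdivrMr// ltr_pMr// ltr1n.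
exists (V1 `&` [set w | mag (w - f q) < t]), chi.
have chi_q : chi (f q) = p.
  by rewrite -Phip; apply: Hback; rewrite ?Phip subrr mag0.
have fq_t : mag (f q - Phi p) < t by rewrite Phip subrr mag0.
have chi_leaf xi : Levi_leaf U q (q.1, xi) -> V1 (f (q.1, xi)) -> mag (f (q.1, xi) - f q) < t ->
    chi (f (q.1, xi)) = row_mx xi 0.
  move=> Lxi V1xi txi; have [Uxi _] := Levi_leaf_sub Lxi.
  have PhiE : Phi (row_mx xi 0) = f (q.1, xi) by rewrite /Phi row_mxKl row_mxKr mul0mx addr0.
  rewrite -PhiE; apply: Hback; last by rewrite PhiE Phip.
  have -> : row_mx xi 0 - p = row_mx (xi - q.2) (0 : 'rV[C]_d).
    by rewrite /p opp_row_mx add_row_mx subrr.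
  apply: le_lt_trans (HV1 _ Uxi V1xi) => /=.
  apply: mag_mx_le => [|i j]; first exact: mag_ge0.
  by rewrite mxE; case: splitP => k _; rewrite ?mag_entry// mxE mag0 mag_ge0.
have dchi z : mag (z - f q) < t -> differentiable chi z.
  by move=> zt; have [] := Hinv z; rewrite ?Phip.
split.
- split; first by apply: openI => //; exact: open_mag_ball.
  by split => //=; rewrite subrr mag0.
- by move=> z [_ /dchi].
- split=> [|z [_ zt]]; first exact: chi_q.
  have [chis _ _] : [/\ mag (chi z - p) < s, Phi (chi z) = z & differentiable chi z].
    by apply: Hinv; rewrite Phip.
  apply: le_lt_trans (sub_le _) _; apply: lt_le_trans chis _.
  by apply: le_trans sr _; rewrite ge_min lexx orbT.
- split=> [z [_ zt] tau0|xi Lxi [V1xi txi]]; last exact: chi_leaf.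
  have [chis Phiz _] : [/\ mag (chi z - p) < s, Phi (chi z) = z & differentiable chi z].
    by apply: Hinv; rewrite Phip.
  have [Uz Lz] := ball _ (le_lt_trans (sub_le _) (lt_le_trans chis sr)).
  by split => //; rewrite -[RHS]Phiz /Phi tau0 mul0mx addr0.
have dchi0 : differentiable chi (f q) by apply: dchi; rewrite subrr mag0.
have dPhip := dPhi p pr.
split.
  move=> w w0; have near_id : \forall z \near f q, Phi (chi z) = z.
    by apply/nbhs_magP; exists t => // z zt; have [] := Hinv z; rewrite ?Phip.
  have dP : differentiable Phi (chi (f q)) by rewrite chi_q; exact: dPhip.1.
  have := diff_left_inverse w dchi0 dP near_id.
  by rewrite w0 => <-; exact: linear0.
move=> y; exists ('d Phi p y).
have near_id : \forall z \near p, chi (Phi z) = z.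
  have cPhi : \forall z \near p, mag (Phi z - Phi p) < t.
    have /continuous_magP/(_ t t0) [e e0 He] := differentiable_continuous dPhip.1.
    by apply/nbhs_magP; exists e.
  have : \forall z \near p, mag (z - p) < s by apply/nbhs_magP; exists s.
  by apply: filterS2 cPhi => z h1 h2; exact: Hback.
have dc : differentiable chi (Phi p) by rewrite Phip.
have := diff_left_inverse y dPhip.1 dc near_id.
by rewrite [X in 'd chi X]Phip.
Qed.

End LeafGeometry.

(** * Subvarieties of a leaf *)

Section LeafVarieties.
Variable R : realType.
Local Notation C := R[i].
Variables d m : nat.
Local Notation n := (d + m)%N.
Local Notation N := (d + (m + m))%N.
Local Notation E := ('rV[R]_d * 'rV[C]_m)%type.
Variables (U : set E) (f : E -> 'rV[C]_n).
Hypotheses (U_open : open U) (f_analytic : real_analytic_map U f) (f_CR : CR_map U f)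
  (f_diffeo : mixed_diffeo_onto_image U f).
Local Notation O := (real_domain U).

(** An equation [phi] in the parameter of the leaf is read in the ambient
    space as [phi \o lsubmx \o chi]; the equations [rsubmx \o chi] of the leaf
    complete it. *)
Lemma leaf_equation q k (phi : 'rV[C]_m -> 'rV[C]_k) (rho : R) X :
  U q -> 0 < rho -> X `<=` f @` Levi_leaf U q ->
  (forall xi, mag (xi - q.2) < rho -> differentiable phi xi /\ (X (f (q.1, xi)) <-> phi xi = 0)) ->
  exists (V : set 'rV[C]_n) (G : 'rV[C]_n -> 'rV[C]_(k + d)),
    [/\ open V, V (f q), holomorphic_on V G, X `&` V = V `&` [set z | G z = 0] &
      (forall y : 'rV[C]_k, exists w, 'd phi (q.2) w = y) -> forall y : 'rV[C]_(k + d), exists w, 'd G (f q) w = y].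
Proof.
move=> Uq rho0 XL Hphi.
have [V [chi [[oV Vq] hol [chiq small] [back leaf] [inj sur]]]] :=
  leaf_straightening U_open f_analytic f_CR f_diffeo Uq rho0.
have dl z : V z -> differentiable (fun z => lsubmx (chi z)) z /\
   forall v, 'd (fun z => lsubmx (chi z)) z v = lsubmx ('d chi z v).
  by move=> Vz; apply: diff_lsubmx; exact: hol.
have dr z : V z -> differentiable (fun z => rsubmx (chi z)) z /\
   forall v, 'd (fun z => rsubmx (chi z)) z v = rsubmx ('d chi z v).
  by move=> Vz; apply: diff_rsubmx; exact: hol.
have dp z : V z -> differentiable (fun z => phi (lsubmx (chi z))) z.
  by move=> Vz; apply: dfun_comp (dl z Vz).1 (Hphi _ (small _ Vz)).1.
exists V, (fun z => row_mx (phi (lsubmx (chi z))) (rsubmx (chi z))); split => //.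
- by move=> z Vz; exact: (diff_row_mx (dp z Vz) (dr z Vz).1).1.
- apply/seteqP; split=> z /=.
    case=> Xz Vz; split => //; have [[x xi] Lxi fz] := XL _ Xz.
    have [Ux /= xq] := Levi_leaf_sub Lxi; rewrite /= in xq; subst x.
    have chiz : chi z = row_mx xi 0 by rewrite -fz; apply: leaf => //; rewrite fz.
    have := small _ Vz; rewrite chiz row_mxKl row_mxKr => /Hphi [_ [h _]].
    by rewrite h ?row_mx0// fz.
  case=> Vz; rewrite -[0 in RHS]row_mx0 => G0; split => //.
  have [p0 t0] : phi (lsubmx (chi z)) = 0 /\ rsubmx (chi z) = 0.
    by case/eq_row_mx: G0.
  have [Lz fz] := back _ Vz t0.
  by rewrite -fz; apply/(Hphi _ (small _ Vz)).2.
move=> sp y; have [w1 Hw1] := sp (lsubmx y); have [w Hw] := sur (row_mx w1 (rsubmx y)).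
exists w; apply: etrans ((diff_row_mx (dp _ Vq) (dr _ Vq).1).2 w) _.
rewrite -[RHS]hsubmxK; congr row_mx; last by rewrite (dr _ Vq).2 Hw row_mxKr.
apply: etrans (diff_chain w (dl _ Vq).1 (Hphi _ (small _ Vq)).1) _.
by rewrite (dl _ Vq).2 Hw chiq !row_mxKl.
Qed.

Lemma leaf_regular_point q k (phi : 'rV[C]_m -> 'rV[C]_k) (rho : R) X :
  U q -> 0 < rho -> X `<=` f @` Levi_leaf U q ->
  (forall xi, mag (xi - q.2) < rho -> differentiable phi xi /\ (X (f (q.1, xi)) <-> phi xi = 0)) ->
  phi (q.2) = 0 -> (forall y : 'rV[C]_k, exists w, 'd phi (q.2) w = y) ->
  regular_point X (m - k) (f q).
Proof.
move=> Uq rho0 XL Hphi p0 sur.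
have km : (k <= m)%N by rewrite -[X in (X <= _)%N]((rank_jacobian phi (q.2)).2 sur) rank_leq_row.
have [V [G [oV Vq hol XV /(_ sur) surG]]] := leaf_equation Uq rho0 XL Hphi.
apply: (regular_pointI _ _ _ oV Vq hol XV surG); [lia|lia|].
have := (Hphi (q.2)); rewrite subrr mag0 => /(_ rho0) [_ [_ H]].
by have := H p0; case: (q).
Qed.

(** The equations of [X] at a regular point, completed to coordinates, give a
    parametrization [theta] of [X] by [s] variables. In the parameters of the
    leaf it becomes an immersion [eta] into [m] variables, so [s <= m]; if
    [s = m], [eta] is locally onto and [X] contains a neighborhood of the
    point in the leaf. *)
Lemma leaf_dim_bound q s X : U q -> X `<=` f @` Levi_leaf U q -> regular_point X s (f q) ->
  (s <= m)%N /\ (s = m -> exists2 r : R, 0 < r &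
     forall xi, mag (xi - q.2) < r -> X (f (q.1, xi))).
Proof.
move=> Uq XL [sn Xq [V [g [oV Vq hg XV rk]]]].
have [V2 [chi [[oV2 V2q] hol [chiq small] [back leaf] [inj _]]]] :=
  leaf_straightening U_open f_analytic f_CR f_diffeo Uq ltr01.
pose J := 'J g (f q).
have gJ w : 'd g (f q) w = w *m J by rewrite /J /jacobian mul_rV_lin1.
have [P Pf] : exists P : 'M[C]_(s, n), row_full (col_mx J^T P).
  by apply: complement_matrix; rewrite mxrank_tr rk subnK.
have injJP w : w *m J = 0 -> w *m P^T = 0 -> w = 0.
  move=> h1 h2; have fr : row_free (row_mx J P^T).
    by rewrite /row_free -mxrank_tr tr_row_mx trmxK; exact: Pf.
  by apply: (row_free_inj fr); rewrite mul_mx_row h1 h2 row_mx0 mul0mx.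
(* the equations of [X], completed to coordinates by linear functions *)
pose Psi z := row_mx (g z) ((z - f q) *m P^T).
have dB z : differentiable (fun z : 'rV[C]_n => (z - f q) *m P^T) z /\
    forall v, 'd (fun z : 'rV[C]_n => (z - f q) *m P^T) z v = v *m P^T.
  have -> : (fun z : 'rV[C]_n => (z - f q) *m P^T) = fun z => z *m P^T + - (f q *m P^T).
    by apply/funext => x; rewrite mulmxBl.
  have [h1 h2] := diff_mulmx P^T z.
  split; first by apply: dfunD; [exact: h1|exact: dfun_cst].
  move=> v; apply: etrans (diff_add v h1 (dfun_cst _ _)) _.
  by apply: etrans (congr2 +%R (h2 v) (diff_const _ z v)) (addr0 _).
have [r r0 rV] : exists2 r : R, 0 < r & forall z, mag (z - f q) < r -> V z /\ V2 z.
  by apply/nbhs_magP; apply: filterI; exact: open_nbhs_nbhs.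
have dPsi z : mag (z - f q) < r -> differentiable Psi z /\
    forall v, 'd Psi z v = row_mx ('d g z v) (v *m P^T).
  move=> /rV [Vz _]; have [h1 h2] := diff_row_mx (hg _ Vz) (dB z).1.
  by split => // v; rewrite h2 (dB z).2.
have g0 : g (f q) = 0.
  have : (X `&` V) (f q) by split.
  by rewrite XV => -[].
have Psiq : Psi (f q) = 0 by rewrite /Psi g0 subrr mul0mx row_mx0.
have rq : mag (f q - f q) < r by rewrite subrr mag0.
have injPsi h : 'd Psi (f q) h = 0 -> h = 0.
  rewrite (dPsi _ rq).2 gJ -[X in _ = X]row_mx0 => /eq_row_mx [h1 h2]; exact: injJP.
have [t [t' [Psii [/andP[t0 tr] t'0 Hinv Hback]]]] :=
  inverse_function (esym (subnK sn)) r0 (fun z zr => (dPsi z zr).1) injPsi.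
(* the parametrization of [X] = [g = 0] *)
pose theta (v : 'rV[C]_s) := Psii (row_mx 0 v).
have thetaP v : mag v < t' -> [/\ mag (theta v - f q) < t, Psi (theta v) = row_mx 0 v &
    differentiable theta v].
  move=> vt; have h : mag (row_mx 0 v - Psi (f q)) < t'.
    rewrite Psiq subr0; apply: le_lt_trans vt; apply: mag_mx_le => [|i j]; first exact: mag_ge0.
    by rewrite mxE; case: splitP => k _; rewrite ?mag_entry// mxE mag0 mag_ge0.
  have [h1 h2 h3] := Hinv _ h; split => //.
  apply: dfun_comp h3; exact: (diff_row_mx (dfun_cst _ _) (dfun_id _)).1.
have thetaX v : mag v < t' -> [/\ X (theta v), V2 (theta v) & (theta v - f q) *m P^T = v].
  move=> /thetaP [h1 h2 _]; have [Vt V2t] := rV _ (lt_le_trans h1 tr).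
  move/eq_row_mx: h2 => [h2 h3]; split => //.
  by have : (V `&` [set z | g z = 0]) (theta v) by []; rewrite -XV => -[].
have theta0 : theta 0 = f q.
  by rewrite /theta row_mx0 -Psiq; apply: Hback; rewrite subrr mag0.
have t'0' : mag (0 : 'rV[C]_s) < t' by rewrite mag0.
have [_ _ dtheta0] := thetaP _ t'0'.
have near_t : \forall v \near (0 : 'rV[C]_s), mag v < t'.
  by apply/nbhs_magP; exists t' => // w; rewrite subr0.
have injtheta v : 'd theta 0 v = 0 -> v = 0.
  move=> v0; have id0 : \forall v \near (0 : 'rV[C]_s), (theta v - f q) *m P^T = v.
    by apply: filterS near_t => w /thetaX [].
  have := diff_left_inverse v dtheta0 (dB (theta 0)).1 id0.
  by rewrite v0 => <-; exact: linear0.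
have chi_theta v : mag v < t' -> rsubmx (chi (theta v)) = 0 /\
    f (q.1, lsubmx (chi (theta v))) = theta v.
  move=> /thetaX [Xt V2t _]; have [[x xi] Lxi fz] := XL _ Xt.
  have [Ux /= xq] := Levi_leaf_sub Lxi; rewrite /= in xq; subst x.
  have -> : chi (theta v) = row_mx xi 0 by rewrite -fz; apply: leaf => //; rewrite fz.
  by rewrite row_mxKl row_mxKr.
have dct v : mag v < t' -> differentiable (fun v => chi (theta v)) v.
  move=> vt; have [_ V2t _] := thetaX _ vt; have [_ _ dt] := thetaP _ vt.
  exact: dfun_comp dt (hol _ V2t).
pose eta v := lsubmx (chi (theta v)).
have deta v : mag v < t' -> differentiable eta v by move=> /dct/diff_lsubmx[].
have injeta v : 'd eta 0 v = 0 -> v = 0.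
  rewrite (diff_lsubmx (dct _ t'0')).2 => h1; apply: injtheta; apply: inj.
  have dchiq : differentiable chi (theta 0) by rewrite theta0; exact: hol.
  have E2 : 'd (fun v => chi (theta v)) 0 v = 'd chi (f q) ('d theta 0 v).
    by apply: etrans (diff_chain v dtheta0 dchiq) _; rewrite theta0.
  rewrite -E2 -[LHS]hsubmxK h1 -(diff_rsubmx (dct _ t'0')).2.
  have tau0 : \forall v \near (0 : 'rV[C]_s), rsubmx (chi (theta v)) = 0.
    by apply: filterS near_t => w /chi_theta [].
  have -> : 'd (fun v => rsubmx (chi (theta v))) 0 v = 0; last by rewrite row_mx0.
  apply: etrans (diff_germ v (diff_rsubmx (dct _ t'0')).1 (dfun_cst 0 _) tau0) _.
  exact: diff_const.
have eta0 : eta 0 = q.2 by rewrite /eta theta0 chiq row_mxKl.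
split.
  pose A := lin1_mx ('d eta 0); have AE v : 'd eta 0 v = v *m A by rewrite mul_rV_lin1.
  suff : \rank A = s by move=> <-; exact: rank_leq_col.
  apply/eqP; rewrite -/(row_free A) -kermx_eq0; apply/eqP/row_matrixP => i; rewrite row0.
  by apply: injeta; rewrite AE; apply/sub_kermxP; exact: row_sub.
move=> sm.
have [s2 [t2 [etai [/andP[s20 s2t] t20 Hinv2 _]]]] :=
  inverse_function sm t'0 (fun z zr => deta z (eq_ind _ (fun w => mag w < t') zr _ (subr0 z))) injeta.
exists t2 => // xi xit; have [h1 h2 _] := Hinv2 xi (eq_ind_r (fun w => mag (xi - w) < t2) xit eta0).
have h3 : mag (etai xi) < t' by move: h1; rewrite subr0 => /lt_le_trans; apply.
by rewrite -h2 /eta (chi_theta _ h3).2; have [] := thetaX _ h3.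
Qed.

End LeafVarieties.

(** * Hurwitz's theorem with parameters *)

Section Hurwitz.
Variable R : realType.
Local Notation C := R[i].
Variables d m : nat.
Local Notation N := (d + (m + m))%N.
Local Notation E := ('rV[R]_d * 'rV[C]_m)%type.
Implicit Types (U : set E) (h : 'rV[R]_N -> C) (q : E) (e : 'rV[C]_m).

(** Compactness of the square. The same [dl] will serve as a lower bound and
    as a radius. *)
Lemma uniform_on_square (P : R -> C -> Prop) (r : R) :
  (forall w, in_rect (- r) r (- r) r w -> exists2 eta : R, 0 < eta &
     forall w' dl, mag (w' - w) < eta -> 0 < dl < eta -> P dl w') ->
  exists2 dl : R, 0 < dl & forall w, in_rect (- r) r (- r) r w -> P dl w.
Proof.
move=> H; have cK : compact (`[- r, r]%classic `*` `[- r, r]%classic : set (R * R)).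
  by apply: compact_setX; exact: segment_compact.
have /compact_near_coveringP cov := cK.
have := cov R (0^'+) (fun dl (z : R * R) => P dl (z.1 +i* z.2)) _.
have loc : forall x : R * R, (`[- r, r]%classic `*` `[- r, r]%classic) x ->
   \forall x' \near x & i \near 0^'+, P i (x'.1 +i* x'.2).
  move=> [x y] /= [hx hy]; rewrite !in_itv /= in hx hy.
  have [eta eta0 He] := H (x +i* y) (conj hx hy).
  have e2 : 0 < eta / 2 by rewrite divr_gt0.
  exists ([set x' : R * R | `|x - x'.1| < eta / 2 /\ `|y - x'.2| < eta / 2],
          [set dl | 0 < dl < eta]) => /=.
    split.
      exists (ball x (eta / 2), ball y (eta / 2)); first by split; exact: nbhsx_ballx.
      by move=> [x' y'] [h1 h2]; split; [exact: h1|exact: h2].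
    have := nbhs_right_lt eta0; have := @nbhs_right_gt R 0.
    by apply: filterS2 => dl h1 h2; apply/andP.
  move=> [[x' y'] dl] /= [[h1 h2] h3]; apply: He => //.
  apply: le_lt_trans (mag_le_ReIm _) _ => /=.
  by rewrite -[x' - x]opprB -[y' - y]opprB !normrN [ltRHS]splitr ltrD.
move=> /(_ _ loc) cv.
have : \forall dl \near (0 : R)^'+, 0 < dl /\ forall w, in_rect (- r) r (- r) r w -> P dl w.
  have := cv; have := @nbhs_right_gt R 0; apply: filterS2 => dl h1 h2; split => // -[x y] [hx hy].
  by apply: (h2 (x, y)); split; rewrite /= in_itv.
by move=> /filter_ex [dl [d0 Hd]]; exists dl.
Qed.

Lemma line_near q1 e w0 (B : set E) : nbhs (q1.1, q1.2 + w0 *: e) B ->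
  exists2 eta : R, 0 < eta & forall q w, `|q.1 - q1.1| <= eta -> mag (q.2 - q1.2) <= eta ->
    mag (w - w0) <= eta -> B (q.1, q.2 + w *: e).
Proof.
move=> /nbhs_prodP [r r0 H]; have e1 : 0 < 1 + mag e by rewrite ltr_wpDr ?mag_ge0.
exists (r / (1 + mag e)); first by rewrite divr_gt0.
have le1 : r / (1 + mag e) <= r.
  by rewrite ler_pdivrMr// mulrDr mulr1 lerDl mulr_ge0 ?mag_ge0 ?ltW.
move=> q w h1 h2 h3; apply: H => /=; first exact: le_trans h1 le1.
have -> : q.2 + w *: e - (q1.2 + w0 *: e) = (q.2 - q1.2) + (w - w0) *: e.
  by rewrite scalerBl opprD addrACA.
apply: le_trans (magD _ _) _; rewrite magZ.
have -> : r = r / (1 + mag e) + r / (1 + mag e) * mag e.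
  by rewrite -[X in X + _]mulr1 -mulrDr divfK// gt_eqF.
by apply: lerD => //; rewrite ler_wpM2r ?mag_ge0.
Qed.

Lemma holo_near U h q : open U -> holo_on (real_domain U) h -> U q -> forall eps : R, 0 < eps ->
  \forall q' \near q, U q' /\ mag (h (to_real q') - h (to_real q)) < eps.
Proof.
move=> oU hh Uq eps eps0; apply: filterI; first exact: open_nbhs_nbhs.
have [an _] : analytic_at h (to_real q) /\ True.
  by split => //; apply: (hh _ _).1; rewrite /real_domain /= to_realK.
have [dl dl0 Hd] := analytic_continuous an eps0.
by apply/nbhs_to_realP; exists dl => // y /Hd; rewrite of_realK.
Qed.

(** On the border of a square about [w = 0], the values of [h] along the line
    through [q] are bounded below uniformly in [q] near [q1], and at the
    center they tend to [h q1 = 0]; so [zero_in_square] applies. *)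
Lemma hurwitz_parameter U h q1 e (rho : R) : open U -> holo_on (real_domain U) h -> 0 < rho ->
  (forall w : C, mag w <= rho -> U (q1.1, q1.2 + w *: e)) -> h (to_real q1) = 0 ->
  (forall w : C, mag w <= rho -> h (to_real (q1.1, q1.2 + w *: e)) = 0 -> w = 0) ->
  \forall q \near q1, U q /\ exists2 w : C, mag w <= rho & U (q.1, q.2 + w *: e) /\
     h (to_real (q.1, q.2 + w *: e)) = 0.
Proof.
move=> oU hh rho0 HU h0 iso; pose r := rho / 2.
have r0 : 0 < r by rewrite divr_gt0.
have rect_le w : in_rect (- r) r (- r) r w -> mag w <= rho.
  move=> [h1 h2]; apply: le_trans (mag_le_ReIm _) _.
  by rewrite [leRHS]splitr; apply: lerD; rewrite ler_norml.
pose P dl w := forall q, `|q.1 - q1.1| <= dl -> mag (q.2 - q1.2) <= dl ->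
  U (q.1, q.2 + w *: e) /\ (r <= mag w -> dl <= mag (h (to_real (q.1, q.2 + w *: e)))).
have [dl dl0 HP] : exists2 dl : R, 0 < dl & forall w, in_rect (- r) r (- r) r w -> P dl w.
  apply: uniform_on_square => w0 w0r.
  have Uw0 := HU _ (rect_le _ w0r).
  pose g := mag (h (to_real (q1.1, q1.2 + w0 *: e))) / 2.
  (* the points near [w = 0], a zero of [h], are not on the border *)
  have [w00|w0n] := eqVneq w0 0.
    have [eta eta0 He] := line_near (open_nbhs_nbhs (conj oU Uw0)).
    exists (Num.min eta r); first by rewrite lt_min eta0.
    move=> w dl; rewrite !lt_min => /andP[we]; rewrite w00 subr0 => wr /and3P[dl0 dle _] q h1 h2.
    split; last by rewrite leNgt wr.
    exact: He (le_trans h1 (ltW dle)) (le_trans h2 (ltW dle)) (ltW we).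
  have g0 : 0 < g.
    rewrite divr_gt0// mag_gt0; apply/eqP => h00.
    by move: w0n; rewrite (iso _ (rect_le _ w0r) h00) eqxx.
  have [eta eta0 He] := line_near (holo_near oU hh Uw0 g0).
  exists (Num.min eta g); first by rewrite lt_min eta0.
  move=> w dl; rewrite !lt_min => /andP[we _] /and3P[dl0 dle dlg] q h1 h2.
  have [] := He q w (le_trans h1 (ltW dle)) (le_trans h2 (ltW dle)) (ltW we).
  move=> Uqw hw; split => // _; apply: le_trans (ltW dlg) _.
  have := mag_sub (h (to_real (q1.1, q1.2 + w0 *: e))) (h (to_real (q.1, q.2 + w *: e))).
  move: hw; rewrite mag_distC /g; move: (mag _) (mag _) (mag _) => a b c; clear; lra.
have Uq1 : U q1 by have := HU 0; rewrite mag0 scale0r addr0; case: (q1) => x y; apply; exact: ltW.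
have dl16 : 0 < dl / 16 by rewrite divr_gt0.
have near_q1 : \forall q \near q1, `|q.1 - q1.1| <= dl /\ mag (q.2 - q1.2) <= dl.
  by apply/nbhs_prodP; exists dl => // q h1 h2.
apply: filterS2 near_q1 (holo_near oU hh Uq1 dl16) => q [q1d q2d] [Uq hq]; split => //.
pose psi w := h (to_real (q.1, q.2 + w *: e)).
have psid w : in_rect (0 - r) (0 + r) (0 - r) (0 + r) w -> cdiff_at psi w.
  rewrite sub0r add0r => wr; have [Uw _] := HP w wr q q1d q2d; apply/cdiff_atP.
  have Ow : real_domain U (to_real (q.1, q.2 + w *: e)) by rewrite /real_domain /= to_realK.
  have [dh _] := holo_leaf_diff hh Ow.
  apply: (@dfun_comp _ _ _ _ (fun w : C => q.2 + w *: e) (fun xi => h (to_real (q.1, xi)))) dh.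
  by apply: dfunD; [exact: dfun_cst|apply: dfunZl; exact: dfun_id].
have := @zero_in_square R psi 0 0 r dl r0 dl0 psid.
rewrite sub0r add0r => zs.
have border z : in_rect (- r) r (- r) r z -> on_border (- r) r (- r) r z -> dl <= mag (psi z).
  move=> zr zb; have [_] := HP z zr q q1d q2d; apply.
  case: zb => E1.
  - by apply: le_trans (le_Re_mag z); rewrite E1 normrN gtr0_norm.
  - by apply: le_trans (le_Re_mag z); rewrite E1 gtr0_norm.
  - by apply: le_trans (le_Im_mag z); rewrite E1 normrN gtr0_norm.
  - by apply: le_trans (le_Im_mag z); rewrite E1 gtr0_norm.
have [|z zr z0] := zs border.
  rewrite -[0 +i* 0]/(0 : C) /psi scale0r addr0; have -> : (q.1, q.2) = q by case: (q).
  by move: hq; rewrite h0 subr0 ltr_pdivlMr// mulrC.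
exists z; first exact: rect_le.
by split; first by have [] := HP z zr q q1d q2d.
Qed.

End Hurwitz.

(** * The zeros on a leaf *)

Section LeafZeros.
Variable R : realType.
Local Notation C := R[i].
Variables d m : nat.
Local Notation N := (d + (m + m))%N.
Local Notation E := ('rV[R]_d * 'rV[C]_m)%type.
Implicit Types (U : set E) (h u : 'rV[R]_N -> C) (p q : E).

(** Among the zeros of [h] on the leaf, [q1] has the least order, that is, the
    shortest list of leaf directions with a nonzero iterated derivative; [u]
    is the derivative along the tail of that list, and it vanishes at all the
    zeros by minimality. *)
Lemma leaf_zero_order U h p : open U -> holo_on (real_domain U) h ->
  (exists2 q, Levi_leaf U p q & h (to_real q) = 0) ->
  (exists2 q, Levi_leaf U p q & h (to_real q) <> 0) ->
  exists q1 u k, [/\ Levi_leaf U p q1 /\ h (to_real q1) = 0, holo_on (real_domain U) u,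
    forall q, Levi_leaf U p q -> h (to_real q) = 0 -> u (to_real q) = 0 &
    Dreal u (delta_mx 0 (ux d k)) (to_real q1) != 0].
Proof.
move=> oU hh [qz Lz z] [qn Ln nz].
have an q : U q -> analytic_at h (to_real q).
  by move=> Uq; apply: (hh _ _).1; rewrite /real_domain /= to_realK.
pose P j := `[< exists q l, [/\ Levi_leaf U p q, h (to_real q) = 0, all (@leafdir d m) l,
   size l = j & Dl l h (to_real q) != 0] >].
have exP : exists j, P j.
  have [l al lz] := leaf_flat_nonzero oU an Ln nz Lz.
  by exists (size l); apply/asboolP; exists qz, l.
case: (ex_minnP exP) => j /asboolP [q1 [l [L1 z1 al sl lz]]] minj.
case: l al sl lz => [|i l] /=; first by rewrite z1 eqxx.
move=> /andP[li al] sl lz.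
have hu : holo_on (real_domain U) (Dl l h) by apply: holo_Dl => //; exact: open_to_real.
have O1 : real_domain U (to_real q1).
  by rewrite /real_domain /= to_realK; exact: (Levi_leaf_sub L1).1.
have [k Hk] : exists k, Dreal (Dl l h) (delta_mx 0 (ux d k)) (to_real q1) != 0.
  case: (leafdirP li) => -[k ik]; exists k; rewrite ik in lz; first exact: lz.
  by apply: contraNneq lz => e; rewrite (hu _ O1).2 e mulr0.
exists q1, (Dl l h), k; split => // q Lq zq; apply/eqP; apply: contrapT => /negP nz'.
have /minj : P (size l) by apply/asboolP; exists q, l.
by rewrite -sl ltnn.
Qed.

(** Near [q1], by strict differentiability, the increments of [u] along the
    direction [k] are at least half of those of its differential. *)
Lemma line_injective U u q1 k : open U -> holo_on (real_domain U) u -> U q1 ->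
  Dreal u (delta_mx 0 (ux d k)) (to_real q1) != 0 ->
  exists2 rho : R, 0 < rho & forall (xi : 'rV[C]_m) (w : C),
    mag (xi - q1.2) < rho -> mag (xi + w *: delta_mx 0 k - q1.2) < rho ->
    u (to_real (q1.1, xi + w *: delta_mx 0 k)) = u (to_real (q1.1, xi)) -> w = 0.
Proof.
move=> oU hu U1; set c := Dreal _ _ _ => c0.
pose one : 'rV[C]_1 := const_mx 1.
have O1 : real_domain U (to_real q1) by rewrite /real_domain /= to_realK.
have [r r0 Hr] : exists2 r : R, 0 < r & forall xi, mag (xi - q1.2) < r -> U (q1.1, xi).
  have /nbhs_prodP [r r0 H] := open_nbhs_nbhs (conj oU U1).
  by exists r => // xi xr; apply: H; rewrite /= ?subrr ?normr0 ltW.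
pose G (xi : 'rV[C]_m) : 'rV[C]_1 := u (to_real (q1.1, xi)) *: one.
have dG xi : mag (xi - q1.2) < r -> differentiable G xi.
  move=> xr; have Oxi : real_domain U (to_real (q1.1, xi)).
    by rewrite /real_domain /= to_realK; exact: Hr.
  by have [h1 _] := holo_leaf_diff hu Oxi; apply: dfunZl; exact: h1.
have c2 : 0 < mag c / 2 by rewrite divr_gt0 ?mag_gt0.
have [dl dl0 Hd] := holo_strict r0 dG c2.
exists dl => // xi w h1 h2 E; have := Hd _ _ h1 h2.
have -> : G (xi + w *: delta_mx 0 k) - G xi = 0 by rewrite /G E subrr.
have -> : xi + w *: delta_mx 0 k - xi = w *: delta_mx 0 k by rewrite addrAC subrr add0r.
rewrite sub0r magN.
have [d1 d2] := holo_leaf_diff hu O1.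
have -> : 'd G (q1.2) (w *: delta_mx 0 k) = (w * c) *: one.
  apply: etrans (diff_scale one _ d1) _; congr (_ *: _).
  apply: etrans (congr1 (fun g => g (w *: delta_mx 0 k)) d2) _.
  rewrite /leaf_derivative (bigD1 k)//= big1 ?addr0 => [|i ik]; rewrite !mxE ?eqxx ?mulr1//.
  by rewrite (negbTE ik) /= mulr0 mul0r.
rewrite !magZ ?magM => H; apply/eqP; rewrite -mag_eq0; apply: contraTT H => w0.
rewrite -ltNge; have w0' : 0 < mag w by rewrite lt_def w0 mag_ge0.
have o1 : 1 <= mag one by apply: le_trans (mag_entry one 0 0); rewrite mxE mag1.
have e1 : mag (delta_mx 0 k : 'rV[C]_m) <= 1.
  apply: mag_mx_le => // i j; rewrite mxE; case: (_ && _); rewrite ?mag1 ?mag0//.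
have p1 : 0 < mag w * mag c by rewrite mulr_gt0// mag_gt0.
have h3 : mag w * mag c <= mag w * mag c * mag one by rewrite ler_peMr// ltW.
have h4 : mag c / 2 * (mag w * mag (delta_mx 0 k : 'rV[C]_m)) <= mag c / 2 * mag w.
  by rewrite ler_wpM2l ?(ltW c2)// ler_piMr ?mag_ge0.
apply: le_lt_trans h4 _; apply: lt_le_trans h3.
by rewrite mulrC mulrA ltr_pdivrMr// ltr_pMr// ltr1n.
Qed.

(** At the zeros of [h] on the leaf, [u] vanishes. Conversely, near a zero
    [xi] of [u], the line in the direction [k] contains a zero of [h] by
    [hurwitz_parameter]; it is a zero of [u] as well, hence is [xi], since [u]
    is injective on these lines. Thus [u = 0] is a smooth equation of the zero
    set, whatever the multiplicity of [h]. *)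
Lemma leaf_zero_structure U h p : open U -> holo_on (real_domain U) h ->
  (exists2 q, Levi_leaf U p q & h (to_real q) = 0) ->
  (exists2 q, Levi_leaf U p q & h (to_real q) <> 0) ->
  exists q1 (phi : 'rV[C]_m -> 'rV[C]_1) (rho : R),
  [/\ Levi_leaf U p q1 /\ 0 < rho, phi q1.2 = 0,
   forall xi, mag (xi - q1.2) < rho -> differentiable phi xi /\
      [/\ U (q1.1, xi), Levi_leaf U q1 (q1.1, xi) & h (to_real (q1.1, xi)) = 0 <-> phi xi = 0],
   forall y : 'rV[C]_1, exists w, 'd phi (q1.2) w = y &
   \forall q \near q1, U q /\ exists2 q', Levi_leaf U q q' & h (to_real q') = 0].
Proof.
move=> oU hh zz nz; have [q1 [u [k [[L1 z1] hu zu c0]]]] := leaf_zero_order oU hh zz nz.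
have U1 : U q1 := (Levi_leaf_sub L1).1.
have [r0 r00 ball] := Levi_leaf_ball oU U1.
have [rho1 rho10 inj] := line_injective oU hu U1 c0.
pose e : 'rV[C]_m := delta_mx 0 k.
have e1 w : mag (w *: e) <= mag w.
  rewrite magZ ler_piMr ?mag_ge0//; apply: mag_mx_le => // i j.
  by rewrite mxE; case: (_ && _); rewrite ?mag1 ?mag0.
(* points at distance [rho] from [q1] are moved by at most [rho] along the line *)
have [rho [rho0 rr0 rr1]] : exists rho : R, [/\ 0 < rho, rho + rho <= r0 & rho + rho < rho1].
  exists (Num.min r0 rho1 / 3); have m0 : 0 < Num.min r0 rho1 by rewrite lt_min r00.
  have m1 : Num.min r0 rho1 <= r0 by rewrite ge_min lexx.
  have m2 : Num.min r0 rho1 <= rho1 by rewrite ge_min lexx orbT.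
  by move: m0 m1 m2; move: (Num.min _ _) => t; split; lra.
have leafU xi : mag (xi - q1.2) <= r0 -> U (q1.1, xi) /\ Levi_leaf U q1 (q1.1, xi).
  move=> xr; split.
    by apply: (ball (q1.1, xi) q1 _ erefl _ _).1; rewrite /= ?subrr ?normr0 ?mag0// ltW.
  by apply: (ball q1 (q1.1, xi) _ erefl _ _).2; rewrite /= ?subrr ?normr0 ?mag0// ltW.
have uz xi : mag (xi - q1.2) <= r0 -> h (to_real (q1.1, xi)) = 0 -> u (to_real (q1.1, xi)) = 0.
  by move=> /leafU [_ L]; apply: zu; rewrite (Levi_leaf_eq L1).
have rho_r0 : rho <= r0 by apply: le_trans rr0; rewrite lerDl ltW.
have rho_rho1 : rho < rho1 by apply: le_lt_trans rr1; rewrite lerDl ltW.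
have q1E : (q1.1, q1.2) = q1 by case: (q1).
have u1 : u (to_real q1) = 0 by apply: zu.
have hur := hurwitz_parameter (e := e) oU hh rho0 _ z1.
have {hur} : \forall q \near q1, U q /\ exists2 w : C, mag w <= rho & U (q.1, q.2 + w *: e) /\
     h (to_real (q.1, q.2 + w *: e)) = 0.
  apply: hur => w wr.
    by apply: (leafU _ _).1; rewrite addrAC subrr add0r (le_trans (e1 w))// (le_trans wr).
  have we : mag (q1.2 + w *: e - q1.2) <= rho.
    by rewrite addrAC subrr add0r (le_trans (e1 w)).
  move=> /(uz _ (le_trans we rho_r0)) u0; apply: (inj (q1.2)).
  - by rewrite subrr mag0.
  - exact: le_lt_trans we rho_rho1.
  - by rewrite u0 q1E u1.
move=> near1; have /nbhs_prodP [dl dl0 Hd] := near1.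
pose one : 'rV[C]_1 := const_mx 1.
pose phi (xi : 'rV[C]_m) : 'rV[C]_1 := u (to_real (q1.1, xi)) *: one.
have one0 (a : C) : a *: one = 0 -> a = 0.
  by move=> /rowP /(_ 0); rewrite !mxE mulr1.
exists q1, phi, (Num.min dl rho); split.
- by rewrite lt_min dl0.
- by rewrite /phi q1E u1 scale0r.
- move=> xi; rewrite lt_min => /andP[xd xrho].
  have [Uxi Lxi] := leafU xi (le_trans (ltW xrho) rho_r0).
  have Oxi : real_domain U (to_real (q1.1, xi)) by rewrite /real_domain /= to_realK.
  split; first by have [h1 _] := holo_leaf_diff hu Oxi; apply: dfunZl; exact: h1.
  split => //; split => [/(uz _ (le_trans (ltW xrho) rho_r0)) u0|/one0 u0].
    by rewrite /phi u0 scale0r.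
  have [|_ [w wr [Uw zw]]] := Hd (q1.1, xi) _ (ltW xd); first by rewrite subrr normr0 ltW.
  have we : mag (xi + w *: e - q1.2) <= rho + rho.
    by rewrite addrAC (le_trans (magD _ _))// lerD ?(ltW xrho)// (le_trans (e1 w)).
  have w0 : w = 0.
    apply: (inj xi); [exact: lt_trans xrho rho_rho1|exact: le_lt_trans we rr1|].
    by rewrite u0; apply: uz zw; exact: le_trans we rr0.
  by move: zw; rewrite /= w0 scale0r addr0.
- move=> y; set c := Dreal _ _ _ in c0; exists ((y 0 0 / c) *: e).
  have O1 : real_domain U (to_real q1) by rewrite /real_domain /= to_realK.
  have [d1 d2] := holo_leaf_diff hu O1.
  apply: etrans (diff_scale one _ d1) _; rewrite linearZ /=.
  have -> : 'd (fun xi => u (to_real (q1.1, xi))) (q1.2) e = c.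
    apply: etrans (congr1 (fun g => g e) d2) _.
    rewrite /leaf_derivative (bigD1 k)//= big1 ?addr0 => [|i ik]; rewrite !mxE ?eqxx ?mul1r//.
    by rewrite (negbTE ik) /= mul0r.
  apply/rowP => i; rewrite !mxE mulr1 -[_ *: _]/(_ * _) divfK//.
  by rewrite (ord1 i).
- have near2 : \forall q \near q1, `|q.1 - q1.1| <= r0 /\ mag (q.2 - q1.2) <= rho.
    apply/nbhs_prodP; exists rho => // q h1 h2; split => //; exact: le_trans h1 rho_r0.
  apply: filterS2 near1 near2 => q [Uq [w wr [Uw zw]]] [h1 h2]; split => //.
  exists (q.1, q.2 + w *: e) => //.
  have := ball q (q.1, q.2 + w *: e) h1 erefl (le_trans h2 rho_r0) => /(_ _)[]// /=.
  rewrite addrAC (le_trans (magD _ _))// (le_trans _ rr0)// lerD//.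
  exact: le_trans (e1 w) wr.
Qed.

End LeafZeros.

(** * The singular points on the leaves *)

Section SingularSet.
Variable R : realType.
Local Notation C := R[i].
Variables d m : nat.
Local Notation n := (d + m)%N.
Local Notation N := (d + (m + m))%N.
Local Notation E := ('rV[R]_d * 'rV[C]_m)%type.
Variables (U : set E) (f : E -> 'rV[C]_n).
Hypotheses (U_open : open U) (U_connected : connected U)
  (f_analytic : real_analytic_map U f) (f_CR : CR_map U f)
  (f_diffeo : mixed_diffeo_onto_image U f)
  (M_generic : exists p, generic_at d (f @` U) p).
Local Notation S := (CR_singular_set (f @` U)).
Local Notation h := (degeneracy f).
Local Notation leaf p := (f @` Levi_leaf U p).

Let singularE q : U q -> S (f q) <-> h (to_real q) = 0.
Proof. move=> Uq; exact: CR_singularE. Qed.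

Let h_holo : holo_on (real_domain U) h.
Proof. exact: holo_degeneracy. Qed.

Let h_analytic q : U q -> analytic_at h (to_real q).
Proof. by move=> Uq; apply: (h_holo _).1; rewrite /real_domain /= to_realK. Qed.

Lemma singular_set_equation p : U p ->
  exists (V : set E) (g : E -> C),
    [/\ open V, V p, V `<=` U, real_analytic_on V g /\ holomorphic_in_xi V g &
      V `&` f @^-1` S = V `&` [set q | g q = 0]].
Proof.
move=> Up; exists U, (fun q => h (to_real q)).
split; [exact: U_open|exact: Up|exact: subset_refl| |].
  split=> q Uq.
    rewrite /comp; under eq_fun do rewrite of_realK.
    exact: h_analytic.
  have Oq : real_domain U (to_real q) by rewrite /real_domain /= to_realK.
  exact: (holo_leaf_diff h_holo Oq).1.
apply/seteqP; split=> q [Uq Hq]; split; [exact: Uq|exact: (singularE Uq).1|exact: Uq|exact: (singularE Uq).2].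
Qed.

Lemma singular_leaf_near p q : Levi_leaf U p q -> exists2 r : R, 0 < r &
  forall xi, mag (xi - q.2) < r -> [/\ U (q.1, xi), Levi_leaf U p (q.1, xi) &
    (S `&` leaf p) (f (q.1, xi)) <-> h (to_real (q.1, xi)) = 0].
Proof.
move=> Lq; have [Uq qp] := Levi_leaf_sub Lq.
have [r r0 ball] := Levi_leaf_ball U_open Uq; exists r => // xi xr.
have [Uxi _] : U (q.1, xi) /\ Levi_leaf U (q.1, xi) q.
  by apply: ball; rewrite /= ?subrr ?normr0 ?mag0 ?ltW.
have [_ Lxi] : U q /\ Levi_leaf U q (q.1, xi).
  by apply: ball; rewrite /= ?subrr ?normr0 ?mag0 ?ltW.
have {}Lxi : Levi_leaf U p (q.1, xi) by rewrite (Levi_leaf_eq Lq).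
split => //; split=> [[/(singularE Uxi)]//|/(singularE Uxi) h0].
by split => //; exists (q.1, xi).
Qed.

Lemma singular_leaf_analytic p : U p -> analytic_subvariety (leaf p) (S `&` leaf p).
Proof.
move=> Up; split=> [z []//|_ [q Lq <-]]; have [Uq qp] := Levi_leaf_sub Lq.
have [r r0 Hr] := singular_leaf_near Lq.
pose one : 'rV[C]_1 := const_mx 1.
pose phi (xi : 'rV[C]_m) : 'rV[C]_1 := h (to_real (q.1, xi)) *: one.
have one0 (a : C) : a *: one = 0 <-> a = 0.
  by split=> [/rowP /(_ 0)|->]; rewrite ?scale0r// !mxE mulr1.
have XL : S `&` leaf p `<=` leaf q by move=> z [_]; rewrite (Levi_leaf_eq Lq).
have Hphi xi : mag (xi - q.2) < r -> differentiable phi xi /\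
    ((S `&` leaf p) (f (q.1, xi)) <-> phi xi = 0).
  move=> xr; have [Uxi Lxi HX] := Hr _ xr; split; last by rewrite HX one0.
  have Oxi : real_domain U (to_real (q.1, xi)) by rewrite /real_domain /= to_realK.
  apply: dfunZl; exact: (holo_leaf_diff h_holo Oxi).1.
have [V [G [oV Vq hol XV _]]] :=
  leaf_equation U_open f_analytic f_CR f_diffeo Uq r0 XL Hphi.
by exists V, _, G.
Qed.

(** The zero map to the space of dimension 0 is an equation of the whole
    leaf. *)
Lemma full_leaf_dim p : U p -> (forall q, Levi_leaf U p q -> h (to_real q) = 0) ->
  variety_dim (S `&` leaf p) m.
Proof.
move=> Up Hz; split.
  exists (f p); have [r r0 Hr] := singular_leaf_near (Levi_leaf_self Up).
  have H0 xi : mag (xi - p.2) < r -> differentiable (fun=> 0 : 'rV[C]_0) xi /\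
      ((S `&` leaf p) (f (p.1, xi)) <-> 0 = 0 :> 'rV[C]_0).
    move=> xr; split; first exact: dfun_cst.
    have [Uxi Lxi HX] := Hr _ xr; split => // _.
    by apply/HX; apply: Hz.
  have := leaf_regular_point U_open f_analytic f_CR f_diffeo Up r0 (@subIsetr _ _ _) H0 erefl.
  rewrite subn0; apply => y; exists 0; by apply/rowP => -[].
move=> s z rp; have [_ [_ [q Lq zq]] _] := rp; have [Uq _] := Levi_leaf_sub Lq.
rewrite -zq in rp.
apply: (leaf_dim_bound U_open f_analytic f_CR f_diffeo Uq _ rp).1.
by move=> w [_]; rewrite (Levi_leaf_eq Lq).
Qed.

(** At a regular point of dimension [m], [h] would vanish on an open part of
    the leaf, hence on all of it. *)
Lemma proper_leaf_dim p : (0 < m)%N -> U p ->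
  (exists2 q, Levi_leaf U p q & h (to_real q) = 0) ->
  (exists2 q, Levi_leaf U p q & h (to_real q) <> 0) ->
  variety_dim (S `&` leaf p) (m - 1).
Proof.
move=> m0 Up zz nz; split.
  have [q1 [phi [rho [[L1 rho0] p0 Hphi sur _]]]] := leaf_zero_structure U_open h_holo zz nz.
  have [r r0 Hr] := singular_leaf_near L1; have [U1 _] := Levi_leaf_sub L1.
  exists (f q1).
  apply: (@leaf_regular_point R d m U f U_open f_analytic f_CR f_diffeo q1 1 phi (Num.min rho r)) => //.
  - by rewrite lt_min rho0.
  - by move=> z [_]; rewrite (Levi_leaf_eq L1).
  - move=> xi; rewrite lt_min => /andP[x1 x2].
    have [dp [_ _ H]] := Hphi _ x1; have [_ _ H2] := Hr _ x2; split => //.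
    exact: iff_trans H2 H.
move=> s z rp; have [_ [_ [q Lq zq]] _] := rp; have [Uq qp] := Levi_leaf_sub Lq.
rewrite -zq in rp.
have XL : S `&` leaf p `<=` leaf q by move=> w [_]; rewrite (Levi_leaf_eq Lq).
have [sm full] := leaf_dim_bound U_open f_analytic f_CR f_diffeo Uq XL rp.
have [sE|sne] := eqVneq s m; last by lia.
have [r r0 Hr] := full sE; have [r' r'0 Hr'] := singular_leaf_near Lq.
have [q2 L2 []] := nz.
have e0 : 0 < Num.min r r' / 2 by rewrite divr_gt0// lt_min r0.
apply: (identity_leaf U_open h_analytic Lq e0) => // -[x xi] /= xp xr.
have : mag (xi - q.2) < Num.min r r'.
  by apply: le_lt_trans xr _; rewrite ltr_pdivrMr// ltr_pMr ?ltr1n// lt_min r0.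
rewrite lt_min xp -qp => /andP[x1 x2]; have [_ _ H] := Hr' _ x2.
by apply/H; exact: Hr.
Qed.

Lemma singular_leaf_cases p : (0 < m)%N -> U p ->
  S `&` leaf p = set0 \/
  (analytic_subvariety (leaf p) (S `&` leaf p) /\
   (variety_dim (S `&` leaf p) m \/ variety_dim (S `&` leaf p) (m - 1))).
Proof.
move=> m0 Up.
have [zz|nz] := pselect (exists2 q, Levi_leaf U p q & h (to_real q) = 0); last first.
  left; apply/seteqP; split => // z [Sz [q Lq zq]]; apply: nz; exists q => //.
  by apply/(singularE (Levi_leaf_sub Lq).1); rewrite zq.
right; split; first exact: singular_leaf_analytic.
have [nz|an] := pselect (exists2 q, Levi_leaf U p q & h (to_real q) <> 0).
  by right; exact: proper_leaf_dim.
left; apply: full_leaf_dim => // q Lq; apply: contrapT => hq; apply: an; by exists q.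
Qed.

(** All the leaves near [q1] contain zeros, by [leaf_zero_structure]. That all
    the leaves near [q] contain zeros is a locally constant property of the
    point [q] of the leaf, because a leaf that passes near [q] passes near the
    neighboring points as well. *)
Lemma singular_leaves_near p : (0 < m)%N -> U p -> variety_dim (S `&` leaf p) (m - 1) ->
  exists W : set 'rV[C]_n, [/\ open W, leaf p `<=` W &
    forall p', U p' -> leaf p' `&` W !=set0 -> S `&` leaf p' !=set0].
Proof.
move=> m0 Up [[z rz] bound].
have zz : exists2 q, Levi_leaf U p q & h (to_real q) = 0.
  have [_ [Sz [q Lq zq]] _] := rz; exists q => //.
  by apply/(singularE (Levi_leaf_sub Lq).1); rewrite zq.
have nz : exists2 q, Levi_leaf U p q & h (to_real q) <> 0.
  apply: contrapT => an.
  have [|[z' rz'] _] := @full_leaf_dim p Up.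
    move=> q Lq; apply: contrapT => hq; apply: an; by exists q.
  by have := bound _ _ rz'; lia.
have [q1 [phi [rho [[L1 rho0] _ _ _ near1]]]] := leaf_zero_structure U_open h_holo zz nz.
pose Q (q : E) := \forall q' \near q, U q' /\ exists2 q'', Levi_leaf U q' q'' & h (to_real q'') = 0.
have step q q' (r : R) : 0 < r -> q'.1 = q.1 ->
    (forall x, `|x - q.1| <= r -> Levi_leaf U (x, q.2) (x, q'.2)) -> U q' ->
    Q q -> Q q'.
  move=> r0 qq same Uq' /nbhs_prodP [r1 r10 H1]; have [r2 r20 ball] := Levi_leaf_ball U_open Uq'.
  apply/nbhs_prodP; exists (Num.min r (Num.min r1 r2)); first by rewrite !lt_min r0 r10.
  move=> q0; rewrite !le_min => /and3P[a1 a2 a3] /and3P[b1 b2 b3].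
  have [U0 L0] := ball q0 (q0.1, q'.2) a3 erefl b3 (eq_ind_r (fun t => mag t <= r2) (eq_ind_r (fun t => t <= r2) (ltW r20) (mag0 _)) (subrr _)).
  rewrite qq in a1 a2; split => //.
  have [|_ [q'' L'' z'']] := H1 (q0.1, q.2) a2; first by rewrite /= subrr mag0 ltW.
  exists q'' => //; rewrite (Levi_leaf_eq L0) -(Levi_leaf_eq (same _ a1)).
  exact: L''.
have near_leaf q : Levi_leaf U p q -> exists2 r : R, 0 < r & forall q', Levi_leaf U p q' ->
    mag (q'.2 - q.2) <= r -> Q q <-> Q q'.
  move=> Lq; have [Uq qp] := Levi_leaf_sub Lq.
  have [r r0 ball] := Levi_leaf_ball U_open Uq; exists r; first exact: r0.
  move=> q' Lq' qr.
  have [Uq' qp'] := Levi_leaf_sub Lq'.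
  have qq : q'.1 = q.1 by rewrite qp qp'.
  have b0 : mag (q.2 - q.2) <= r by rewrite subrr mag0 ltW.
  split.
    apply: (step _ _ _ r0 qq _ Uq') => x xr.
    exact: (ball (x, q.2) (x, q'.2) xr erefl b0 qr).2.
  apply: (step _ _ _ r0 (esym qq) _ Uq) => x xr.
  by rewrite qq in xr; exact: (ball (x, q'.2) (x, q.2) xr erefl qr b0).2.
have allQ q : Levi_leaf U p q -> Q q.
  have nbh (x : E) (r : R) : 0 < r -> \forall y \near x, mag (y.2 - x.2) <= r.
    by move=> r0; apply/nbhs_prodP; exists r.
  apply: (@connected_locally_constant _ (Levi_leaf U p) Q q1 (@Levi_leaf_connected _ _ _ U p) L1 near1).
    move=> x Lx Qx; have [r r0 Hr] := near_leaf _ Lx.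
    apply: filterS (nbh x r r0) => y yr Ly; exact: (Hr y Ly yr).1.
  move=> x Lx Qx; have [r r0 Hr] := near_leaf _ Lx.
  apply: filterS (nbh x r r0) => y yr Ly /(Hr y Ly yr).2; exact: Qx.
have /choice [V HV] : forall q, exists V : set 'rV[C]_n, Levi_leaf U p q ->
    [/\ open V, V (f q) & forall q', U q' -> V (f q') ->
       exists2 q'', Levi_leaf U q' q'' & h (to_real q'') = 0].
  move=> q; have [Lq|] := pselect (Levi_leaf U p q); last by exists setT.
  have [V [oV Vq H]] := f_embedding f_diffeo (Levi_leaf_sub Lq).1 (allQ _ Lq).
  by exists V => _; split => // q' Uq' /(H _ Uq') [_].
exists (\bigcup_(q in Levi_leaf U p) V q); split.
- by apply: bigcup_open => q /HV [].
- by move=> _ [q Lq <-]; exists q => //; have [] := HV q Lq.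
move=> p' Up' [_ [[q' Lq' <-] [q Lq Vq']]].
have [_ _ H] := HV q Lq; have [Uq' _] := Levi_leaf_sub Lq'.
have [q'' L'' z''] := H _ Uq' Vq'; exists (f q''); split.
  by apply/(singularE (Levi_leaf_sub L'').1).
by exists q'' => //; rewrite (Levi_leaf_eq Lq').
Qed.

End SingularSet.

(** Naming the dimension [m] of the leaves lets [n] be replaced by [d + m],
    which makes the complex Jacobian a square matrix. *)
Lemma CR_singular_leaves (R : realType) (n d m : nat) (U : set ('rV[R]_d * 'rV[R[i]]_m))
    (f : 'rV[R]_d * 'rV[R[i]]_m -> 'rV[R[i]]_n) :
  n = (d + m)%N -> (0 < m)%N -> open U -> connected U ->
  real_analytic_map U f -> CR_map U f -> mixed_diffeo_onto_image U f ->
  (exists p, generic_at d (f @` U) p) ->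
  let S := CR_singular_set (f @` U) in
  [/\ forall p, U p ->
        exists (V : set ('rV[R]_d * 'rV[R[i]]_m)) (h : 'rV[R]_d * 'rV[R[i]]_m -> R[i]),
          [/\ open V, V p, V `<=` U,
              real_analytic_on V h /\ holomorphic_in_xi V h &
              V `&` f @^-1` S = V `&` [set q | h q = 0]],
      forall L, is_leaf U f L -> S `&` L = set0 \/
        (analytic_subvariety L (S `&` L) /\
         (variety_dim (S `&` L) m \/ variety_dim (S `&` L) (m - 1)%N))
    & forall L, is_leaf U f L -> variety_dim (S `&` L) (m - 1)%N ->
        exists W : set 'rV[R[i]]_n,
          [/\ open W, L `<=` W &
              forall L', is_leaf U f L' -> L' `&` W !=set0 -> S `&` L' !=set0]].
Proof.
move=> nE m0 oU cU fa fCR fd gen S; subst n; split.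
- by move=> p Up; exact: singular_set_equation.
- by move=> L [p Up ->]; exact: singular_leaf_cases.
- move=> L [p Up ->] dimL.
  have [W [oW LW H]] := singular_leaves_near oU cU fa fCR fd gen m0 Up dimL.
  by exists W; split => // L' [p' Up' ->]; exact: H.
Qed.

Theorem theorem5p1 (R : realType) (n d : nat)
  (hn : (3 <= n)%N) (hdn : (d < n)%N) (hd : (2 <= d)%N)
  (U : set ('rV[R]_d * 'rV[R[i]]_(n - d)))
  (f : 'rV[R]_d * 'rV[R[i]]_(n - d) -> 'rV[R[i]]_n)
  (U_open : open U) (U_connected : connected U)
  (f_analytic : real_analytic_map U f) (f_CR : CR_map U f)
  (f_diffeo : mixed_diffeo_onto_image U f)
  (M_generic : exists p, generic_at d (f @` U) p) :
  let S := CR_singular_set (f @` U) in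
  [/\ forall p, U p ->
        exists (V : set ('rV[R]_d * 'rV[R[i]]_(n - d)))
               (h : 'rV[R]_d * 'rV[R[i]]_(n - d) -> R[i]),
          [/\ open V, V p, V `<=` U,
              real_analytic_on V h /\ holomorphic_in_xi V h &
              V `&` f @^-1` S = V `&` [set q | h q = 0]],
      forall L, is_leaf U f L ->
        S `&` L = set0 \/
        (analytic_subvariety L (S `&` L) /\
         (variety_dim (S `&` L) (n - d)%N \/
          variety_dim (S `&` L) (n - d - 1)%N))
    & forall L, is_leaf U f L -> variety_dim (S `&` L) (n - d - 1)%N ->
        exists W : set 'rV[R[i]]_n,
          [/\ open W, L `<=` W &
              forall L', is_leaf U f L' -> L' `&` W !=set0 ->
                S `&` L' !=set0]].
Proof.
apply: (@CR_singular_leaves R n d (n - d)) => //; first by rewrite subnKC// ltnW.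
by rewrite subn_gt0.
Qed.
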